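(* Fix an integer $D\geq 1$ and a constant $C>0$. Let $k$ be an even integer, written as $k=12\ell+k'$ with $k'\in\{0,4,6,8,10,14\}$ and $\ell\geq D+1$, and let $f\in S_k$ be a cusp form of weight $k$ for $\mathrm{SL}(2,\mathbb Z)$ whose $q$-expansion has the shape \[ f=q^{\ell-D}\left(1+a(1)q+\dots+a(D)q^D\right)+O\!\left(q^{\ell+1}\right), \] with complex coefficients satisfying $|a(j)|\leq C$ for $j=1,\dots,D$. Then the $D$ zeros $\tau_1,\dots,\tau_D$ of $f$ in the fundamental domain $\mathcal F$ that are not zeros forced by $E_{k'}$ (i.e. the zeros of $f/E_{k'}$ in $\mathcal F$), suitably labeled, satisfy \[ \tau_r=\frac{\sqrt{-1}}{2\pi}\log\left(2k\, z_{D,r}\right)+O\!\left(\frac1k\right),\qquad r=1,\dots,D, \] as $k\to\infty$, where the implied constant depends only on $D$ and $C$, and $\log$ denotes the branch of the logarithm with argument in $[-\pi,\pi)$.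
   Context: $\mathbb H=\{\tau:\operatorname{Im}\tau>0\}$, $q=e^{2\pi i\tau}$. $M_k$ is the space of holomorphic modular forms of weight $k$ for $\mathrm{SL}(2,\mathbb Z)$ and $S_k\subset M_k$ the cusp forms (those with vanishing constant term in the $q$-expansion). For even $k\geq 4$, $E_k(\tau)=1-\frac{2k}{B_k}\sum_{n\geq1}\sigma_{k-1}(n)q^n$ is the normalized Eisenstein series ($B_k$ the Bernoulli numbers, $\sigma_s(n)=\sum_{d\mid n}d^s$), and $E_0=1$. The fundamental domain is $\mathcal F=\{\tau\in\mathbb H:\operatorname{Re}\tau\in[-1/2,1/2),\ |\tau|\geq1\}$, where if $|\tau|=1$ one requires $\operatorname{Re}\tau\leq 0$. Every form of weight $k=12\ell+k'$ is divisible by $E_{k'}$. $\mathcal E_D(t)=1+t+\frac{t^2}{2!}+\dots+\frac{t^D}{D!}$ is the truncated exponential polynomial, and $z_{D,1},\dots,z_{D,D}$ are its inverse zeros, defined by $\mathcal E_D(t)=\prod_{r=1}^D(1-z_{D,r}t)$.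
   Formalization: When z_{D,r} is a negative real, the estimate is claimed only for τ_r or for τ_r+1, since the branch with argument −π gives real part 1/2, outside 𝓕 (for D=1, a(1)=0 the zero has real part −1/2). *)

(* Defs.v *)
From HB Require Import structures.
From mathcomp Require Import all_boot all_order all_algebra.
From mathcomp Require Import complex.
From mathcomp Require Import all_classical all_reals all_analysis.

Set Implicit Arguments.
Unset Strict Implicit.
Unset Printing Implicit Defensive.

Import Order.TTheory GRing.Theory Num.Theory.
Import numFieldNormedType.Exports.

Local Open Scope classical_set_scope.
Local Open Scope ring_scope.
Local Open Scope complex_scope.

(* [R[i]] carries the topology, limits and derivatives of the library only
   through the alias [R[i]^o], hence the casts to [R[i]^o] below. *)

Definition cexp (R : realType) (z : R[i]) : R[i] :=
  (expR (complex.Re z))%:C * (cos (complex.Im z) +i* sin (complex.Im z)).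

Definition cabs (R : realType) (z : R[i]) : R := Normc.normc z.

(* The argument in [-pi, pi): a negative real number has argument -pi. *)
Definition carg (R : realType) (z : R[i]) : R :=
  if 0 < complex.Im z then acos (complex.Re z / cabs z)
  else - acos (complex.Re z / cabs z).

Definition clog (R : realType) (z : R[i]) : R[i] := ln (cabs z) +i* carg z.

Definition upper_half (R : realType) : set R[i] :=
  [set tau | 0 < complex.Im tau].

Definition holomorphic_uh (R : realType) (f : R[i] -> R[i]) : Prop :=
  forall tau, upper_half tau -> derivable (f : R[i]^o -> R[i]^o) tau 1.

Definition nome (R : realType) (tau : R[i]) : R[i] :=
  cexp (2 * pi%:C * 'i%C * tau).

Definition is_qexpansion (R : realType) (f : R[i] -> R[i]) (c : nat -> R[i]) :=
  forall tau, upper_half tau ->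
    (series (fun n => c n * nome tau ^+ n : R[i]^o) @ \oo
       --> (f tau : R[i]^o)).

Definition slash_invariant (R : realType) (k : nat) (f : R[i] -> R[i]) : Prop :=
  forall a b c d : int, a * d - b * c = 1 ->
  forall tau, upper_half tau ->
    f ((a%:~R * tau + b%:~R) / (c%:~R * tau + d%:~R))
    = (c%:~R * tau + d%:~R) ^+ k * f tau.

Definition modular_form (R : realType) (k : nat) (f : R[i] -> R[i]) : Prop :=
  [/\ holomorphic_uh f, slash_invariant k f & exists c, is_qexpansion f c].

Definition cusp_form (R : realType) (k : nat) (f : R[i] -> R[i]) : Prop :=
  modular_form k f /\ exists2 c, is_qexpansion f c & c 0%N = 0.

(* [bernoulli_upto n] is [:: B_0; ...; B_(n-1)], computed from the recurrence
   sum_(j <= m) 'C(m.+1, j) * B_j = (m == 0). *)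
Fixpoint bernoulli_upto (n : nat) : seq rat :=
  if n is m.+1 then
    let s := bernoulli_upto m in
    rcons s (((m == 0%N)%:R - \sum_(j < m) 'C(m.+1, j)%:R * s`_j) / m.+1%:R)
  else [::].

Definition bernoulli (n : nat) : rat := (bernoulli_upto n.+1)`_n.

Definition sigma (s n : nat) : nat := (\sum_(d <- divisors n) d ^ s)%N.

(* For k = 0 all coefficients with n > 0 vanish, which gives E_0 = 1. *)
Definition eisenstein_coef (R : realType) (k n : nat) : R[i] :=
  if n == 0%N then 1
  else - ((2 * k)%N%:R / ratr (bernoulli k)) * (sigma k.-1 n)%:R.

Definition eisenstein (R : realType) (k : nat) (tau : R[i]) : R[i] :=
  limn (series (fun n => eisenstein_coef R k n * nome tau ^+ n : R[i]^o)).

Definition fund_domain (R : realType) : set R[i] :=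
  [set tau | [/\ upper_half tau,
                 - 2^-1 <= complex.Re tau < 2^-1,
                 1 <= cabs tau
               & cabs tau = 1 -> complex.Re tau <= 0]].

(* f = q^(l-D) (1 + a(1) q + ... + a(D) q^D) + O(q^(l+1)), as q-series. *)
Definition has_shape (R : realType) (f : R[i] -> R[i]) (l D : nat)
    (a : nat -> R[i]) : Prop :=
  exists2 c : nat -> R[i], is_qexpansion f c &
    forall n, (n <= l)%N ->
      c n = ('X^(l - D) * (1 + \sum_(1 <= j < D.+1) a j *: 'X^j))`_n.

Definition zero_order (R : realType) (h : R[i] -> R[i]) (t : R[i]) (n : nat) :=
  (forall j, (j < n)%N -> derive1n j (h : R[i]^o -> R[i]^o) t = 0) /\
  derive1n n (h : R[i]^o -> R[i]^o) t != 0.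

(* [tau] lists, with multiplicity, the zeros of [h] in the fundamental
   domain; in particular [zero_order h t 0] says that [h t != 0]. *)
Definition lists_zeros (R : realType) (D : nat) (h : R[i] -> R[i])
    (tau : 'I_D -> R[i]) : Prop :=
  (forall r, fund_domain (tau r)) /\
  (forall t, fund_domain t -> zero_order h t #|[pred r | tau r == t]|).

Definition trunc_exp (R : realType) (D : nat) : {poly R[i]} :=
  \poly_(j < D.+1) (j`!%:R)^-1.

Definition inverse_zeros (R : realType) (D : nat) (z : 'I_D -> R[i]) : Prop :=
  trunc_exp R D = \prod_(r < D) (1 - z r *: 'X).

(* Main.v *)
(* Write f = E_k' Delta^(l-D) prod_r (E_4^3 - w_r Delta). The coefficients of the
   polynomial with roots w_r solve a triangular system, and the two sides agree
   because a form vanishing beyond the Sturm bound is zero. The j-th coefficient of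
   (Delta/q)^N is equivalent to (-24 N)^j / j!, and 24 N = 2k + O(1), so that after
   rescaling by powers of 2k the system tends, with an error O(1/k), to one whose
   solution is 1/m!. Hence w_r = 2k z_r + O(1). For large w the equation
   E_4^3 = w Delta has, by contraction, exactly one solution in the fundamental
   domain; it is simple and its nome is 1/w + O(1/w^2), whence the logarithm.

   No complex integration is needed: E_4 and E_6 are modular by the Lipschitz
   formula, which follows from Herglotz' duplication trick, and the Sturm bound is a
   maximum principle that compares a value with those at four surrounding points. *)
Require Import Defs.
From HB Require Import structures.
From mathcomp Require Import all_boot all_order all_algebra.
From mathcomp Require Import complex.
From mathcomp Require Import all_classical all_reals all_analysis.
From mathcomp Require Import ring lra zify.

Set Implicit Arguments.
Unset Strict Implicit.
Unset Printing Implicit Defensive.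

Import Order.TTheory GRing.Theory Num.Theory.
Import numFieldNormedType.Exports.

Local Open Scope ring_scope.
Local Open Scope complex_scope.

(** * Modulus, real part and imaginary part *)

Section Modulus.
Variable R : realType.
Local Notation C := R[i].
Implicit Types (x y z : C) (a b e : R).

(** Forms are treated as functions of the nome on the unit disc, with Taylor remainders uniform on
    smaller discs. Translation invariance is then built in, only the inversion has to be checked,
    and a step size can be fixed before the point it is used at.

    The comparison at four points needs a positive power of Im tau to balance the weight. Weights 12
    m - 2 v with v > 0 have one; a form of weight 12 m + 2, the case k' = 14, does not and is
    treated through its square and its cube.

    The delicate point of the logarithm is the branch. If z_r is a negative real number, as happens
    for odd D, then arg z_r = - pi and the point (i / 2 pi) log (2 k z_r) has real part 1/2, an edge
    that the fundamental domain omits. The zero may then be close to that point or to its translate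
    by - 1, so the conclusion has a second alternative for z_r < 0. For every other r the argument
    keeps a fixed distance from the cut.

    Since K and k0 are chosen before z, constants are computed from one reference list; any other
    list of inverse zeros is a permutation of it. *)

Lemma cabsE z : `|z| = (cabs z)%:C.
Proof. by case: z => a b; rewrite normc_def. Qed.

Lemma cabs_ge0 z : 0 <= cabs z.
Proof. by rewrite -lecR -cabsE; exact: normr_ge0. Qed.

Lemma cabs0 : cabs (0 : C) = 0. Proof. exact: Normc.normc0. Qed.
Lemma cabs1 : cabs (1 : C) = 1. Proof. exact: Normc.normc1. Qed.

Lemma cabsM x y : cabs (x * y) = cabs x * cabs y.
Proof. exact: Normc.normcM. Qed.

Lemma cabsV x : cabs x^-1 = (cabs x)^-1.
Proof. exact: Normc.normcV. Qed.

Lemma cabsX x n : cabs (x ^+ n) = cabs x ^+ n.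
Proof. by elim: n => [|n IH]; rewrite ?expr0 ?cabs1// !exprS cabsM IH. Qed.

Lemma cabsN x : cabs (- x) = cabs x.
Proof. exact: normcN. Qed.

Lemma cabsD x y : cabs (x + y) <= cabs x + cabs y.
Proof. exact: le_normcD. Qed.

Lemma cabsB x y : cabs (x - y) <= cabs x + cabs y.
Proof. by rewrite -(cabsN y) cabsD. Qed.

Lemma cabsC x y : cabs (x - y) = cabs (y - x).
Proof. by rewrite -cabsN opprB. Qed.

Lemma cabs_eq0 x : (cabs x == 0) = (x == 0).
Proof.
apply/eqP/eqP => [|->]; last exact: cabs0.
exact: Normc.eq0_normc.
Qed.

Lemma cabs_gt0 x : (0 < cabs x) = (x != 0).
Proof. by rewrite lt_neqAle cabs_ge0 andbT eq_sym cabs_eq0. Qed.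

Lemma cabs_triB x y z : cabs (x - z) <= cabs (x - y) + cabs (y - z).
Proof. by rewrite -[x - z](subrKA y) cabsD. Qed.

Lemma cabs_subl x y : cabs x - cabs y <= cabs (x - y).
Proof. by rewrite lerBlDr -{1}(subrK y x) cabsD. Qed.

Lemma cabs_addl x y : cabs x - cabs y <= cabs (x + y).
Proof. by rewrite -(cabsN y) -{2}(opprK y) cabs_subl. Qed.

Lemma cabs_real a : cabs a%:C = `|a|.
Proof. by rewrite /cabs /= expr0n /= addr0 sqrtr_sqr. Qed.

Lemma cabs_nat n : cabs (n%:R : C) = n%:R.
Proof. by rewrite -(rmorph_nat (real_complex R)) cabs_real normr_nat. Qed.

Lemma cabsi : cabs ('i%C : C) = 1.
Proof. by rewrite /cabs /= expr0n expr1n add0r sqrtr1. Qed.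

Lemma cabs_sqr z : cabs z ^+ 2 = complex.Re z ^+ 2 + complex.Im z ^+ 2.
Proof.
by case: z => a b; rewrite /cabs /= sqr_sqrtr// addr_ge0 ?sqr_ge0.
Qed.

Lemma cReD x y : complex.Re (x + y) = complex.Re x + complex.Re y.
Proof. by case: x; case: y. Qed.
Lemma cImD x y : complex.Im (x + y) = complex.Im x + complex.Im y.
Proof. by case: x; case: y. Qed.
Lemma cReN x : complex.Re (- x) = - complex.Re x.
Proof. by case: x. Qed.
Lemma cImN x : complex.Im (- x) = - complex.Im x.
Proof. by case: x. Qed.
Lemma cReM x y : complex.Re (x * y) =
  complex.Re x * complex.Re y - complex.Im x * complex.Im y.
Proof. by case: x; case: y. Qed.
Lemma cImM x y : complex.Im (x * y) =
  complex.Re x * complex.Im y + complex.Im x * complex.Re y.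
Proof. by case: x => a b; case: y => c d /=; rewrite [b * c]mulrC [c * b]mulrC. Qed.
Lemma cRe_nat n : complex.Re (n%:R : C) = n%:R.
Proof. by rewrite -(rmorph_nat (real_complex R)). Qed.
Lemma cIm_nat n : complex.Im (n%:R : C) = 0.
Proof. by rewrite -(rmorph_nat (real_complex R)). Qed.

Lemma complex_ReIm (z : C) : z = (complex.Re z)%:C + 'i%C * (complex.Im z)%:C.
Proof. exact: complexE. Qed.

Lemma cabsRe z : `|complex.Re z| <= cabs z.
Proof.
rewrite -(ler_pXn2r (n := 2)) ?nnegrE ?cabs_ge0// cabs_sqr.
by rewrite -normrX ger0_norm ?sqr_ge0// lerDl sqr_ge0.
Qed.

Lemma cabsIm z : `|complex.Im z| <= cabs z.
Proof.
rewrite -(ler_pXn2r (n := 2)) ?nnegrE ?cabs_ge0// cabs_sqr.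
by rewrite -normrX ger0_norm ?sqr_ge0// lerDr sqr_ge0.
Qed.

Lemma cabs_ReIm z : cabs z <= `|complex.Re z| + `|complex.Im z|.
Proof.
rewrite {1}(complex_ReIm z); apply: (le_trans (cabsD _ _)).
by rewrite cabsM cabsi mul1r !cabs_real.
Qed.

Lemma cabs_sum (I : Type) (s : seq I) (P : pred I) (F : I -> C) :
  cabs (\sum_(i <- s | P i) F i) <= \sum_(i <- s | P i) cabs (F i).
Proof.
elim/big_rec2: _ => [|i y1 y2 _ h]; first by rewrite cabs0.
by apply: (le_trans (cabsD _ _)); rewrite lerD2l.
Qed.

Lemma cabs_prod (I : Type) (s : seq I) (P : pred I) (F : I -> C) :
  cabs (\prod_(i <- s | P i) F i) = \prod_(i <- s | P i) cabs (F i).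
Proof. exact: (big_morph (@cabs R) cabsM cabs1). Qed.

(** The factorization of x^(n+1) - y^(n+1) by x - y leaves n + 1 monomials, each of modulus at most
    a^n. *)
Lemma cabs_expB x y a n : cabs x <= a -> cabs y <= a ->
  cabs (x ^+ n.+1 - y ^+ n.+1) <= n.+1%:R * a ^+ n * cabs (x - y).
Proof.
move=> hx hy; have a0 : 0 <= a := le_trans (cabs_ge0 _) hx.
rewrite subrXX cabsM mulrC ler_wpM2r ?cabs_ge0//.
apply: (le_trans (cabs_sum _ _ _)).
have : \sum_(i < n.+1) a ^+ n = n.+1%:R * a ^+ n.
  by rewrite sumr_const card_ord mulr_natl.
move=> <-; apply: ler_sum => i _; rewrite cabsM !cabsX.
have -> : a ^+ n = a ^+ (n.+1.-1 - i) * a ^+ i.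
  by rewrite -exprD subnK// -ltnS.
by apply: ler_pM; rewrite ?exprn_ge0 ?cabs_ge0// lerXn2r// nnegrE ?cabs_ge0.
Qed.

End Modulus.

(** * Limits of complex sequences and sums of series *)

Section Limits.
Variable R : realType.
Local Notation C := R[i].
Implicit Types (u v : nat -> C) (l m : C).

(** Epsilons are real and the inequality is weak, so that bounds pass to the limit unchanged and
    [lra] can finish; [climP] translates to the filter convergence of the library. *)
Definition clim u l := forall e : R, 0 < e ->
  exists N, forall n, (N <= n)%N -> cabs (u n - l) <= e.

Lemma climP u l : clim u l <-> ((u : nat -> C^o) @ \oo --> (l : C^o))%classic.
Proof.
split=> [h|h].
  apply/cvgrPdist_le => e e0.
  have e1 : 0 < complex.Re e by move: e0; rewrite ltcE /= => /andP[].
  have e2 : e = (complex.Re e)%:C.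
    by move: e0; rewrite ltcE /= => /andP[/eqP h1 _]; case: (e) h1 => a b /= ->.
  have [N hN] := h _ e1; exists N => // n /= hn.
  by rewrite e2 cabsE lecR cabsC hN.
move=> e e0; move/cvgrPdist_le: h => /(_ e%:C).
rewrite ltcR => /(_ e0) [N _ hN]; exists N => n hn.
by have := hN n hn; rewrite cabsE lecR cabsC.
Qed.

Lemma clim_bound u l (b : C) (e : R) N : clim u l ->
  (forall n, (N <= n)%N -> cabs (u n - b) <= e) -> cabs (l - b) <= e.
Proof.
move=> h hb; rewrite leNgt; apply/negP => hlt.
have d0 : 0 < (cabs (l - b) - e) / 2 by lra.
have [M hM] := h _ d0.
have h1 := hM _ (leq_maxr N M); have h2 := hb _ (leq_maxl N M).
have := cabs_triB l (u (maxn N M)) b; rewrite (cabsC l (u _)); lra.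
Qed.

Lemma clim_unique u l m : clim u l -> clim u m -> l = m.
Proof.
move=> hl hm; apply/eqP; rewrite -subr_eq0 -cabs_eq0 eq_le cabs_ge0 andbT.
apply/ler_addgt0Pl => e e0; rewrite addr0.
have [N hN] := hm _ e0.
by have := clim_bound hl hN.
Qed.

Lemma clim_eq u v l N : (forall n, (N <= n)%N -> u n = v n) -> clim u l -> clim v l.
Proof.
move=> h hu e e0; have [M hM] := hu _ e0; exists (maxn N M) => n.
by rewrite geq_max => /andP[hn1 hn2]; rewrite -h// hM.
Qed.

Lemma clim_cst l : clim (fun=> l) l.
Proof. by move=> e e0; exists 0%N => n _; rewrite subrr cabs0 ltW. Qed.

Lemma climD u v l m : clim u l -> clim v m -> clim (fun n => u n + v n) (l + m).
Proof.
move=> hu hv e e0; have e2 : 0 < e / 2 by lra.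
have [N hN] := hu _ e2; have [M hM] := hv _ e2; exists (maxn N M) => n.
rewrite geq_max => /andP[hn1 hn2].
have := hN n hn1; have := hM n hn2.
have -> : u n + v n - (l + m) = (u n - l) + (v n - m) by ring.
have := cabsD (u n - l) (v n - m); lra.
Qed.

Lemma climZ u l m : clim u l -> clim (fun n => m * u n) (m * l).
Proof.
move=> hu e e0; have c0 : 0 < cabs m + 1 by rewrite ltr_wpDl ?cabs_ge0.
have [N hN] := hu _ (divr_gt0 e0 c0); exists N => n hn.
rewrite -mulrBr cabsM; have h := hN n hn.
apply: (@le_trans _ _ ((cabs m + 1) * (e / (cabs m + 1)))).
  by apply: ler_pM; rewrite ?cabs_ge0// lerDl.
by rewrite mulrC divfK// gt_eqF.
Qed.

Lemma climN u l : clim u l -> clim (fun n => - u n) (- l).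
Proof.
move=> h; rewrite -mulN1r; apply: clim_eq (climZ (-1) h) => // n _.
  exact: mulN1r. Unshelve. exact: 0%N.
Qed.

Lemma climB u v l m : clim u l -> clim v m -> clim (fun n => u n - v n) (l - m).
Proof. by move=> hu hv; apply: climD => //; apply: climN. Qed.

Lemma clim_sum (I : Type) (s : seq I) (U : I -> nat -> C) (L : I -> C) :
  (forall i, clim (U i) (L i)) ->
  clim (fun n => \sum_(i <- s) U i n) (\sum_(i <- s) L i).
Proof.
move=> h; elim: s => [|i s IH].
  rewrite big_nil; apply: (@clim_eq (fun=> 0) _ _ 0%N) (clim_cst 0) => n _.
  by rewrite big_nil.
rewrite big_cons; apply: (@clim_eq (fun n => U i n + \sum_(j <- s) U j n) _ _ 0%N).
  by move=> n _; rewrite big_cons.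
exact: climD.
Qed.

Lemma clim_sub u l (s : nat -> nat) : (forall n, (n <= s n)%N) -> clim u l ->
  clim (fun n => u (s n)) l.
Proof.
move=> hs h e e0; have [N hN] := h _ e0; exists N => n hn.
by apply: hN; apply: leq_trans (hs n).
Qed.

Lemma clim_shift u l k : clim (fun n => u (n + k)%N) l -> clim u l.
Proof.
move=> h e e0; have [N hN] := h _ e0; exists (N + k)%N => n hn.
have := hN (n - k)%N; rewrite subnK; first by apply; lia.
by apply: leq_trans hn; rewrite leq_addl.
Qed.

Lemma clim_squeeze u v l (w : nat -> R) : clim u l ->
  (forall e : R, 0 < e -> exists N, forall n, (N <= n)%N -> w n <= e) ->
  (forall n, cabs (v n - u n) <= w n) -> clim v l.
Proof.
move=> hu hw h e e0; have e2 : 0 < e / 2 by lra.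
have [N hN] := hu _ e2; have [M hM] := hw _ e2; exists (maxn N M) => n.
rewrite geq_max => /andP[hn1 hn2].
have := hN n hn1; have := hM n hn2; have := h n.
have := cabs_triB (v n) (u n) l; lra.
Qed.

(** Up to conversion this is the sum used in [eisenstein]. Without convergence its value means
    nothing; [csumP] provides the meaning from an absolute bound. *)
Definition csum (u : nat -> C) : C := limn (series (u : nat -> C^o)).

Lemma climP_csum u l : clim (fun n => \sum_(i < n) u i) l -> csum u = l.
Proof.
move=> h; apply: (@cvg_lim C^o); first exact: norm_hausdorff.
have -> : series (u : nat -> C^o) = (fun n => \sum_(i < n) u i).
  by apply/funext => n; rewrite /series /= big_mkord.
by apply/climP.
Qed.

Lemma rcvg_abs (u : nat -> R) (K : R) : (forall n, \sum_(i < n) `|u i| <= K) ->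
  exists l : R, forall e : R, 0 < e ->
    exists N, forall n, (N <= n)%N -> `|\sum_(i < n) u i - l| <= e.
Proof.
move=> h.
have h1 : cvgn [normed series u].
  apply: nondecreasing_is_cvgn.
    by apply/nondecreasing_series => n _ _; exact: normr_ge0.
  exists K => _ [n _ <-] /=; rewrite /series /=; rewrite big_mkord; exact: h.
have /cvg_ex[l hl] := normed_cvg h1.
exists l => e e0; move/cvgrPdist_le: hl => /(_ e e0)[N _ hN]; exists N => n hn.
by have := hN n hn; rewrite /series /= big_mkord distrC.
Qed.

Lemma cRe_sum (I : Type) (s : seq I) (P : pred I) (F : I -> C) :
  complex.Re (\sum_(i <- s | P i) F i) = \sum_(i <- s | P i) complex.Re (F i).
Proof. exact: (big_morph (@complex.Re R) (@cReD R) erefl). Qed.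

Lemma cIm_sum (I : Type) (s : seq I) (P : pred I) (F : I -> C) :
  complex.Im (\sum_(i <- s | P i) F i) = \sum_(i <- s | P i) complex.Im (F i).
Proof. exact: (big_morph (@complex.Im R) (@cImD R) erefl). Qed.

(** Absolute convergence is taken from real series, hence the passage through real and imaginary
    parts. *)
Lemma csumP u (K : R) : (forall n, \sum_(i < n) cabs (u i) <= K) ->
  clim (fun n => \sum_(i < n) u i) (csum u).
Proof.
move=> h.
have [a ha] : exists l : R, forall e : R, 0 < e ->
    exists N, forall n, (N <= n)%N -> `|\sum_(i < n) complex.Re (u i) - l| <= e.
  apply: (@rcvg_abs (fun i => complex.Re (u i)) K) => n; apply: le_trans (h n).
  by apply: ler_sum => i _; apply: cabsRe.
have [b hb] : exists l : R, forall e : R, 0 < e ->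
    exists N, forall n, (N <= n)%N -> `|\sum_(i < n) complex.Im (u i) - l| <= e.
  apply: (@rcvg_abs (fun i => complex.Im (u i)) K) => n; apply: le_trans (h n).
  by apply: ler_sum => i _; apply: cabsIm.
suff hl : clim (fun n => \sum_(i < n) u i) (a +i* b) by rewrite (climP_csum hl).
move=> e e0; have e2 : 0 < e / 2 by lra.
have [N hN] := ha _ e2; have [M hM] := hb _ e2; exists (maxn N M) => n.
rewrite geq_max => /andP[hn1 hn2].
apply: (le_trans (cabs_ReIm _)); rewrite cReD cImD cReN cImN /= cRe_sum cIm_sum.
have := hN n hn1; have := hM n hn2; lra.
Qed.

Lemma csum_le u (v : nat -> R) (K : R) : (forall n, cabs (u n) <= v n) ->
  (forall n, \sum_(i < n) v i <= K) -> cabs (csum u) <= K.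
Proof.
move=> huv hv.
have h n : \sum_(i < n) cabs (u i) <= K.
  by apply: le_trans (hv n); apply: ler_sum.
rewrite -[csum u]subr0; apply: (clim_bound (N := 0%N) (csumP h)) => n _.
by rewrite subr0; apply: (le_trans (cabs_sum _ _ _)).
Qed.

End Limits.

Opaque csum.

(** * Power series on the unit disc with uniform remainders *)

Section PowerSeries.
Variable R : realType.
Local Notation C := R[i].
Implicit Types (c : nat -> C) (q u : C).

Lemma ler_expr_base (x y : R) n : 0 <= x -> x <= y -> x ^+ n <= y ^+ n.
Proof. by move=> x0 xy; rewrite lerXn2r ?nnegrE// (le_trans x0). Qed.

(** Pascal's rule gives S_(s+1)(n+1) = S_s(n+1) + x S_(s+1)(n), and y = 1/(1-x) satisfies 1 + x y =
    y; this closes a double induction on s and n. *)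
Lemma geometric_bin_sum s (x : R) : 0 <= x -> x < 1 -> forall n,
  \sum_(i < n) 'C(i + s, s)%:R * x ^+ i <= (1 - x)^-1 ^+ s.+1.
Proof.
move=> x0 x1; have y0 : 0 < (1 - x)^-1 by rewrite invr_gt0; lra.
have yE : 1 + x * (1 - x)^-1 = (1 - x)^-1 by field; lra.
elim: s => [|s IH] n.
  under eq_bigr do rewrite addn0 bin0 mul1r.
  elim: n => [|n IHn]; first by rewrite big_ord0 expr1 ltW.
  rewrite big_ord_recl expr0 expr1 -yE lerD2l.
  have -> : \sum_(i < n) x ^+ lift ord0 i = x * \sum_(i < n) x ^+ i.
    by rewrite mulr_sumr; apply: eq_bigr => i _; rewrite lift0 exprS.
  by rewrite ler_wpM2l.
elim: n => [|n IHn]; first by rewrite big_ord0 exprn_ge0 ?ltW.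
have -> : \sum_(i < n.+1) 'C(i + s.+1, s.+1)%:R * x ^+ i =
    \sum_(i < n.+1) 'C(i + s, s)%:R * x ^+ i
    + x * \sum_(i < n) 'C(i + s.+1, s.+1)%:R * x ^+ i.
  rewrite mulr_sumr (eq_bigr (fun i : 'I_n.+1 => 'C(i + s, s)%:R * x ^+ i
     + 'C(i + s, s.+1)%:R * x ^+ i)); last first.
    by move=> i _; rewrite addnS binS natrD; ring.
  rewrite big_split /=; congr (_ + _).
  rewrite big_ord_recl /= add0n bin_small// mul0r add0r.
  by apply: eq_bigr => i _; rewrite /bump /= add1n addSn addnS exprS; ring.
have := IH n.+1; move: IHn; rewrite ![_ ^+ s.+2]exprS.
set y := (1 - x)^-1 in y0 yE *; set T := y ^+ s.+1 => h1 h2.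
apply: (le_trans (lerD h2 (ler_wpM2l x0 h1))).
by rewrite -{1}[T]mul1r mulrA -mulrDl yE.
Qed.

Lemma expn_le_bin s i : (i.+1 ^ s <= s`! * 'C(i + s, s))%N.
Proof.
rewrite mulnC bin_ffact; elim: s => [|s IH]; first by rewrite ffactn0.
by rewrite expnS addnS ffactnS /= leq_mul// ltnS leq_addr.
Qed.

Lemma polygeo s (x : R) : 0 <= x -> x < 1 ->
  exists2 K, 0 < K & forall n, \sum_(i < n) i.+1%:R ^+ s * x ^+ i <= K.
Proof.
move=> x0 x1; exists (s`!%:R * (1 - x)^-1 ^+ s.+1).
  by rewrite mulr_gt0 ?ltr0n ?fact_gt0// exprn_gt0// invr_gt0; lra.
move=> n; apply: le_trans (ler_wpM2l _ (geometric_bin_sum s x0 x1 n)) => //.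
rewrite mulr_sumr; apply: ler_sum => i _.
rewrite mulrA ler_wpM2r ?exprn_ge0// -natrX -natrM ler_nat.
exact: expn_le_bin.
Qed.

(** Radius of convergence at least 1, expressed by bounded terms. Polynomial growth is not asked
    for, because the coefficients of the given form are known only through the convergence of its
    expansion. *)
Definition tame c := forall r : R, 0 < r -> r < 1 ->
  exists K : R, forall n, cabs (c n) * r ^+ n <= K.

Lemma tame_sum c s (r : R) : tame c -> 0 < r -> r < 1 ->
  exists2 K, 0 < K &
    forall n, \sum_(i < n) i.+1%:R ^+ s * (cabs (c i) * r ^+ i) <= K.
Proof.
(* A radius strictly between r and 1: the ratio (r/p)^i absorbs the polynomial weight. *)
move=> hc r0 r1; set p := (1 + r) / 2.
have p0 : 0 < p by rewrite /p; lra.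
have p1 : p < 1 by rewrite /p; lra.
have [K hK] := hc p p0 p1.
have x0 : 0 <= r / p by rewrite divr_ge0 ?ltW.
have x1 : r / p < 1 by rewrite ltr_pdivrMr// mul1r /p; lra.
have K0 : 0 <= K by apply: le_trans (hK 0%N); rewrite mulr_ge0 ?cabs_ge0// exprn_ge0 ?ltW.
have [M M0 hM] := polygeo s x0 x1; exists ((K + 1) * M); first by rewrite mulr_gt0; lra.
move=> n; apply: le_trans (ler_wpM2l _ (hM n)); last by lra.
rewrite mulr_sumr; apply: ler_sum => i _.
have -> : cabs (c i) * r ^+ i = cabs (c i) * p ^+ i * (r / p) ^+ i.
  by rewrite -mulrA -exprMn mulrCA divff ?mulr1// gt_eqF.
rewrite [leRHS]mulrCA ler_wpM2l ?exprn_ge0// ler_wpM2r ?exprn_ge0//.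
by apply: le_trans (hK i) _; lra.
Qed.

Lemma tame_poly c s : (forall n, cabs (c n) <= n.+1%:R ^+ s) -> tame c.
Proof.
move=> h r r0 r1; have [K K0 hK] := polygeo s (ltW r0) r1; exists K => n.
apply: le_trans (hK n.+1); rewrite big_ord_recr /=.
have r0' := ltW r0.
rewrite ler_wpDl ?ler_wpM2r ?exprn_ge0//.
by apply: sumr_ge0 => i _; rewrite mulr_ge0 ?exprn_ge0.
Qed.

Definition pser c q := csum (fun n => c n * q ^+ n).

Lemma pser_absum c q s : tame c -> cabs q < 1 ->
  exists2 K, 0 < K &
    forall n, \sum_(i < n) i.+1%:R ^+ s * cabs (c i * q ^+ i) <= K.
Proof.
move=> hc hq; set r := (1 + cabs q) / 2.
have q0 := cabs_ge0 q.
have r0 : 0 < r by rewrite /r; lra.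
have r1 : r < 1 by rewrite /r; lra.
have [K K0 hK] := tame_sum s hc r0 r1; exists K => // n; apply: le_trans (hK n).
apply: ler_sum => i _; rewrite ler_wpM2l ?exprn_ge0// cabsM cabsX.
by rewrite ler_wpM2l ?cabs_ge0// ler_expr_base// /r; lra.
Qed.

Lemma pserP c q : tame c -> cabs q < 1 ->
  clim (fun n => \sum_(i < n) c i * q ^+ i) (pser c q).
Proof.
move=> hc hq; have [K _ hK] := pser_absum 0 hc hq.
apply: (csumP (K := K)) => n; apply: le_trans (hK n).
by apply: ler_sum => i _; rewrite expr0 mul1r.
Qed.

(** In the tail |q|^i <= |q|^N r^(i-N), which leaves a convergent sum divided by r^N. *)
Lemma pser_jet c (r : R) N : tame c -> 0 < r -> r < 1 ->
  exists2 K, 0 < K & forall q, cabs q <= r ->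
    cabs (pser c q - \sum_(i < N) c i * q ^+ i) <= K * cabs q ^+ N.
Proof.
move=> hc r0 r1; have [K K0 hK] := tame_sum 0 hc r0 r1.
exists (K / r ^+ N); first by rewrite divr_gt0 ?exprn_gt0.
move=> q hq; apply: (clim_bound (N := N) (pserP hc (le_lt_trans hq r1))) => n hn.
rewrite -(subnKC hn) big_split_ord /= addrAC subrr add0r.
apply: (le_trans (cabs_sum _ _ _)); rewrite mulrAC.
apply: (@le_trans _ _ ((\sum_(i < n - N) cabs (c (N + i)%N) * r ^+ (N + i)) *
   cabs q ^+ N / r ^+ N)).
  rewrite -mulrA mulr_suml; apply: ler_sum => i _.
  rewrite cabsM cabsX -mulrA ler_wpM2l ?cabs_ge0// !exprD.
  rewrite [leRHS](_ : _ = cabs q ^+ N * r ^+ i); last first.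
    by field; rewrite expf_neq0// gt_eqF.
  by rewrite ler_wpM2l ?exprn_ge0 ?ler_expr_base ?cabs_ge0.
rewrite ler_wpM2r ?invr_ge0 ?exprn_ge0 ?(ltW r0)//.
rewrite ler_wpM2r ?exprn_ge0 ?cabs_ge0//.
apply: le_trans (hK (N + (n - N))%N); rewrite big_split_ord /=.
rewrite ler_wpDl//; first by apply: sumr_ge0 => i _; rewrite !mulr_ge0 ?cabs_ge0 ?exprn_ge0// (ltW r0).
by apply: ler_sum => i _; rewrite expr0 mul1r.
Qed.

(** The termwise derivative, followed by half of the second derivative. Truncated exponents are
    harmless, since the integer factor vanishes there. *)
Definition pser1 c q := csum (fun n => c n * (n%:R * q ^+ n.-1)).
Definition pser2 c q := csum (fun n => c n * ('C(n, 2)%:R * q ^+ (n - 2))).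

(** The factor x^3 on the left avoids an exponent n - 3. The remainder satisfies T_(n+1) = (q+u) T_n
    + C(n,2) q^(n-2) u^3, and the induction closes because n^3 + C(n,2) <= (n+1)^3. *)
Lemma expr_taylor2 (x : R) q u n : cabs q + cabs u <= x ->
  cabs ((q + u) ^+ n - q ^+ n - n%:R * q ^+ n.-1 * u
        - 'C(n, 2)%:R * q ^+ (n - 2) * u ^+ 2) * x ^+ 3
  <= n%:R ^+ 3 * x ^+ n * cabs u ^+ 3.
Proof.
move=> h; have q0 := cabs_ge0 q; have u0 := cabs_ge0 u.
have x0 : 0 <= x by lra.
elim: n => [|n IH].
  by rewrite !expr0 bin0n subrr !mul0r !subr0 cabs0 expr0n /= !mul0r.
have -> : (q + u) ^+ n.+1 - q ^+ n.+1 - n.+1%:R * q ^+ n.+1.-1 * u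
        - 'C(n.+1, 2)%:R * q ^+ (n.+1 - 2) * u ^+ 2 =
   (q + u) * ((q + u) ^+ n - q ^+ n - n%:R * q ^+ n.-1 * u
        - 'C(n, 2)%:R * q ^+ (n - 2) * u ^+ 2) + 'C(n, 2)%:R * q ^+ (n - 2) * u ^+ 3.
  case: n {IH} => [|[|n]].
  - by rewrite !bin_small//; ring.
  - by rewrite binn bin_small//=; ring.
  - rewrite [in LHS]binS bin1 !subSS !subn0 /= natrD !exprS -!natr1; ring.
set T := (X in (q + u) * X) in IH *; set b := 'C(n, 2)%:R : R.
have h1 : cabs ((q + u) * T) <= x * cabs T.
  by rewrite cabsM ler_wpM2r ?cabs_ge0//; apply: le_trans h; exact: cabsD.
have h2 : cabs ('C(n, 2)%:R * q ^+ (n - 2) * u ^+ 3) <= b * x ^+ (n - 2) * cabs u ^+ 3.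
  rewrite /b cabsM cabsM cabs_nat !cabsX; apply: ler_wpM2r; first by rewrite exprn_ge0.
  apply: ler_wpM2l => //.
  by rewrite ler_expr_base//; lra.
apply: (@le_trans _ _ (x * (cabs T * x ^+ 3) + b * (x ^+ (n - 2) * x ^+ 3) * cabs u ^+ 3)).
  rewrite [leRHS](_ : _ = (x * cabs T + b * x ^+ (n - 2) * cabs u ^+ 3) * x ^+ 3); last by ring.
  by rewrite ler_wpM2r ?exprn_ge0//; apply: (le_trans (cabsD _ _)); exact: lerD.
apply: (le_trans (lerD (ler_wpM2l x0 IH) (lexx _))).
rewrite {T h1 h2 IH}/b; case: n => [|n].
  by rewrite bin0n !mul0r addr0 expr0n /= !mul0r mulr0 mulr_ge0 ?exprn_ge0 ?mulr_ge0.
have -> : 'C(n.+1, 2)%:R * (x ^+ (n.+1 - 2) * x ^+ 3) = 'C(n.+1, 2)%:R * x ^+ n.+2.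
  case: n => [|n]; first by rewrite bin_small// !mul0r.
  by rewrite -exprD !subSS subn0 addn3.
have -> : x * (n.+1%:R ^+ 3 * x ^+ n.+1 * cabs u ^+ 3) = n.+1%:R ^+ 3 * x ^+ n.+2 * cabs u ^+ 3.
  by rewrite [x ^+ n.+2]exprS; ring.
rewrite -!mulrDl ler_wpM2r ?exprn_ge0// ler_wpM2r ?exprn_ge0//.
rewrite -!natrX -natrD ler_nat.
have : ('C(n.+1, 2) <= n.+1 * n.+1)%N.
  by rewrite bin2 leq_half_double -muln2; apply: (leq_trans (leq_mul (leqnn _) (leqnSn _))); lia.
by move=> h2; apply: (leq_trans (leq_add (leqnn _) h2)); rewrite !expnS !expn0 !muln1; nia.
Qed.

(** With x midway between r and 1, all four estimates are dominated by the sum of (n+1)^3 |c_n| x^n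
    divided by x^3, so one constant serves the whole disc. *)
Lemma pser_taylor c (r : R) : tame c -> 0 < r -> r < 1 ->
  exists2 K, 0 < K & forall q, cabs q <= r ->
   [/\ cabs (pser c q) <= K, cabs (pser1 c q) <= K, cabs (pser2 c q) <= K &
    forall u, cabs u <= (1 - r) / 2 ->
    cabs (pser c (q + u) - pser c q - pser1 c q * u - pser2 c q * u ^+ 2)
      <= K * cabs u ^+ 3].
Proof.
move=> hc r0 r1; set x := (1 + r) / 2.
have x0 : 0 < x by rewrite /x; lra.
have x1 : x < 1 by rewrite /x; lra.
have [K K0 hK] := tame_sum 3 hc x0 x1.
have y0 : 0 < x^-1 by rewrite invr_gt0.
have y1 : 1 < x^-1 by rewrite invf_gt1.
exists (K / x ^+ 3); first by rewrite divr_gt0 ?exprn_gt0.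
have gen (t : nat -> C) (b : R) : 0 <= b ->
    (forall n, cabs (t n) * x ^+ 3 <= n.+1%:R ^+ 3 * (x ^+ n) * b) ->
    forall n, \sum_(i < n) cabs (c i * t i) <= K / x ^+ 3 * b.
  move=> b0 ht n; rewrite mulrAC ler_pdivlMr ?exprn_gt0//.
  apply: le_trans (ler_wpM2r b0 (hK n)); rewrite !mulr_suml; apply: ler_sum => i _.
  rewrite cabsM -mulrA [leRHS](_ : _ = cabs (c i) * (i.+1%:R ^+ 3 * x ^+ i * b)); last by ring.
  by rewrite ler_wpM2l ?cabs_ge0.
have nn3 n : (n%:R : R) ^+ 3 <= n.+1%:R ^+ 3 by rewrite lerXn2r ?nnegrE ?ler_nat.
move=> q hq; have q0 := cabs_ge0 q; have qx : cabs q <= x by rewrite /x; lra.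
have pw n m : (m <= 3)%N -> cabs q ^+ (n - m) * x ^+ 3 <= x ^+ n.
  move=> hm; apply: (@le_trans _ _ (x ^+ (n - m) * x ^+ 3)).
    by rewrite ler_wpM2r ?exprn_ge0 ?ler_expr_base ?(ltW x0).
  by rewrite -exprD ler_wiXn2l ?(ltW x0) ?(ltW x1)//; lia.
have nsq n : ('C(n, 2)%:R : R) <= n.+1%:R ^+ 3.
  rewrite -natrX ler_nat bin2 leq_half_double -muln2 !expnS expn0.
  case: n => // n /=; nia.
have n1 n : (n%:R : R) <= n.+1%:R ^+ 3.
  by rewrite -natrX ler_nat !expnS expn0; nia.
have n13 n : (1 : R) <= n.+1%:R ^+ 3 by rewrite exprn_ege1// ler1n.
have h0 : forall n, cabs (q ^+ n) * x ^+ 3 <= n.+1%:R ^+ 3 * x ^+ n * 1.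
  move=> n; rewrite mulr1 cabsX -[n in cabs q ^+ n]subn0.
  by apply: (le_trans (pw n 0%N isT)); rewrite ler_peMl ?exprn_ge0 ?(ltW x0).
have h1 : forall n, cabs (n%:R * q ^+ n.-1) * x ^+ 3 <= n.+1%:R ^+ 3 * x ^+ n * 1.
  move=> n; rewrite mulr1 cabsM cabsX cabs_nat -subn1 -mulrA.
  by apply: ler_pM; [exact: ler0n|rewrite mulr_ge0 ?exprn_ge0 ?cabs_ge0 ?(ltW x0)| |exact: pw].
have h2 : forall n, cabs ('C(n, 2)%:R * q ^+ (n - 2)) * x ^+ 3 <= n.+1%:R ^+ 3 * x ^+ n * 1.
  move=> n; rewrite mulr1 cabsM cabsX cabs_nat -mulrA.
  by apply: ler_pM; [exact: ler0n|rewrite mulr_ge0 ?exprn_ge0 ?cabs_ge0 ?(ltW x0)| |exact: pw].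
have s0 := gen _ _ ler01 h0; have s1 := gen _ _ ler01 h1; have s2 := gen _ _ ler01 h2.
rewrite mulr1 in s0 s1 s2.
split; [exact: csum_le (fun=> lexx _) s0|exact: csum_le (fun=> lexx _) s1|
  exact: csum_le (fun=> lexx _) s2|].
move=> u hu; have u0 := cabs_ge0 u.
have hqu : cabs q + cabs u <= x by rewrite /x; lra.
have d0 := csumP (u := fun n => c n * q ^+ n) s0.
have d1 := csumP (u := fun n => c n * (n%:R * q ^+ n.-1)) s1.
have d2 := csumP (u := fun n => c n * ('C(n, 2)%:R * q ^+ (n - 2))) s2.
have d3 : clim (fun n => \sum_(i < n) c i * (q + u) ^+ i) (pser c (q + u)).
  by apply: pserP => //; apply: (le_lt_trans (cabsD _ _)); lra.
have := climB (climB (climB d3 d0) (climZ u d1)) (climZ (u ^+ 2) d2).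
rewrite [u * csum _]mulrC [u ^+ 2 * csum _]mulrC -[csum _ * u]/(pser1 c q * u) => hl.
rewrite -[_ - _ - _ - _]subr0; apply: (clim_bound (N := 0%N) hl) => n _.
rewrite subr0 !mulr_sumr -!sumrB.
apply: (le_trans (cabs_sum _ _ _)).
apply: le_trans (gen (fun n => (q + u) ^+ n - q ^+ n - n%:R * q ^+ n.-1 * u
        - 'C(n, 2)%:R * q ^+ (n - 2) * u ^+ 2) (cabs u ^+ 3) _ _ n).
- by apply: ler_sum => i _; rewrite le_eqVlt; apply/orP; left; apply/eqP; congr cabs; ring.
- by rewrite exprn_ge0.
- move=> m; apply: (le_trans (expr_taylor2 m hqu)).
  by rewrite ler_wpM2r ?exprn_ge0// ler_wpM2r ?exprn_ge0 ?(ltW x0).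
Qed.

(** Without the linear term only degrees at least 2 remain, and q^n - q'^n is at most n x^(n-1) |q -
    q'|; the Lipschitz constant of the rest is therefore O(x). This makes the later fixed-point map
    contract near 0. *)
Lemma pser_lip c (r : R) : tame c -> 0 < r -> r < 1 ->
  exists2 K, 0 < K & forall (x : R) q q', x <= r -> cabs q <= x -> cabs q' <= x ->
    cabs (pser c q - pser c q' - c 1%N * (q - q')) <= K * x * cabs (q - q').
Proof.
move=> hc r0 r1; have [K K0 hK] := tame_sum 1 hc r0 r1.
exists (K / r ^+ 2); first by rewrite divr_gt0 ?exprn_gt0.
move=> x q q' xr hq hq'; have x0 := le_trans (cabs_ge0 _) hq.
have hl := climB (pserP hc (le_lt_trans (le_trans hq xr) r1))
                 (pserP hc (le_lt_trans (le_trans hq' xr) r1)).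
have := climB hl (clim_cst (c 1%N * (q - q'))).
move=> {}hl; rewrite -[_ - _ - _]subr0; apply: (clim_bound (N := 2) hl) => -[|[|n]]// _.
rewrite subr0 -sumrB !big_ord_recl /= !expr0 !expr1 subrr add0r.
rewrite /bump /= -mulrBr addrAC subrr add0r.
apply: (le_trans (cabs_sum _ _ _)).
rewrite -mulrA mulrAC ler_pdivlMr ?exprn_gt0//.
apply: (@le_trans _ _ ((\sum_(i < n) i.+3%:R * (cabs (c i.+2) * r ^+ i.+2)) * (x * cabs (q - q')))); last first.
  rewrite ler_wpM2r ?mulr_ge0 ?cabs_ge0//; apply: le_trans (hK (2 + n)%N).
  rewrite big_split_ord /= ler_wpDl//.
    by apply: sumr_ge0 => i _; rewrite !mulr_ge0 ?cabs_ge0 ?exprn_ge0// (ltW r0).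
rewrite !mulr_suml; apply: ler_sum => i _; rewrite !add1n.
rewrite -mulrBr cabsM [leRHS](_ : _ = cabs (c i.+2) *
  (i.+3%:R * r ^+ i * x * cabs (q - q') * r ^+ 2)); last first.
  by rewrite [r ^+ i.+2]exprS [r ^+ i.+1]exprS; ring.
rewrite -[leLHS]mulrA ler_wpM2l ?cabs_ge0//.
rewrite ler_wpM2r ?exprn_ge0 ?(ltW r0)//.
apply: (le_trans (cabs_expB _ hq hq')); rewrite ler_wpM2r ?cabs_ge0//.
rewrite exprS mulrA mulrAC ler_wpM2r//.
apply: ler_pM; rewrite ?exprn_ge0 ?ler_nat//.
by rewrite ler_expr_base.
Qed.

End PowerSeries.

(** * Numerical bounds for sine, cosine, exponential and pi *)

Section RealBounds.
Variable R : realType.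
Implicit Types (x a : R) (p : {poly R}).

(** The mean value theorem for s - p. Each Taylor bound below follows from the previous one by
    comparing derivatives. *)
Lemma poly_compare_ge (s ds : R -> R) p A :
  (forall x, is_derive x 1 s (ds x)) -> p.[0] <= s 0 ->
  (forall x, 0 <= x -> x <= A -> p^`().[x] <= ds x) ->
  forall x, 0 <= x -> x <= A -> p.[x] <= s x.
Proof.
move=> hs h0 hd x x0 xA.
have dd (y : R) : is_derive y 1 (s - horner p) (ds y - p^`().[y]).
  by apply: is_deriveB.
have [|c] := @MVT_segment R (s - horner p) (fun y => ds y - p^`().[y]) 0 x x0.
  apply: derivable_within_continuous => y _.
  by case: (dd y).
rewrite in_itv /= => /andP[c0 cx]; rewrite subr0 !fctE => h.
have := hd c c0 (le_trans cx xA); rewrite -subr_ge0 => h2.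
have := mulr_ge0 h2 x0; rewrite -h; lra.
Qed.

Lemma poly_compare_le (s ds : R -> R) p A :
  (forall x, is_derive x 1 s (ds x)) -> s 0 <= p.[0] ->
  (forall x, 0 <= x -> x <= A -> ds x <= p^`().[x]) ->
  forall x, 0 <= x -> x <= A -> s x <= p.[x].
Proof.
move=> hs h0 hd x x0 xA.
have : (- p).[x] <= (- s) x; last by rewrite hornerN fctE lerN2.
apply: (@poly_compare_ge (- s) (fun y => - ds y) (- p) A _ _ _ x x0 xA).
- by rewrite hornerN fctE lerN2.
- by move=> y y0 yA; rewrite derivN hornerN lerN2; exact: hd.
Qed.

Lemma sin_le_id x : 0 <= x -> sin x <= x.
Proof.
move=> x0; set p : {poly R} := 'X.
have : sin x <= p.[x].
  apply: (@poly_compare_le sin cos p x (@is_derive_sin R) _ _ x x0 (lexx x)).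
  - by rewrite sin0 /p !(hornerXn, hornerE) ?expr0n /=; lra.
  - move=> y y0 _; rewrite /p !poly.derivE !(hornerXn, hornerE) /=.
    have := cos_le1 y; lra.
rewrite /p !(hornerXn, hornerE) /=; lra.
Qed.

Lemma cos_ge_taylor2 x : 0 <= x -> 1 - x ^+ 2 / 2 <= cos x.
Proof.
move=> x0; set p : {poly R} := 1 - 2^-1 *: 'X^2.
have : p.[x] <= cos x.
  apply: (@poly_compare_ge cos (fun y => - sin y) p x (@is_derive_cos R) _ _ x x0 (lexx x)).
  - by rewrite cos0 /p !(hornerXn, hornerE) ?expr0n /=; lra.
  - move=> y y0 _; rewrite /p !poly.derivE !(hornerXn, hornerE) /=.
    have := sin_le_id y0; lra.
rewrite /p !(hornerXn, hornerE) /=; lra.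
Qed.

Lemma sin_ge_taylor3 x : 0 <= x -> x - x ^+ 3 / 6 <= sin x.
Proof.
move=> x0; set p : {poly R} := 'X - 6^-1 *: 'X^3.
have : p.[x] <= sin x.
  apply: (@poly_compare_ge sin cos p x (@is_derive_sin R) _ _ x x0 (lexx x)).
  - by rewrite sin0 /p !(hornerXn, hornerE) ?expr0n /=; lra.
  - move=> y y0 _; rewrite /p !poly.derivE !(hornerXn, hornerE) /=.
    have := cos_ge_taylor2 y0; lra.
rewrite /p !(hornerXn, hornerE) /=; lra.
Qed.

Lemma cos_le_taylor4 x : 0 <= x -> cos x <= 1 - x ^+ 2 / 2 + x ^+ 4 / 24.
Proof.
move=> x0; set p : {poly R} := 1 - 2^-1 *: 'X^2 + 24^-1 *: 'X^4.
have : cos x <= p.[x].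
  apply: (@poly_compare_le cos (fun y => - sin y) p x (@is_derive_cos R) _ _ x x0 (lexx x)).
  - by rewrite cos0 /p !(hornerXn, hornerE) ?expr0n /=; lra.
  - move=> y y0 _; rewrite /p !poly.derivE !(hornerXn, hornerE) /=.
    have := sin_ge_taylor3 y0; lra.
rewrite /p !(hornerXn, hornerE) /=; lra.
Qed.

Lemma sin_le_taylor5 x : 0 <= x -> sin x <= x - x ^+ 3 / 6 + x ^+ 5 / 120.
Proof.
move=> x0; set p : {poly R} := 'X - 6^-1 *: 'X^3 + 120^-1 *: 'X^5.
have : sin x <= p.[x].
  apply: (@poly_compare_le sin cos p x (@is_derive_sin R) _ _ x x0 (lexx x)).
  - by rewrite sin0 /p !(hornerXn, hornerE) ?expr0n /=; lra.
  - move=> y y0 _; rewrite /p !poly.derivE !(hornerXn, hornerE) /=.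
    have := cos_le_taylor4 y0; lra.
rewrite /p !(hornerXn, hornerE) /=; lra.
Qed.

Lemma cos_ge_taylor6 x : 0 <= x -> 1 - x ^+ 2 / 2 + x ^+ 4 / 24 - x ^+ 6 / 720 <= cos x.
Proof.
move=> x0; set p : {poly R} := 1 - 2^-1 *: 'X^2 + 24^-1 *: 'X^4 - 720^-1 *: 'X^6.
have : p.[x] <= cos x.
  apply: (@poly_compare_ge cos (fun y => - sin y) p x (@is_derive_cos R) _ _ x x0 (lexx x)).
  - by rewrite cos0 /p !(hornerXn, hornerE) ?expr0n /=; lra.
  - move=> y y0 _; rewrite /p !poly.derivE !(hornerXn, hornerE) /=.
    have := sin_le_taylor5 y0; lra.
rewrite /p !(hornerXn, hornerE) /=; lra.
Qed.

(** The Taylor polynomial of degree 6 is positive at 31/20, so this point lies before the zero pi/2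
    of the cosine. The precision is what |q| <= 1/190 above height 17/20 asks for. *)
Lemma pi_ge31 : 31 / 10 <= pi :> R.
Proof.
have c0 : 0 < cos (31 / 20 : R).
  have : 0 < 1 - (31 / 20) ^+ 2 / 2 + (31 / 20) ^+ 4 / 24 - (31 / 20) ^+ 6 / 720 :> R by lra.
  by move=> h1; apply: (lt_le_trans h1); apply: cos_ge_taylor6; lra.
rewrite leNgt; apply/negP => hpi.
have p2 := @pi_ge2 R; have h := @cos_pihalf R.
have i1 : (31 / 20 : R) \in `[0, pi] by rewrite in_itv /=; apply/andP; split; lra.
have i2 : (pi / 2 : R) \in `[0, pi] by rewrite in_itv /=; apply/andP; split; lra.
have := ltr_cos i1 i2; rewrite h c0 => /esym; lra.
Qed.

Lemma pi_le4 : pi <= 4 :> R.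
Proof. by have /andP[_] := @pihalf_02 R; lra. Qed.

Lemma sin_ge_third x : 0 <= x -> x <= 2 -> x / 3 <= sin x.
Proof.
move=> x0 x2; apply: le_trans (sin_ge_taylor3 x0).
have : 0 <= x * (4 - x ^+ 2) by rewrite mulr_ge0// subr_ge0; nra.
lra.
Qed.

Lemma cos_taylor_bound x : `|cos x - (1 - x ^+ 2 / 2)| <= x ^+ 4 / 24.
Proof.
wlog x0 : x / 0 <= x.
  move=> H; case: (lerP 0 x) => hx; first exact: H.
  have := H (- x); rewrite cosN sqrrN (exprNn x 4) -signr_odd /= mul1r; apply; lra.
have h1 := cos_ge_taylor2 x0; have h2 := cos_le_taylor4 x0.
by rewrite ler_norml; apply/andP; split; lra.
Qed.

Lemma sin_taylor_bound x : `|sin x - x| <= `|x| ^+ 3 / 6.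
Proof.
wlog x0 : x / 0 <= x.
  move=> H; case: (lerP 0 x) => hx; first exact: H.
  have := H (- x); rewrite sinN -opprD !normrN; apply; lra.
have h1 := sin_ge_taylor3 x0; have h2 := sin_le_id x0.
by rewrite (ger0_norm x0) ler_norml; apply/andP; split; have := exprn_ge0 3 x0; lra.
Qed.

Lemma is_derive_expRN (y : R) : is_derive y 1 (fun x : R => expR (- x)) (- expR (- y)).
Proof.
have h := is_derive1_comp (f := expR) (g := -%R) (is_derive_expR (- y)) (is_deriveNid y 1).
by apply: is_derive_eq h _; rewrite mulrN1.
Qed.

Lemma expN_le_taylor2 x : 0 <= x -> expR (- x) <= 1 - x + x ^+ 2 / 2.
Proof.
move=> x0; set p : {poly R} := 1 - 'X + 2^-1 *: 'X^2.
have : expR (- x) <= p.[x].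
  apply: (@poly_compare_le (fun y => expR (- y)) _ p x is_derive_expRN _ _ x x0 (lexx x)).
  - by rewrite oppr0 expR0 /p !(hornerXn, hornerE) ?expr0n /=; lra.
  - move=> y y0 _; rewrite /p !poly.derivE !(hornerXn, hornerE) /=.
    have := expR_ge1Dx (- y); lra.
rewrite /p !(hornerXn, hornerE) /=; lra.
Qed.

Lemma expN_ge_taylor3 x : 0 <= x -> 1 - x + x ^+ 2 / 2 - x ^+ 3 / 6 <= expR (- x).
Proof.
move=> x0; set p : {poly R} := 1 - 'X + 2^-1 *: 'X^2 - 6^-1 *: 'X^3.
have : p.[x] <= expR (- x).
  apply: (@poly_compare_ge (fun y => expR (- y)) _ p x is_derive_expRN _ _ x x0 (lexx x)).
  - by rewrite oppr0 expR0 /p !(hornerXn, hornerE) ?expr0n /=; lra.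
  - move=> y y0 _; rewrite /p !poly.derivE !(hornerXn, hornerE) /=.
    have := expN_le_taylor2 y0; lra.
rewrite /p !(hornerXn, hornerE) /=; lra.
Qed.

Lemma expR1_le3 : expR 1 <= 3 :> R.
Proof.
have h := @expN_ge_taylor3 1 ler01.
have h1 : 3^-1 <= expR (- 1) :> R by apply: le_trans h; lra.
by rewrite -[expR 1]invrK -expRN -[leRHS]invrK lef_pV2 ?posrE ?expR_gt0.
Qed.

Lemma exp_ge_taylor2 x : 0 <= x -> 1 + x + x ^+ 2 / 2 <= expR x.
Proof.
move=> x0; set p : {poly R} := 1 + 'X + 2^-1 *: 'X^2.
have : p.[x] <= expR x.
  apply: (@poly_compare_ge expR expR p x (@is_derive_expR R) _ _ x x0 (lexx x)).
  - by rewrite expR0 /p !(hornerXn, hornerE) ?expr0n /=; lra.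
  - move=> y y0 _; rewrite /p !poly.derivE !(hornerXn, hornerE) /=.
    have := expR_ge1Dx y; lra.
rewrite /p !(hornerXn, hornerE) /=; lra.
Qed.

Lemma exp_le3 x : x <= 1 -> expR x <= 3.
Proof. by move=> x1; apply: le_trans expR1_le3; rewrite ler_expR. Qed.

Lemma exp_le_taylor1 x : 0 <= x -> x <= 1 -> expR x <= 1 + 3 * x.
Proof.
move=> x0 x1; set p : {poly R} := 1 + 3 *: 'X.
have : expR x <= p.[x].
  apply: (@poly_compare_le expR expR p 1 (@is_derive_expR R) _ _ x x0 x1).
  - by rewrite expR0 /p !(hornerXn, hornerE) ?expr0n /=; lra.
  - move=> y y0 y1; rewrite /p !poly.derivE !(hornerXn, hornerE) /=.
    have := exp_le3 y1; lra.
rewrite /p !(hornerXn, hornerE) /=; lra.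
Qed.

Lemma exp_le_taylor2 x : 0 <= x -> x <= 1 -> expR x <= 1 + x + 3 / 2 * x ^+ 2.
Proof.
move=> x0 x1; set p : {poly R} := 1 + 'X + (3 / 2) *: 'X^2.
have : expR x <= p.[x].
  apply: (@poly_compare_le expR expR p 1 (@is_derive_expR R) _ _ x x0 x1).
  - by rewrite expR0 /p !(hornerXn, hornerE) ?expr0n /=; lra.
  - move=> y y0 y1; rewrite /p !poly.derivE !(hornerXn, hornerE) /=.
    have := exp_le_taylor1 y0 y1; lra.
rewrite /p !(hornerXn, hornerE) /=; lra.
Qed.

Lemma exp_le_taylor3 x : 0 <= x -> x <= 1 -> expR x <= 1 + x + x ^+ 2 / 2 + x ^+ 3 / 2.
Proof.
move=> x0 x1; set p : {poly R} := 1 + 'X + 2^-1 *: 'X^2 + 2^-1 *: 'X^3.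
have : expR x <= p.[x].
  apply: (@poly_compare_le expR expR p 1 (@is_derive_expR R) _ _ x x0 x1).
  - by rewrite expR0 /p !(hornerXn, hornerE) ?expr0n /=; lra.
  - move=> y y0 y1; rewrite /p !poly.derivE !(hornerXn, hornerE) /=.
    have := exp_le_taylor2 y0 y1; lra.
rewrite /p !(hornerXn, hornerE) /=; lra.
Qed.

Lemma exp_taylor_bound x : `|x| <= 1 -> `|expR x - (1 + x + x ^+ 2 / 2)| <= `|x| ^+ 3 / 2.
Proof.
case: (lerP 0 x) => x0.
  rewrite (ger0_norm x0) => x1.
  have h1 := exp_ge_taylor2 x0; have h2 := exp_le_taylor3 x0 x1.
  by rewrite ler_norml; apply/andP; split; have := exprn_ge0 3 x0; lra.
rewrite (ltr0_norm x0) => x1.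
have y0 : 0 <= - x by lra.
have h1 := expN_ge_taylor3 y0; have h2 := expN_le_taylor2 y0.
move: h1 h2; rewrite opprK sqrrN => h1 h2.
have := exprn_ge0 3 y0.
by rewrite ler_norml => h3; apply/andP; split; lra.
Qed.

End RealBounds.

Arguments cabs R z : simpl never.
Arguments cexp R z : simpl never.
Arguments nome R tau : simpl never.
Arguments clog R z : simpl never.
Arguments carg R z : simpl never.

(** * Complex exponential, nome and logarithm *)

Section ComplexExp.
Variable R : realType.
Local Notation C := R[i].
Implicit Types (w z tau q : C).

Lemma complex_eq z w : complex.Re z = complex.Re w ->
  complex.Im z = complex.Im w -> z = w.
Proof. by case: z => a b; case: w => c d /= -> ->. Qed.

Lemma cexpD z w : cexp (z + w) = cexp z * cexp w.
Proof.
case: z => a b; case: w => c d; rewrite /cexp /= expRD cosD sinD rmorphM /=.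
rewrite mulrACA; congr (_ * _); apply: complex_eq => /=; ring.
Qed.

Lemma cexp0 : cexp (0 : C) = 1.
Proof. by rewrite /cexp /= expR0 cos0 sin0 mul1r. Qed.

Lemma cabs_cis (b : R) : cabs (cos b +i* sin b) = 1.
Proof. by rewrite /cabs /= cos2Dsin2 sqrtr1. Qed.

Lemma cabs_cexp z : cabs (cexp z) = expR (complex.Re z).
Proof.
by rewrite /cexp cabsM cabs_cis mulr1 cabs_real ger0_norm ?expR_ge0.
Qed.

Lemma cexp_neq0 z : cexp z != 0.
Proof. by rewrite -cabs_gt0 cabs_cexp expR_gt0. Qed.

Lemma cexpN z : cexp (- z) = (cexp z)^-1.
Proof.
apply: (mulIf (cexp_neq0 z)); rewrite mulVf ?cexp_neq0//.
by rewrite -cexpD addNr cexp0.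
Qed.

Lemma cexpMn n z : cexp (n%:R * z) = cexp z ^+ n.
Proof.
elim: n => [|n IH]; first by rewrite mul0r cexp0 expr0.
by rewrite -natr1 mulrDl mul1r cexpD IH exprSr.
Qed.

(** The real errors of exp, cos and sin are of order 3 and get multiplied by bounded factors. The
    product of the real Taylor polynomials differs from 1 + w + w^2/2 by terms in a b^2, a^2 b^2 and
    a^2 b, again of order at least 3. *)
Lemma cexp_taylor w : cabs w <= 1 ->
  cabs (cexp w - (1 + w + w ^+ 2 / 2)) <= 4 * cabs w ^+ 3.
Proof.
move=> w1; have wRe := cabsRe w; have wIm := cabsIm w.
have m0 := cabs_ge0 w.
move: w w1 wRe wIm m0 => [a b]; set m := cabs (a +i* b) => w1 /= wa wb m0.
have m3 : 0 <= m ^+ 3 by rewrite exprn_ge0.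
have m4 : m ^+ 4 <= m ^+ 3 by rewrite [m ^+ 4]exprS ler_piMl.
have a3 : `|a| ^+ 3 <= m ^+ 3 by rewrite ler_expr_base.
have b3 : `|b| ^+ 3 <= m ^+ 3 by rewrite ler_expr_base.
have a1 : `|a| <= 1 := le_trans wa w1.
have he := exp_taylor_bound a1.
have hc := cos_taylor_bound b; have hs := sin_taylor_bound b.
set A := 1 + a + a ^+ 2 / 2 in he.
set e := expR a - A in he.
set d := cos b - (1 - b ^+ 2 / 2) in hc.
set n := sin b - b in hs.
have b4 : b ^+ 4 <= m ^+ 3.
  apply: le_trans m4; have -> : b ^+ 4 = `|b| ^+ 4.
    by rewrite -normrX ger0_norm// -[4%N]/(2 * 2)%N exprM sqr_ge0.
  by rewrite ler_expr_base.
have ab2 : `|a| * `|b| ^+ 2 <= m ^+ 3.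
  by rewrite [m ^+ 3]exprS ler_pM ?exprn_ge0// ler_expr_base.
have a2b : `|a| ^+ 2 * `|b| <= m ^+ 3.
  by rewrite [m ^+ 3]exprSr ler_pM ?exprn_ge0// ler_expr_base.
have a2b2 : `|a| ^+ 2 * `|b| ^+ 2 <= m ^+ 3.
  apply: le_trans m4; rewrite -[4%N]/(2 + 2)%N exprD.
  by rewrite ler_pM ?exprn_ge0// ler_expr_base.
have -> : cexp (a +i* b) - (1 + (a +i* b) + (a +i* b) ^+ 2 / 2) =
   e%:C * (cos b +i* sin b) + A%:C * (d +i* n)
   + (- (a * b ^+ 2) / 2 - a ^+ 2 * b ^+ 2 / 4)%:C + 'i%C * (a ^+ 2 * b / 2)%:C.
  rewrite /cexp /e /d /n /A /= {e d n A he hc hs}.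
  have -> : (2 : C)^-1 = (2^-1)%:C by rewrite fmorphV rmorph_nat.
  by apply: complex_eq; rewrite expr2 ?(cReD, cImD, cReN, cImN, cReM, cImM) /=; field.
have hA : `|A| <= 5 / 2.
  rewrite /A; move: a1; rewrite !ler_norml => /andP[h1 h2]; apply/andP; split; nra.
have t1 : cabs (e%:C * (cos b +i* sin b)) <= m ^+ 3 / 2.
  rewrite cabsM cabs_cis mulr1 cabs_real; apply: (le_trans he); lra.
have t2 : cabs (A%:C * (d +i* n)) <= 5 / 2 * (m ^+ 3 / 24 + m ^+ 3 / 6).
  rewrite cabsM cabs_real ler_pM ?cabs_ge0//.
  apply: (le_trans (cabs_ReIm _)) => /=; apply: lerD; first by lra.
  by apply: (le_trans hs); lra.
have t3 : cabs (- (a * b ^+ 2) / 2 - a ^+ 2 * b ^+ 2 / 4)%:C <= m ^+ 3 / 2 + m ^+ 3 / 4.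
  rewrite cabs_real; apply: (le_trans (ler_normB _ _)); apply: lerD.
    rewrite [`|_ / _|]normrM normrN normfV [`|a * _|]normrM [`|b ^+ 2|]normrX [`|2|]ger0_norm//; lra.
  rewrite [`|_ / _|]normrM normfV [`|a ^+ 2 * _|]normrM [`|b ^+ 2|]normrX [`|a ^+ 2|]normrX [`|4|]ger0_norm//; lra.
have t4 : cabs ('i%C * (a ^+ 2 * b / 2)%:C) <= m ^+ 3 / 2.
  rewrite cabsM cabsi mul1r cabs_real [`|_ / _|]normrM normfV [`|a ^+ 2 * _|]normrM [`|a ^+ 2|]normrX [`|2|]ger0_norm//; lra.
apply: (le_trans (cabsD _ _)); apply: (le_trans (lerD (cabsD _ _) t4)).
have := cabsD (e%:C * (cos b +i* sin b)) (A%:C * (d +i* n)); lra.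
Qed.

Lemma cexp_lin w : cabs w <= 1 -> cabs (cexp w - 1 - w) <= 5 * cabs w ^+ 2.
Proof.
move=> w1; have h := cexp_taylor w1; have m0 := cabs_ge0 w.
have m2 : 0 <= cabs w ^+ 2 by rewrite exprn_ge0.
have m3 : cabs w ^+ 3 <= cabs w ^+ 2 by rewrite [cabs w ^+ 3]exprS ler_piMl.
have -> : cexp w - 1 - w = (cexp w - (1 + w + w ^+ 2 / 2)) + w ^+ 2 / 2 by ring.
apply: (le_trans (cabsD _ _)).
rewrite [cabs (_ / _)]cabsM cabsV cabs_nat cabsX; lra.
Qed.

(** Quantitative injectivity at 1: e^a near 1 gives |a| <= 2 e; then |sin b| <= 2 e and cos b > 0
    force |b| < pi/2, where sin b >= b/3 gives |b| <= 6 e. It serves injectivity of the nome, the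
    pole of [cothv] and the final logarithm. *)
Lemma cexp_near1 z (e : R) : `|complex.Im z| <= pi -> cabs (cexp z - 1) <= e ->
  e <= 1 / 2 -> cabs z <= 8 * e.
Proof.
case: z => a b /= hb he e2.
set E := expR a; have E0 : 0 < E := expR_gt0 a.
have hE : `|E - 1| <= e.
  apply: le_trans he; have hE := cabs_cexp (a +i* b); rewrite [complex.Re _]/= -/E in hE.
  rewrite ler_norml -hE; have h1 := cabs_subl (cexp (a +i* b)) 1.
  have h2 := cabs_subl 1 (cexp (a +i* b)); rewrite cabsC cabs1 in h2.
  by rewrite cabs1 in h1; apply/andP; split; lra.
have e0 : 0 <= e := le_trans (cabs_ge0 _) he.
have /andP[hE1 hE2] : - e <= E - 1 <= e by rewrite -ler_norml.
have ha : `|a| <= 2 * e.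
  have h1 := expR_ge1Dx a; have h2 := expR_ge1Dx (- a).
  rewrite expRN -/E in h1 h2; rewrite ler_norml; apply/andP; split; last by lra.
  have h3 : E^-1 <= 1 + 2 * e.
    rewrite -[E^-1]mul1r ler_pdivrMr//; nra.
  lra.
have hre : `|E * cos b - 1| <= e.
  apply: le_trans he; apply: le_trans (cabsRe _).
  by rewrite /cexp cReD cReM cReN /= mul0r subr0.
have him : `|E * sin b| <= e.
  apply: le_trans he; apply: le_trans (cabsIm _).
  by rewrite /cexp cImD cImM cImN /= mul0r addr0 oppr0 addr0.
have c0 : 0 < cos b.
  move: hre; rewrite ler_norml => /andP[h _].
  have : 0 < E * cos b by lra.
  by rewrite pmulr_rgt0.
have s0 : `|sin b| <= 2 * e.
  rewrite normrM (gtr0_norm E0) in him.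
  have := normr_ge0 (sin b); nra.
have hbb : `|b| <= 6 * e.
  have b0 := normr_ge0 b.
  have cb : cos `|b| = cos b.
    by have [h|h] := leP 0 b; [rewrite ger0_norm|rewrite ltr0_norm// cosN].
  have sb : `|sin `|b| | = `|sin b|.
    by have [h|h] := leP 0 b; [rewrite (ger0_norm h)|rewrite (ltr0_norm h) sinN normrN].
  have hlt : `|b| < pi / 2.
    have p0 := @pi_gt0 R.
    have i1 : `|b| \in `[0, pi] by rewrite in_itv /= b0.
    have i2 : (pi / 2 : R) \in `[0, pi] by rewrite in_itv /=; apply/andP; split; lra.
    by rewrite -(ltr_cos i1 i2) cos_pihalf cb.
  have p4 := @pi_le4 R.
  have h := sin_ge_third b0 ltac:(lra).
  rewrite ger0_norm in sb; last by lra.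
  by rewrite sb in h; lra.
have := cabs_ReIm (a +i* b); rewrite [complex.Re _]/= [complex.Im _]/=; lra.
Qed.

Lemma nome_argE tau : 2 * pi%:C * 'i%C * tau =
   (- (2 * pi * complex.Im tau)) +i* (2 * pi * complex.Re tau).
Proof.
have -> : (2 : C) = (2 : R)%:C by rewrite rmorph_nat.
by case: tau => a b; apply: complex_eq => /=; ring.
Qed.

Lemma nomeE tau : nome tau =
  (expR (- (2 * pi * complex.Im tau)))%:C *
  (cos (2 * pi * complex.Re tau) +i* sin (2 * pi * complex.Re tau)).
Proof.
by rewrite /nome /cexp nome_argE.
Qed.

Lemma cabs_nome tau : cabs (nome tau) = expR (- (2 * pi * complex.Im tau)).
Proof. by rewrite nomeE cabsM cabs_cis mulr1 cabs_real ger0_norm ?expR_ge0. Qed.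

Lemma cabs_nome_lt1 tau : upper_half tau -> cabs (nome tau) < 1.
Proof.
move=> h; rewrite cabs_nome expR_lt1 oppr_lt0 mulr_gt0// mulr_gt0// pi_gt0//.
Qed.

Lemma nome_neq0 tau : nome tau != 0.
Proof. exact: cexp_neq0. Qed.

Lemma nomeD tau z : nome (tau + z) = nome tau * nome z.
Proof. by rewrite /nome mulrDr cexpD. Qed.

Lemma nomeN tau : nome (- tau) = (nome tau)^-1.
Proof. by rewrite /nome mulrN cexpN. Qed.

Lemma nomeMn n tau : nome (n%:R * tau) = nome tau ^+ n.
Proof. by rewrite /nome -cexpMn; congr cexp; ring. Qed.

Lemma nome1 : nome (1 : C) = 1.
Proof.
rewrite nomeE /= !mulr0 mulr1 oppr0 expR0 mul1r.
by rewrite [2 * pi]mulr_natl cos2pi sin2pi.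
Qed.

Lemma nome_half : nome (2^-1 : C) = -1.
Proof.
have -> : (2 : C)^-1 = (2^-1)%:C by rewrite fmorphV rmorph_nat.
rewrite nomeE /= mulr0 oppr0 expR0 mul1r mulrAC divff// mul1r cospi sinpi.
by apply: complex_eq; rewrite ?cReN ?cImN /= ?oppr0.
Qed.

Lemma nomeD1 tau : nome (tau + 1) = nome tau.
Proof. by rewrite nomeD nome1 mulr1. Qed.

Lemma cargP z : z != 0 -> [/\ - pi <= carg z, carg z < pi,
  cabs z * cos (carg z) = complex.Re z & cabs z * sin (carg z) = complex.Im z].
Proof.
move=> z0; have m0 : 0 < cabs z by rewrite cabs_gt0.
have mRe := cabsRe z; have hsq := cabs_sqr z.
rewrite /carg; set c := complex.Re z / cabs z.
have cm : cabs z * c = complex.Re z by rewrite mulrC divfK// gt_eqF.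
have hc : -1 <= c <= 1.
  by rewrite -ler_norml normrM normfV (gtr0_norm m0) ler_pdivrMr// mul1r.
have hcos : cos (acos c) = c by apply: acosK; rewrite in_itv.
have ge0 := acos_ge0 hc; have lepi := acos_lepi hc.
have hsin : cabs z * sin (acos c) = `|complex.Im z|.
  rewrite sin_acos//; apply/eqP.
  rewrite -(eqrXn2 (n := 2))//; last by rewrite mulr_ge0 ?sqrtr_ge0 ?cabs_ge0.
  rewrite exprMn sqr_sqrtr; last first.
    by have /andP[c1 c2] := hc; nra.
  by rewrite mulrBr mulr1 -exprMn cm hsq addrAC subrr add0r -normrX ger0_norm ?sqr_ge0.
case: ifPn => him.
  rewrite hcos cm hsin (gtr0_norm him); split => //.
    by have := @pi_ge0 R; lra.
  apply: acos_ltpi; rewrite (andP hc).2 andbT lt_neqAle (andP hc).1 andbT.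
  apply/negP => /eqP hc1; move: hsq; rewrite -cm -hc1 mulrN1 sqrrN.
  by move=> /eqP; rewrite -subr_eq0 opprD addNKr oppr_eq0 sqrf_eq0 gt_eqF.
rewrite cosN sinN hcos cm mulrN hsin; split => //.
- by rewrite lerN2.
- by have := @pi_gt0 R; lra.
- by rewrite ler0_norm ?opprK// leNgt.
Qed.

Lemma clogK z : z != 0 -> cexp (clog z) = z.
Proof.
move=> z0; have [_ _ h1 h2] := cargP z0.
rewrite /cexp /clog /= lnK ?posrE ?cabs_gt0//.
by apply: complex_eq; rewrite ?cReM ?cImM /= ?h1 ?h2; ring.
Qed.

(** Take tau = log q / (2 pi i); the half-open range of [carg] becomes the half-open strip. *)
Lemma nome_surj q : q != 0 -> exists tau,
  [/\ - 2^-1 <= complex.Re tau, complex.Re tau < 2^-1 & nome tau = q].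
Proof.
move=> q0; have [h1 h2 _ _] := cargP q0; have p0 := @pi_gt0 R.
exists ((carg q / (2 * pi)) -i* (ln (cabs q) / (2 * pi))); split => /=.
- rewrite ler_pdivlMr ?mulr_gt0//; lra.
- rewrite ltr_pdivrMr ?mulr_gt0//; lra.
- rewrite -[RHS]clogK// /nome /clog; congr cexp.
  have pp : 2 * pi != 0 :> R by rewrite mulf_neq0 ?gt_eqF.
  rewrite nome_argE; apply: complex_eq; rewrite /= ?mulrN ?opprK mulrC divfK//.
Qed.

(** The real parts differ by less than 1. If they differ by at most 1/2, [cexp_near1] applies with
    error 0; otherwise a shift by 1 would force the difference to be 1 or - 1. *)
Lemma nome_inj tau z : - 2^-1 <= complex.Re tau -> complex.Re tau < 2^-1 ->
  - 2^-1 <= complex.Re z -> complex.Re z < 2^-1 -> nome tau = nome z -> tau = z.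
Proof.
move=> t1 t2 z1 z2 h; have p0 := @pi_gt0 R.
have near (u : C) : nome u = 1 -> `|complex.Re u| <= 2^-1 -> u = 0.
  move=> hu; rewrite ler_norml => /andP[u1 u2].
  have h0 : cabs (2 * pi%:C * 'i%C * u) <= 8 * 0.
    apply: cexp_near1; last by lra.
      rewrite nome_argE /= ler_norml; apply/andP; split; nra.
    by rewrite -/(nome u) hu subrr cabs0.
  rewrite mulr0 in h0; have /eqP : cabs (2 * pi%:C * 'i%C * u) = 0.
    by apply/eqP; rewrite eq_le h0 cabs_ge0.
  rewrite cabs_eq0 !mulf_eq0 pnatr_eq0 /= => /orP[/orP[/eqP[]|/eqP[]]|/eqP//].
    by move=> p00; move: p0; rewrite p00 ltxx.
  by move/eqP; rewrite oner_eq0.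
have h1 : nome (tau - z) = 1 by rewrite nomeD nomeN h divff ?nome_neq0.
have [hr|hr] := lerP `|complex.Re (tau - z)| (2^-1).
  by apply/eqP; rewrite -subr_eq0; apply/eqP; exact: near.
move: (hr); rewrite cReD cReN; set r := complex.Re tau - complex.Re z.
case: (lerP 0 r) => r0 hr'; [rewrite (ger0_norm r0) in hr'|rewrite (ltr0_norm r0) in hr'].
  have h2 : nome (tau - z - 1) = 1 by rewrite nomeD h1 nomeN nome1 invr1 mulr1.
  have := near _ h2; rewrite !cReD !cReN /= -/r => /(_ _)/eqP.
  rewrite subr_eq0 => H; have /eqP e : tau - z == 1.
    by apply: H; rewrite ler_norml; apply/andP; split; rewrite /r in r0 hr' *; lra.
  have : r = 1 by rewrite /r -cReN -cReD e.
  by move=> h3; exfalso; move: h3; rewrite /r; lra.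
have h2 : nome (tau - z + 1) = 1 by rewrite nomeD1.
have := near _ h2; rewrite !cReD !cReN /= -/r => /(_ _)/eqP.
rewrite addr_eq0 => H; have /eqP e : tau - z == -1.
  by apply: H; rewrite ler_norml; apply/andP; split; rewrite /r in r0 hr' *; lra.
have : r = -1 by rewrite /r -cReN -cReD e.
by move=> h3; exfalso; move: h3; rewrite /r; lra.
Qed.

End ComplexExp.

Opaque cexp.

(** * First-order expansions in one complex variable *)

Section FirstOrder.
Variable R : realType.
Local Notation C := R[i].
Implicit Types (F G : C -> C) (q u a b : C).

(** A derivative with quadratic remainder, so that the rules of calculus become plain estimates
    without filters. *)
Definition hder F q a := exists2 K : R, 0 < K & exists2 d : R, 0 < d &
  forall u, cabs u <= d -> cabs (F (q + u) - F q - a * u) <= K * cabs u ^+ 2.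

Lemma hder_unique F G q a b (d : R) : 0 < d ->
  (forall u, cabs u <= d -> F (q + u) = G (q + u)) ->
  hder F q a -> hder G q b -> a = b.
Proof.
move=> d0 hFG [K K0 [e e0 hF]] [M M0 [f f0 hG]].
apply/eqP; rewrite -subr_eq0 -cabs_eq0 eq_le cabs_ge0 andbT.
apply/ler_addgt0Pl => z z0; rewrite addr0.
pose x := Num.min (Num.min d e) (Num.min f (z / (K + M))).
have KM : 0 < K + M by rewrite addr_gt0.
have x0 : 0 < x by rewrite !lt_min d0 e0 f0 divr_gt0.
have xc : cabs (x%:C : C) = x by rewrite cabs_real gtr0_norm.
have xd : x <= d by rewrite !ge_min lexx.
have xe : x <= e by rewrite !ge_min lexx !orbT.
have xf : x <= f by rewrite !ge_min lexx !orbT.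
have xz : x <= z / (K + M) by rewrite !ge_min lexx !orbT.
have h1 := hF x%:C; rewrite xc in h1; have {}h1 := h1 xe.
have h2 := hG x%:C; rewrite xc in h2; have {}h2 := h2 xf.
have hq : F q = G q by have := hFG 0; rewrite addr0 cabs0; apply; exact: ltW.
have hx : F (q + x%:C) = G (q + x%:C) by apply: hFG; rewrite xc.
have : cabs ((a - b) * x%:C) <= (K + M) * x ^+ 2.
  have -> : (a - b) * x%:C = (G (q + x%:C) - G q - b * x%:C) - (F (q + x%:C) - F q - a * x%:C).
    by rewrite hx hq; ring.
  apply: (le_trans (cabsB _ _)); rewrite mulrDl; lra.
rewrite cabsM xc expr2 mulrA ler_pM2r// => h; apply: (le_trans h).
by rewrite mulrC -ler_pdivlMr.
Qed.

Lemma hder_cst q b : hder (fun=> b) q 0.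
Proof.
exists 1 => //; exists 1 => // u _.
by rewrite subrr mul0r subr0 cabs0 mul1r exprn_ge0 ?cabs_ge0.
Qed.

Lemma hderD F G q a b : hder F q a -> hder G q b -> hder (fun q => F q + G q) q (a + b).
Proof.
move=> [K K0 [d d0 hF]] [M M0 [e e0 hG]]; exists (K + M); first by rewrite addr_gt0.
exists (Num.min d e); first by rewrite lt_min d0 e0.
move=> u; rewrite le_min => /andP[ud ue].
have := hF u ud; have := hG u ue.
have -> : F (q + u) + G (q + u) - (F q + G q) - (a + b) * u =
  (F (q + u) - F q - a * u) + (G (q + u) - G q - b * u) by ring.
have := cabsD (F (q + u) - F q - a * u) (G (q + u) - G q - b * u); lra.
Qed.

Lemma hderM F G q a b : hder F q a -> hder G q b ->
  hder (fun q => F q * G q) q (a * G q + F q * b).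
Proof.
move=> [K K0 [d d0 hF]] [M M0 [e e0 hG]].
pose B := cabs (G q) + cabs b + M.
have gq0 := cabs_ge0 (G q); have b0 := cabs_ge0 b; have fq0 := cabs_ge0 (F q).
have a0 := cabs_ge0 a.
exists (K * B + cabs (F q) * M + cabs a * (cabs b + M)).
  rewrite ltr_wpDr ?mulr_ge0 ?addr_ge0 ?(ltW M0)// ltr_wpDr ?mulr_ge0 ?(ltW M0)//.
  by rewrite mulr_gt0// /B; lra.
exists (Num.min 1 (Num.min d e)); first by rewrite !lt_min ltr01 d0 e0.
move=> u; rewrite !le_min => /and3P[u1 ud ue].
have h1 := hF u ud; have h2 := hG u ue; have u0 := cabs_ge0 u.
set f := F (q + u) - F q - a * u in h1; set g := G (q + u) - G q - b * u in h2.
have u2 : cabs u ^+ 2 <= 1 by rewrite exprn_ile1.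
have u21 : cabs u ^+ 2 <= cabs u by rewrite expr2 ler_piMl.
have hGu : cabs (G (q + u)) <= B.
  have -> : G (q + u) = G q + b * u + g by rewrite /g; ring.
  apply: (le_trans (cabsD _ _)); apply: lerD; last by apply: (le_trans h2); nra.
  by apply: (le_trans (cabsD _ _)); rewrite lerD2l cabsM; nra.
have hGd : cabs (G (q + u) - G q) <= (cabs b + M) * cabs u.
  have -> : G (q + u) - G q = b * u + g by rewrite /g; ring.
  by apply: (le_trans (cabsD _ _)); rewrite cabsM mulrDl lerD2l; apply: (le_trans h2); nra.
have -> : F (q + u) * G (q + u) - F q * G q - (a * G q + F q * b) * u =
   f * G (q + u) + F q * g + a * u * (G (q + u) - G q) by rewrite /f /g; ring.
apply: (le_trans (cabsD _ _)); apply: (le_trans (lerD (cabsD _ _) (lexx _))).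
rewrite !cabsM !mulrDl; apply: lerD; first apply: lerD.
- by rewrite mulrAC ler_pM ?cabs_ge0.
- by rewrite -mulrA ler_wpM2l.
- rewrite [leRHS](_ : _ = cabs a * cabs u * ((cabs b + M) * cabs u)); last by ring.
  by rewrite ler_wpM2l ?mulr_ge0.
Qed.

Lemma hder_poly (p : {poly C}) F q a : hder F q a ->
  hder (fun q => p.[F q]) q (p^`().[F q] * a).
Proof.
move=> hF; elim/poly_ind: p => [|p c IH].
  rewrite deriv0 horner0 mul0r.
  by have := hder_cst q 0; congr hder; apply/funext => x; rewrite horner0.
have := hderD (hderM IH hF) (hder_cst q c).
congr hder; first by apply/funext => x; rewrite hornerMXaddC.
rewrite derivMXaddC hornerD hornerM hornerX; ring.
Qed.

Lemma hder_geom q : q != 1 -> hder (fun q => (1 - q)^-1) q ((1 - q)^-1 ^+ 2).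
Proof.
move=> q1; have z0 : 1 - q != 0 by rewrite subr_eq0 eq_sym.
have m0 : 0 < cabs (1 - q) by rewrite cabs_gt0.
exists (2 / cabs (1 - q) ^+ 3); first by rewrite divr_gt0 ?exprn_gt0.
exists (cabs (1 - q) / 2); first by lra.
move=> u hu; have hz : cabs (1 - q) / 2 <= cabs (1 - (q + u)).
  have := cabs_subl (1 - q) u; rewrite opprD addrA; lra.
have z1 : 1 - (q + u) != 0 by rewrite -cabs_gt0; lra.
have -> : (1 - (q + u))^-1 - (1 - q)^-1 - (1 - q)^-1 ^+ 2 * u =
    u ^+ 2 * ((1 - q)^-1 ^+ 2 * (1 - (q + u))^-1) by field; rewrite z0 z1.
rewrite cabsM cabsX mulrC ler_wpM2r ?exprn_ge0 ?cabs_ge0//.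
rewrite cabsM cabsX !cabsV.
rewrite [leRHS](_ : _ = (cabs (1 - q))^-1 ^+ 2 * (cabs (1 - q) / 2)^-1); last first.
  by field; rewrite gt_eqF.
rewrite ler_wpM2l ?exprn_ge0 ?invr_ge0 ?cabs_ge0// lef_pV2 ?posrE//; lra.
Qed.

Lemma hder_pser (c : nat -> C) q : tame c -> cabs q < 1 ->
  hder (pser c) q (pser1 c q).
Proof.
move=> hc q1; have q0 := cabs_ge0 q; set r := (1 + cabs q) / 2.
have [||K K0 hK] := @pser_taylor _ c r hc; [rewrite /r; lra|rewrite /r; lra|].
exists (2 * K); first by lra.
exists ((1 - r) / 2); first by rewrite /r; lra.
have qr : cabs q <= r by rewrite /r; lra.
have [_ _ h2 h] := hK q qr => u hu; have := h u hu => hh.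
have u0 := cabs_ge0 u.
have u1 : cabs u <= 1 by apply: (le_trans hu); rewrite /r; lra.
rewrite -[X in cabs X](subrK (pser2 c q * u ^+ 2)).
apply: (le_trans (cabsD _ _)); rewrite [cabs (_ * u ^+ 2)]cabsM cabsX.
have h3 : cabs u ^+ 3 <= cabs u ^+ 2 by rewrite [_ ^+ 3]exprS ler_piMl ?exprn_ge0.
have h4 : 0 <= cabs u ^+ 2 by rewrite exprn_ge0.
have h5 := ler_wpM2r h4 h2; have h6 := ler_wpM2l (ltW K0) h3; lra.
Qed.

End FirstOrder.

(** * The series of n^j q^n as polynomials in a hyperbolic cotangent *)

Section PowerSums.
Variable R : realType.
Local Notation C := R[i].

(** Since 0^0 = 1, [powser 0] is the full geometric series; for j > 0 the term n = 0 vanishes. *)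
Definition powser j (q : C) : C := pser (fun n => n%:R ^+ j) q.

Lemma tame_pow j : tame (fun n => n%:R ^+ j : C).
Proof.
apply: (@tame_poly _ _ j) => n; rewrite cabsX cabs_nat.
by rewrite ler_expr_base// ler_nat.
Qed.

Lemma csumZ (u : nat -> C) l a : clim (fun n => \sum_(i < n) u i) l ->
  csum (fun n => a * u n) = a * l.
Proof.
move=> h; apply: climP_csum; apply: clim_eq (climZ a h) => n _.
  by rewrite mulr_sumr.
Unshelve. exact: 0%N.
Qed.

Lemma pser1P (c : nat -> C) q : tame c -> cabs q < 1 ->
  clim (fun n => \sum_(i < n) c i * (i%:R * q ^+ i.-1)) (pser1 c q).
Proof.
move=> hc q1; have q0 := cabs_ge0 q.
have [K K0 hK] := tame_sum (r := (1 + cabs q) / 2) 1 hc ltac:(lra) ltac:(lra).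
set r := (1 + cabs q) / 2 in hK.
have r0 : 0 < r by rewrite /r; lra.
have r1 : r < 1 by rewrite /r; lra.
apply: (csumP (u := fun n => c n * (n%:R * q ^+ n.-1)) (K := K / r)) => n.
rewrite ler_pdivlMr//; apply: le_trans (hK n); rewrite mulr_suml.
apply: ler_sum => i _; rewrite !cabsM cabs_nat cabsX expr1.
rewrite [leRHS]mulrCA -mulrA ler_wpM2l ?cabs_ge0// -mulrA.
apply: ler_pM => //; first by rewrite mulr_ge0 ?exprn_ge0// ltW.
  by rewrite ler_nat.
case: (nat_of_ord i) => [|m] /=; first by rewrite expr0 mul1r ltW.
rewrite exprSr ler_wpM2r ?(ltW r0)// ler_expr_base// /r; lra.
Qed.

Lemma powserS j q : cabs q < 1 ->
  powser j.+1 q = q * pser1 (fun n => n%:R ^+ j) q.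
Proof.
move=> q1; apply: etrans (csumZ (u := fun i => i%:R ^+ j * (i%:R * q ^+ i.-1)) q
  (pser1P (tame_pow j) q1)).
rewrite /powser /pser; congr csum; apply/funext => -[|n].
  by rewrite expr0n /= !(mul0r, mulr0).
by rewrite /= !exprS; ring.
Qed.

Lemma powser0 q : cabs q < 1 -> powser 0 q = (1 - q)^-1.
Proof.
move=> q1; have h := pserP (tame_pow 0) q1.
have z0 : 1 - q != 0.
  rewrite subr_eq0; apply/negP => /eqP e; move: q1; rewrite -e cabs1; lra.
apply: (mulfI z0); rewrite divff//.
apply: clim_unique (climZ (1 - q) h) _ => e e0.
have [K K0 hK] := polygeo 1 (cabs_ge0 q) q1.
have [N hN] : exists N : nat, K / e <= N%:R.
  exists (Num.truncn (K / e)).+1; apply/ltW/Num.Theory.truncnS_gt.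
exists N => n hn.
have -> : (1 - q) * (\sum_(i < n) n%:R ^+ 0 * q ^+ i) - 1 = - q ^+ n.
  under eq_bigr do rewrite expr0 mul1r.
  by rewrite -[X in X * _]opprB mulNr -subrX1; ring.
rewrite cabsN cabsX.
have h1 : n.+1%:R * cabs q ^+ n <= K.
  apply: le_trans (hK n.+1); rewrite big_ord_recr /= expr1 lerDr.
  by apply: sumr_ge0 => i _; rewrite mulr_ge0 ?exprn_ge0 ?cabs_ge0.
have n0 : (0 : R) < n.+1%:R by rewrite ltr0n.
rewrite -(ler_pM2l n0); apply: (le_trans h1).
have : N%:R <= n.+1%:R :> R by rewrite ler_nat ltnW.
rewrite ler_pdivrMr// in hN; nra.
Qed.

(* In terms of v = 1/(1-q) - 1/2 the operator q d/dq is (v^2 - 1/4) d/dv. *)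
Fixpoint eulerp j : {poly C} :=
  if j is i.+1 then ('X^2 - (4^-1)%:P) * (eulerp i)^`() else 'X + (2^-1)%:P.

(** At q = e^w this is - coth(w/2) / 2, an odd function of w with a simple pole - 1/w at 0. *)
Definition cothv (q : C) : C := (1 - q)^-1 - 2^-1.

(** Induction on j: functions that agree near q have the same derivative there, and q d/dq turns v
    into q/(1-q)^2 = v^2 - 1/4. *)
Lemma powserE j q : cabs q < 1 -> powser j q = (eulerp j).[cothv q].
Proof.
elim: j q => [|j IH] q q1.
  by rewrite powser0// /= hornerD hornerX hornerC /cothv subrK.
have q0 := cabs_ge0 q.
have z0 : q != 1 by apply/negP => /eqP e; move: q1; rewrite e cabs1; lra.
have hv : hder cothv q ((1 - q)^-1 ^+ 2).
  by have := hderD (hder_geom z0) (hder_cst q (- 2^-1)); rewrite addr0.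
have := @hder_unique _ (powser j) (fun q => (eulerp j).[cothv q]) q _ _ ((1 - cabs q) / 2) _ _
  (hder_pser (tame_pow j) q1) (hder_poly (eulerp j) hv).
move=> /(_ _ _)/= h; rewrite powserS// h; [|lra|]; last first.
  move=> u hu; apply: IH; apply: (le_lt_trans (cabsD _ _)); lra.
have z1 : 1 - q != 0 by rewrite subr_eq0 eq_sym.
rewrite hornerM hornerD hornerXn hornerN hornerC mulrCA [RHS]mulrC; congr (_ * _).
by rewrite /cothv; field.
Qed.

(** The point is the missing degree just below the leading one. It leaves an error of order |w|^-k
    once the pole of order k + 2 is removed; with order k + 1 the duplication would multiply the
    bound by 1 instead of 1/2. *)
Lemma eulerp_lead j : exists2 r : {poly C}, (size r <= j.+1)%N &
  eulerp j.+1 = j.+1`!%:R *: 'X^(j.+2) + r.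
Proof.
elim: j => [|j [r hr IH]].
  exists (- (4^-1)%:P); first by rewrite size_opp size_polyC; case: (_ != 0).
  by rewrite /= derivD derivX derivC addr0 mulr1 scale1r.
exists (- (4^-1 * (j.+2`!%:R)) *: 'X^(j.+1) + ('X^2 - (4^-1)%:P) * r^`()).
  apply: (leq_trans (size_polyD _ _)); rewrite geq_max; apply/andP; split.
    by apply: (leq_trans (size_scale_leq _ _)); rewrite size_polyXn.
  apply: (leq_trans (size_polyMleq _ _)).
  have h1 : leq (size (('X^2 - (4^-1)%:P)%R : {poly C})) 3.
    apply: (leq_trans (size_polyD _ _)); rewrite size_polyXn size_opp size_polyC.
    by rewrite geq_max; case: (_ != 0).
  have h2 : (size r^`() <= j)%N.
    apply: leq_trans (_ : (size r).-1 <= _)%N; last by lia.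
    exact: size_poly.
  by lia.
have f2 : j.+2`!%:R = j.+2%:R * j.+1`!%:R :> C by rewrite factS natrM.
rewrite f2 [eulerp j.+2]/= -/(eulerp j.+1) IH derivD derivZ derivXn [j.+2.-1]/=.
have e1 : (j.+2%:R * j.+1`!%:R : C)%:P = j.+2%:R * (j.+1`!%:R : C)%:P.
  by rewrite polyCM polyC_natr.
have e2 : 'X^(j.+3) = 'X^2 * 'X^(j.+1) :> {poly C} by rewrite -exprD.
rewrite -!mul_polyC polyCN e1 polyCM e1 e2 -mulr_natr.
set P := 'X^(j.+1) : {poly C}; set a := (j.+1`!%:R)%:P.
set n := j.+2%:R : {poly C}; set d := r^`().
ring.
Qed.

End PowerSums.

(** * Symmetric sums over translates by integers *)

Section LatticeSums.
Variable R : realType.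
Local Notation C := R[i].
Implicit Types (tau : C) (c : R).

Lemma small_inv (K e : R) : 0 < e -> exists N, forall n, (N <= n)%N -> K / n.+1%:R <= e.
Proof.
move=> e0; exists (Num.truncn (K / e)).+1 => n hn.
have h1 : K / e <= (Num.truncn (K / e)).+1%:R.
  by apply/ltW/Num.Theory.truncnS_gt.
have h2 : (Num.truncn (K / e)).+1%:R <= n.+1%:R :> R by rewrite ler_nat ltnW.
rewrite ler_pdivrMr ?ltr0n// mulrC -ler_pdivrMr//; exact: le_trans h2.
Qed.

Lemma clim_small (u : nat -> C) l (K : R) :
  (forall n, cabs (u n - l) <= K / n.+1%:R) -> clim u l.
Proof.
move=> h e e0; have [N hN] := small_inv K e0; exists N => n hn.
exact: le_trans (hN n hn).
Qed.

(** Comparison with the telescoping sum of 1/x - 1/(x+1). *)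
Lemma inv_sq_tail N M : (0 < N)%N ->
  \sum_(i < M) ((N + i).+1%:R ^+ 2)^-1 <= N%:R^-1 :> R.
Proof.
move=> N0; have hN : 0 < N%:R :> R by rewrite ltr0n.
suff : \sum_(i < M) ((N + i).+1%:R ^+ 2)^-1 <= N%:R^-1 - (N + M)%:R^-1 :> R.
  by move=> h; apply: (le_trans h); rewrite gerBl invr_ge0.
elim: M => [|M IH]; first by rewrite big_ord0 addn0 subrr.
rewrite big_ord_recr /= addnS.
have x0 : 0 < (N + M)%:R :> R by rewrite ltr0n addn_gt0 N0.
have -> : (N + M).+1%:R = (N + M)%:R + 1 :> R by rewrite natr1.
move: IH x0; set x := (N + M)%:R; set s := \sum_(i < M) _ => IH x0.
suff : ((x + 1) ^+ 2)^-1 <= x^-1 - (x + 1)^-1 by lra.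
have -> : x^-1 - (x + 1)^-1 = (x * (x + 1))^-1 by field; rewrite ?gt_eqF//; lra.
by rewrite lef_pV2 ?posrE ?exprn_gt0 ?mulr_gt0//; nra.
Qed.

Lemma inv_sq_sum N : \sum_(i < N) (i.+1%:R ^+ 2)^-1 <= 2 :> R.
Proof.
case: N => [|N]; first by rewrite big_ord0.
rewrite big_ord_recl /= expr1n invr1.
have := inv_sq_tail N (ltn0Sn 0); rewrite invr1.
have -> : \sum_(i < N) ((lift ord0 i).+1%:R ^+ 2)^-1 = \sum_(i < N) ((1 + i).+1%:R ^+ 2)^-1 :> R.
  by apply: eq_bigr => i _; rewrite lift0.
lra.
Qed.

Definition lterm k tau n : C :=
  ((tau + n.+1%:R) ^+ k)^-1 + ((tau - n.+1%:R) ^+ k)^-1.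

Definition lpart k tau N : C := (tau ^+ k)^-1 + \sum_(n < N) lterm k tau n.

Definition lsum k tau : C := (tau ^+ k)^-1 + csum (lterm k tau).

(** Distance to the nonzero integers, linear in their size. A single c for all multiples of tau
    makes the tails uniform over the rows of the double sum. *)
Definition far c tau := forall n : nat,
  c * n.+1%:R <= cabs (tau + n.+1%:R) /\ c * n.+1%:R <= cabs (tau - n.+1%:R).

Lemma lterm_le k c tau n : 0 < c -> far c tau ->
  cabs (lterm k tau n) <= 2 * (c ^+ k)^-1 * (n.+1%:R ^+ k)^-1.
Proof.
move=> c0 hf; have [h1 h2] := hf n.
have x0 : 0 < c * n.+1%:R by rewrite mulr_gt0 ?ltr0n.
apply: (le_trans (cabsD _ _)).
have aux (z : C) : c * n.+1%:R <= cabs z -> cabs (z ^+ k)^-1 <= (c ^+ k)^-1 * (n.+1%:R ^+ k)^-1.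
  move=> h; rewrite cabsV cabsX -invfM -exprMn lef_pV2 ?posrE ?exprn_gt0//.
    by rewrite ler_expr_base// ltW.
  exact: lt_le_trans h.
by have := aux _ h1; have := aux _ h2; lra.
Qed.

Lemma lterm_sum k c tau : 0 < c -> far c tau -> forall n,
  \sum_(i < n) cabs (lterm k.+2 tau i) <= 4 * (c ^+ k.+2)^-1.
Proof.
move=> c0 hf n; apply: (@le_trans _ _ (\sum_(i < n) 2 * (c ^+ k.+2)^-1 * (i.+1%:R ^+ 2)^-1)).
  apply: ler_sum => i _; apply: (le_trans (lterm_le _ _ c0 hf)).
  rewrite ler_wpM2l ?mulr_ge0 ?invr_ge0 ?exprn_ge0 ?(ltW c0)//.
  by rewrite lef_pV2 ?posrE ?exprn_gt0 ?ltr0n// ler_weXn2l ?ler1n.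
rewrite -mulr_sumr.
have -> : 4 * (c ^+ k.+2)^-1 = 2 * (c ^+ k.+2)^-1 * 2 by ring.
by rewrite ler_wpM2l ?inv_sq_sum ?mulr_ge0 ?invr_ge0 ?exprn_ge0 ?(ltW c0).
Qed.

Lemma lpartP k c tau : 0 < c -> far c tau -> clim (lpart k.+2 tau) (lsum k.+2 tau).
Proof.
move=> c0 hf; apply: climD; first exact: clim_cst.
exact: csumP (lterm_sum k c0 hf).
Qed.

(** The power k + 1 matters: the N + 1 rows of the square sum add up to an error O(N^-k), which
    tends to 0 for k > 0. *)
Lemma lsum_tail k c tau N : 0 < c -> far c tau ->
  cabs (lsum k.+2 tau - lpart k.+2 tau N.+1) <=
    2 * (c ^+ k.+2)^-1 * (N.+1%:R ^+ k.+1)^-1.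
Proof.
move=> c0 hf; apply: (clim_bound (N := N.+1) (lpartP k c0 hf)) => n hn.
rewrite -(subnKC hn) /lpart big_split_ord /= addrA opprD addrA.
rewrite [X in cabs X](_ : _ = \sum_(i < n - N.+1) lterm k.+2 tau (N.+1 + i)%N); last first.
  by ring.
apply: (le_trans (cabs_sum _ _ _)).
apply: (@le_trans _ _ (\sum_(i < n - N.+1) 2 * (c ^+ k.+2)^-1 * (N.+1%:R ^+ k)^-1 * ((N.+1 + i).+1%:R ^+ 2)^-1)).
  apply: ler_sum => i _; apply: (le_trans (lterm_le _ _ c0 hf)).
  rewrite -!mulrA !ler_wpM2l ?invr_ge0 ?exprn_ge0 ?(ltW c0)//.
  rewrite -invfM lef_pV2 ?posrE ?exprn_gt0 ?mulr_gt0 ?exprn_gt0 ?ltr0n//.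
  rewrite -[in leRHS](addn2 k) exprD ler_wpM2r ?exprn_ge0//.
  by rewrite ler_expr_base// ler_nat; lia.
rewrite -mulr_sumr [N.+1%:R ^+ k.+1]exprSr [(_ * N.+1%:R)^-1]invfM [_ * (_ * _^-1)]mulrA.
rewrite ler_wpM2l ?mulr_ge0 ?invr_ge0 ?exprn_ge0 ?(ltW c0)//.
exact: inv_sq_tail.
Qed.

(** |m tau + n| is at least m y and also at least |n| - m |tau|; weighting these by |tau| and y
    eliminates m. *)
Lemma lattice_far tau : 0 < complex.Im tau -> exists2 c, 0 < c &
  forall m : nat, far c (m%:R * tau).
Proof.
move=> y0; set y := complex.Im tau; have t0 := cabs_ge0 tau.
have d0 : 0 < y + cabs tau by rewrite ltr_wpDr.
exists (y / (y + cabs tau)); first by rewrite divr_gt0.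
move=> m n; have aux (z : C) : z = n.+1%:R \/ z = - n.+1%:R ->
    y / (y + cabs tau) * n.+1%:R <= cabs (m%:R * tau + z).
  move=> hz; have zc : cabs z = n.+1%:R by case: hz => ->; rewrite ?cabsN cabs_nat.
  have zi : complex.Im z = 0 by case: hz => ->; rewrite ?cImN cIm_nat ?oppr0.
  have h1 : m%:R * y <= cabs (m%:R * tau + z).
    apply: le_trans (cabsIm _); rewrite cImD zi addr0 cImM cIm_nat cRe_nat mul0r addr0.
    exact: ler_norm.
  have h2 : n.+1%:R - m%:R * cabs tau <= cabs (m%:R * tau + z).
    by have := cabs_addl z (m%:R * tau); rewrite zc cabsM cabs_nat [z + _]addrC.
  rewrite mulrAC ler_pdivrMr// mulrDr; set a := cabs (_ + z) in h1 h2 *.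
  have := ler_wpM2l (ltW y0) h2; have := ler_wpM2r t0 h1; rewrite -/y; lra.
split; first by apply: aux; left.
by apply: aux; right.
Qed.

Lemma strip_far tau : `|complex.Re tau| <= 2^-1 -> far 2^-1 tau.
Proof.
rewrite ler_norml => /andP[h1 h2] n.
have n1 : 1 <= n.+1%:R :> R by rewrite ler1n.
split; apply: le_trans (cabsRe _); rewrite cReD ?cReN cRe_nat.
  by rewrite ger0_norm; lra.
by rewrite ler0_norm; lra.
Qed.

Lemma inv_pow_to0 k c tau : 0 < c -> far c tau ->
  clim (fun n => ((tau + n.+1%:R) ^+ k.+1)^-1) 0 /\
  clim (fun n => ((tau - n.+1%:R) ^+ k.+1)^-1) 0.
Proof.
move=> c0 hf.
have aux n (z : C) : c * n.+1%:R <= cabs z ->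
    cabs ((z ^+ k.+1)^-1 - 0) <= (c ^+ k.+1)^-1 / n.+1%:R.
  move=> h; rewrite subr0 cabsV cabsX -invfM lef_pV2 ?posrE ?mulr_gt0 ?exprn_gt0 ?ltr0n//; last first.
    by apply: lt_le_trans h; rewrite mulr_gt0 ?ltr0n.
  apply: (@le_trans _ _ ((c * n.+1%:R) ^+ k.+1)); last first.
    by rewrite ler_expr_base// mulr_ge0// ltW.
  rewrite exprMn ler_wpM2l ?exprn_ge0 ?(ltW c0)//.
  by rewrite exprS ler_peMr// exprn_ege1// ler1n.
by split; apply: clim_small => n; have [h1 h2] := hf n; exact: aux.
Qed.

(** The partial sums at tau + 1 and at tau differ by one boundary term at each end, and both tend to
    0. *)
Lemma lsum_periodic k tau : 0 < complex.Im tau -> lsum k.+2 (tau + 1) = lsum k.+2 tau.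
Proof.
move=> y0; have [c c0 hf] := lattice_far y0; have {}hf := hf 1%N; rewrite mul1r in hf.
have [|d d0 hg] := @lattice_far (tau + 1); first by rewrite cImD /= addr0.
have {}hg := hg 1%N; rewrite mul1r in hg.
apply: (clim_unique (lpartP k d0 hg)).
have [l1 l2] := inv_pow_to0 k.+1 c0 hf.
have key N : lpart k.+2 (tau + 1) N = lpart k.+2 tau N + ((tau + N.+1%:R) ^+ k.+2)^-1
     - (if N is M.+1 then ((tau - M.+1%:R) ^+ k.+2)^-1 else (tau ^+ k.+2)^-1).
  elim: N => [|N IH]; first by rewrite /lpart !big_ord0 !addr0 addrAC subrr add0r.
  have e1 : lpart k.+2 (tau + 1) N.+1 = lpart k.+2 (tau + 1) N + lterm k.+2 (tau + 1) N.
    by rewrite /lpart big_ord_recr addrA.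
  have e2 : lpart k.+2 tau N.+1 = lpart k.+2 tau N + lterm k.+2 tau N.
    by rewrite /lpart big_ord_recr addrA.
  rewrite e1 e2 IH /lterm.
  have -> : tau + 1 + N.+1%:R = tau + N.+2%:R by rewrite -[N.+2%:R]natr1; ring.
  have -> : tau + 1 - N.+1%:R = tau - N%:R by rewrite -[N.+1%:R]natr1; ring.
  by case: N {IH e1 e2} => [|N]; rewrite ?subr0; ring.
apply: (@clim_shift _ _ _ 1).
have := climB (climD (clim_sub (s := S) leqnSn (lpartP k c0 hf))
  (clim_sub (s := S) leqnSn l1)) l2.
rewrite subr0 addr0; apply: (clim_eq (N := 0%N)) => n _.
by rewrite addn1 key.
Qed.

Lemma inv_half_pow k (z : C) : ((z / 2) ^+ k)^-1 = 2 ^+ k * (z ^+ k)^-1.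
Proof. by rewrite exprMn invfM exprVn invrK mulrC. Qed.

(** The points tau/2 + n and (tau+1)/2 + n are halves of tau plus the even and the odd integers. For
    |n| <= N the odd ones run from - 2N + 1 to 2N + 1, hence the extra term. *)
Lemma lpart_dup k tau N :
  lpart k (tau / 2) N + lpart k ((tau + 1) / 2) N =
  2 ^+ k * (lpart k tau N.*2 + ((tau + N.*2.+1%:R) ^+ k)^-1).
Proof.
have two0 : (2 : C) != 0 by rewrite pnatr_eq0.
have lpS t M : lpart k t M.+1 = lpart k t M + lterm k t M.
  by rewrite /lpart big_ord_recr addrA.
elim: N => [|N IH]; first by rewrite /lpart !big_ord0 !addr0 !inv_half_pow mulrDr.
rewrite doubleS !lpS addrACA IH /lterm.
have dN : N.*2%:R = 2 * N%:R :> C by rewrite -mul2n natrM.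
have -> : tau / 2 + N.+1%:R = (tau + N.*2.+2%:R) / 2.
  by rewrite -!natr1 dN; field.
have -> : tau / 2 - N.+1%:R = (tau - N.*2.+2%:R) / 2.
  by rewrite -!natr1 dN; field.
have -> : (tau + 1) / 2 + N.+1%:R = (tau + N.*2.+3%:R) / 2.
  by rewrite -!natr1 dN; field.
have -> : (tau + 1) / 2 - N.+1%:R = (tau - N.*2.+1%:R) / 2.
  by rewrite -!natr1 dN; field.
rewrite !inv_half_pow; ring.
Qed.

Lemma lsum_dup k tau : 0 < complex.Im tau ->
  lsum k.+2 (tau / 2) + lsum k.+2 ((tau + 1) / 2) = 2 ^+ k.+2 * lsum k.+2 tau.
Proof.
move=> y0.
have Imh (z : C) : complex.Im (z / 2) = complex.Im z / 2.
  have -> : (2 : C)^-1 = (2^-1)%:C by rewrite fmorphV rmorph_nat.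
  by rewrite cImM /= mulr0 add0r.
have F t : 0 < complex.Im t -> exists2 c, 0 < c & far c t.
  by move=> /lattice_far[c c0 h]; exists c => //; have := h 1%N; rewrite mul1r.
have [a a0 ha] := F _ y0.
have [|b b0 hb] := F (tau / 2); first by rewrite Imh; lra.
have [|c c0 hc] := F ((tau + 1) / 2); first by rewrite Imh cImD /=; lra.
have [l1 _] := inv_pow_to0 k.+1 a0 ha.
have dle n : (n <= n.*2)%N by rewrite -addnn leq_addr.
have h1 := climD (lpartP k b0 hb) (lpartP k c0 hc).
have h2 := climZ (2 ^+ k.+2) (climD (clim_sub dle (lpartP k a0 ha)) (clim_sub dle l1)).
rewrite addr0 in h2; apply: clim_unique h1 _.
by apply: (clim_eq (N := 0%N)) h2 => n _; rewrite -lpart_dup.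
Qed.

(** Odd powers cancel, and n = 2m contributes 2^j m^j twice. *)
Lemma powser_dup j (p : C) : cabs p < 1 ->
  powser j p + powser j (- p) = 2 ^+ j.+1 * powser j (p ^+ 2).
Proof.
move=> p1; have p0 := cabs_ge0 p.
have p2 : cabs (p ^+ 2) < 1 by rewrite cabsX expr2; nra.
have pN : cabs (- p) < 1 by rewrite cabsN.
have dle n : (n <= n.*2)%N by rewrite -addnn leq_addr.
have h1 := clim_sub dle (climD (pserP (tame_pow j) p1) (pserP (tame_pow j) pN)).
have h2 := climZ (2 ^+ j.+1) (pserP (tame_pow j) p2).
apply: (clim_unique h1); apply: (clim_eq (N := 0%N)) h2 => n _.
elim: n => [|n IH]; first by rewrite !big_ord0 mulr0 addr0.
rewrite doubleS !big_ord_recr /= mulrDr IH.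
have -> : (- p) ^+ n.*2.+1 = - p ^+ n.*2.+1 by rewrite exprNn -signr_odd /= odd_double expr1 mulN1r.
have -> : (- p) ^+ n.*2 = p ^+ n.*2 by rewrite exprNn -signr_odd odd_double mul1r.
have -> : n.*2%:R ^+ j = 2 ^+ j * n%:R ^+ j :> C by rewrite -mul2n natrM exprMn.
rewrite -exprM mul2n exprS; ring.
Qed.

End LatticeSums.

(** * The Lipschitz formula *)

Section Lipschitz.
Variable R : realType.
Local Notation C := R[i].
Implicit Types (tau : C).

(** The codomain is arbitrary because the reduction is applied to complex values, to real values and
    to the truth value of a nonvanishing. *)
Lemma shift_reduce (T : Type) (f : C -> T) tau :
  (forall t, complex.Im t = complex.Im tau -> f (t + 1) = f t) ->
  exists t, [/\ complex.Im t = complex.Im tau, `|complex.Re t| <= 2^-1 & f t = f tau].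
Proof.
move=> hf.
have hn (n : nat) t : complex.Im t = complex.Im tau ->
    f (t + n%:R) = f t /\ complex.Im (t + n%:R) = complex.Im tau.
  move=> ht; elim: n => [|n [IH1 IH2]]; first by rewrite addr0.
  rewrite -natr1 addrA; split; first by rewrite hf ?IH1.
  by rewrite cImD IH2 /= addr0.
set m := Num.floor (complex.Re tau + 2^-1).
have h1 := Num.Theory.floor_le_tmp (complex.Re tau + 2^-1).
have h2 := Num.Theory.floorD1_gt (complex.Re tau + 2^-1).
rewrite -/m in h1 h2; rewrite intrD /= in h2.
case: (intP m) h1 h2 => [|n|n] h1 h2.
- exists tau; split => //; rewrite ler_norml; apply/andP; split; lra.
- have e := hn n.+1 (tau - n.+1%:R); rewrite subrK in e.
  have ei : complex.Im (tau - n.+1%:R) = complex.Im tau by rewrite cImD cImN cIm_nat subr0.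
  exists (tau - n.+1%:R); split => //; last by rewrite (e ei).1.
  rewrite cReD cReN cRe_nat ler_norml; rewrite -pmulrn in h1 h2.
  by apply/andP; split; lra.
- have [e1 e2] := hn n.+1 tau erefl.
  exists (tau + n.+1%:R); split => //.
  rewrite cReD cRe_nat ler_norml; rewrite mulrNz -pmulrn in h1 h2.
  by apply/andP; split; lra.
Qed.

(** The classical factor is (- 2 pi i)^(k+1) / k!; the sign disappears because the formula is used
    in even weight k + 1. *)
Definition lipc k : C := (2 * pi%:C * 'i%C) ^+ k.+1 / k`!%:R.

(* Herglotz' trick: the difference S of the two sides satisfies |S| <= C y^-k, and
   2^(k+2) S(t) = S(t/2) + S((t+1)/2) halves the constant C, so that S = 0. *)
Definition lipS k tau : C :=
  lsum k.+2 tau - lipc k.+1 * powser k.+1 (nome tau).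

Lemma Im_half (z : C) : complex.Im (z / 2) = complex.Im z / 2.
Proof.
have -> : (2 : C)^-1 = (2^-1)%:C by rewrite fmorphV rmorph_nat.
by rewrite cImM /= mulr0 add0r.
Qed.

Lemma lipS_periodic k tau : 0 < complex.Im tau -> lipS k (tau + 1) = lipS k tau.
Proof. by move=> y0; rewrite /lipS (lsum_periodic k y0) (nomeD1 tau). Qed.

Lemma lipS_dup k tau : 0 < complex.Im tau ->
  2 ^+ k.+2 * lipS k tau = lipS k (tau / 2) + lipS k ((tau + 1) / 2).
Proof.
move=> y0; rewrite /lipS mulrBr -lsum_dup// mulrCA.
have p1 : cabs (nome (tau / 2)) < 1.
  by apply: cabs_nome_lt1; rewrite /upper_half /= Im_half; lra.
have -> : nome tau = nome (tau / 2) ^+ 2 by rewrite -nomeMn mulrCA divff ?mulr1// pnatr_eq0.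
have -> : nome ((tau + 1) / 2) = - nome (tau / 2).
  by rewrite mulrDl mul1r nomeD nome_half mulrN1.
rewrite -(powser_dup k.+1 p1).
set a := lsum _ _; set b := lsum _ _; set c := powser _ _; set d := powser _ _.
ring.
Qed.

Lemma one_sub_cexp_lb (w : C) : `|complex.Im w| <= pi ->
  1 / 2 <= cabs (1 - cexp w) \/ cabs w / 8 <= cabs (1 - cexp w).
Proof.
move=> hx; have [h|h] := lerP (1 / 2) (cabs (1 - cexp w)); [by left|right].
by rewrite ler_pdivrMr// mulrC; apply: cexp_near1 => //; [rewrite cabsC|exact: ltW].
Qed.

Lemma cothv_identity (w q e : C) : w != 0 -> 1 - q != 0 ->
  q = 1 + w + w ^+ 2 / 2 + e ->
  cothv q + w^-1 = (w ^+ 3 / 2 + w * e - 2 * e) * (2 * w * (1 - q))^-1.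
Proof.
move=> w0 z0 qE; rewrite /cothv.
have -> : w ^+ 3 / 2 + w * e - 2 * e = w * (1 + q) + 2 * (1 - q).
  by rewrite qE; field.
by field; rewrite w0 z0.
Qed.

(** For q = 1 + w + w^2/2 + e the numerator w (1+q) + 2 (1-q) equals w^3/2 + w e - 2 e, of order 3,
    against a denominator of order 2. *)
Lemma cothv_approx (w : C) : `|complex.Im w| <= pi -> w != 0 -> cabs w <= 1 ->
  cabs (cothv (cexp w) + w^-1) <= 50 * cabs w.
Proof.
move=> hx w0 w1; have m0 : 0 < cabs w by rewrite cabs_gt0.
have hlb : cabs w / 8 <= cabs (1 - cexp w) by case: (one_sub_cexp_lb hx); lra.
have he := cexp_taylor w1; move: hlb he; move: (cexp w) => q hlb.
have z0 : 1 - q != 0 by rewrite -cabs_gt0; lra.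
have : q = 1 + w + w ^+ 2 / 2 + (q - (1 + w + w ^+ 2 / 2)) by rewrite [RHS]addrC subrK.
move: (q - (1 + w + w ^+ 2 / 2)) => e qE he; rewrite (cothv_identity w0 z0 qE).
have hn : cabs (w ^+ 3 / 2 + w * e - 2 * e) <= (25 / 2) * cabs w ^+ 3.
  apply: (le_trans (cabsB _ _)); apply: (le_trans (lerD (cabsD _ _) (lexx _))).
  rewrite [cabs (_ / 2)]cabsM cabsV [cabs (w * e)]cabsM [cabs (2 * e)]cabsM cabsX !cabs_nat.
  have := cabs_ge0 e; set m3 := cabs w ^+ 3 in he *; nra.
rewrite cabsM cabsV ler_pdivrMr; last by rewrite cabs_gt0 !mulf_neq0 ?pnatr_eq0.
apply: (le_trans hn); rewrite !cabsM cabs_nat.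
have -> : 25 / 2 * cabs w ^+ 3 = 100 * cabs w ^+ 2 * (cabs w / 8) by rewrite exprS; field.
have -> : 50 * cabs w * (2 * cabs w * cabs (1 - q)) = 100 * cabs w ^+ 2 * cabs (1 - q) by ring.
by rewrite ler_wpM2l// mulr_ge0 ?exprn_ge0// ltW.
Qed.

Lemma horner_bound (p : {poly C}) n : (size p <= n.+1)%N ->
  exists2 K : R, 0 < K & forall v (M : R), 1 <= M -> cabs v <= M ->
    cabs p.[v] <= K * M ^+ n.
Proof.
move=> hp; exists (1 + \sum_(i < n.+1) cabs p`_i).
  by rewrite ltr_wpDr// sumr_ge0// => i _; exact: cabs_ge0.
move=> v M M1 hv; have M0 : 0 <= M by lra.
rewrite (horner_coef_wide _ hp); apply: (le_trans (cabs_sum _ _ _)).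
rewrite mulrDl ler_wpDl ?mulr_ge0 ?exprn_ge0//.
rewrite mulr_suml; apply: ler_sum => i _; rewrite cabsM cabsX ler_wpM2l ?cabs_ge0//.
apply: (@le_trans _ _ (M ^+ i)); first by rewrite ler_expr_base ?cabs_ge0.
by rewrite ler_weXn2l// -ltnS.
Qed.

(** For |w| <= 1 the two poles of order k + 2 cancel and the gap in [eulerp_lead] leaves order k.
    For |w| > 1 every term is bounded, and 1 <= (Y/y)^k gives a bounded term the required shape. *)
Lemma lipS_bound k (Y : R) : ~~ odd k -> 0 < Y -> exists2 K : R, 0 < K &
  forall tau, 0 < complex.Im tau -> complex.Im tau <= Y -> `|complex.Re tau| <= 2^-1 ->
    cabs (lipS k tau) <= K * (complex.Im tau ^+ k)^-1.
Proof.
move=> ek Y0; have p0 := @pi_gt0 R.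
have [r hr eulE] := eulerp_lead R k.
have [Kr Kr0 hKr] := horner_bound hr.
have [Ke Ke0 hKe] := @horner_bound (eulerp R k.+1) (size (eulerp R k.+1)) (leqnSn _).
have c2 : 0 < cabs (lipc k.+1).
  rewrite cabs_gt0 /lipc mulf_neq0 ?invr_eq0 ?pnatr_eq0 -?lt0n ?fact_gt0// expf_neq0//.
  rewrite !mulf_neq0 ?pnatr_eq0//; first by rewrite eq_complex /= gt_eqF.
  by rewrite eq_complex /= oner_eq0 andbF.
set c := cabs (lipc k.+1) in c2.
pose K1 := c * (k.+1`!%:R * (k.+2%:R * 51 ^+ k.+1 * 50) + Kr * 51 ^+ k).
pose K2 := (2 * pi) ^+ k.+2 + c * (Ke * 9 ^+ size (eulerp R k.+1)).
pose L := 4 * (2^-1 ^+ k.+2)^-1 : R.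
have L0 : 0 < L by rewrite mulr_gt0// invr_gt0 exprn_gt0// invr_gt0.
have K10 : 0 < K1.
  by rewrite mulr_gt0// ltr_wpDl ?mulr_ge0 ?exprn_ge0 ?mulr_gt0 ?exprn_gt0.
have K20 : 0 < K2.
  by apply: addr_gt0; [rewrite exprn_gt0 ?mulr_gt0|rewrite !mulr_gt0 ?exprn_gt0].
exists (K1 + (K2 + L) * Y ^+ k); first by rewrite addr_gt0// mulr_gt0 ?exprn_gt0// addr_gt0.
move=> tau y0 yY hx; set y := complex.Im tau in y0 yY *.
set w := 2 * pi%:C * 'i%C * tau.
have wE : cabs w = 2 * pi * cabs tau.
  by rewrite /w !cabsM cabs_nat cabsi mulr1 cabs_real gtr0_norm.
have yt : y <= cabs tau by apply: le_trans (cabsIm _); exact: ler_norm.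
have t0 : 0 < cabs tau by exact: lt_le_trans yt.
have p2 := @pi_ge2 R.
have yw : y <= cabs w by rewrite wE; nra.
have w0 : w != 0 by rewrite -cabs_gt0; lra.
have q1 : cabs (nome tau) < 1 by apply: cabs_nome_lt1.
have hL : cabs (csum (lterm k.+2 tau)) <= L.
  apply: csum_le (fun=> lexx _) _; apply: lterm_sum; first by lra.
  exact: strip_far.
have -> : lipS k tau = (tau ^+ k.+2)^-1 - lipc k.+1 * (eulerp R k.+1).[cothv (nome tau)]
    + csum (lterm k.+2 tau) by rewrite /lipS /lsum powserE//; ring.
have yk0 : 0 < y ^+ k by rewrite exprn_gt0.
have hY : 1 <= Y ^+ k * (y ^+ k)^-1 by rewrite ler_pdivlMr// mul1r ler_expr_base ?(ltW y0).
suff main : cabs ((tau ^+ k.+2)^-1 - lipc k.+1 * (eulerp R k.+1).[cothv (nome tau)])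
    <= K1 * (y ^+ k)^-1 \/
    cabs ((tau ^+ k.+2)^-1 - lipc k.+1 * (eulerp R k.+1).[cothv (nome tau)]) <= K2.
  apply: (le_trans (cabsD _ _)); apply: (le_trans (lerD (lexx _) hL)).
  have i0 : 0 < (y ^+ k)^-1 by rewrite invr_gt0.
  have h1 : L <= L * (Y ^+ k * (y ^+ k)^-1) by rewrite ler_peMr// ltW.
  have h2 : K2 <= K2 * (Y ^+ k * (y ^+ k)^-1) by rewrite ler_peMr// ltW.
  have h3 : 0 < K1 * (y ^+ k)^-1 by rewrite mulr_gt0.
  rewrite mulrDl -[X in _ <= _ + X]mulrA mulrDl.
  by case: main; lra.
have hw : `|complex.Im w| <= pi.
  rewrite /w nome_argE /= normrM ger0_norm ?mulr_ge0 ?pi_ge0//.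
  by have := normr_ge0 (complex.Re tau); nra.
have nE : nome tau = cexp w by [].
rewrite nE; set v := cothv (cexp w).
have [w1|w1] := lerP (cabs w) 1; [left|right]; last first.
  have hlb : 1 / 8 <= cabs (1 - cexp w) by case: (one_sub_cexp_lb hw); lra.
  have hv : cabs v <= 9.
    rewrite /v /cothv; apply: (le_trans (cabsB _ _)); rewrite !cabsV cabs_nat.
    have : (cabs (1 - cexp w))^-1 <= (1 / 8)^-1 by rewrite lef_pV2 ?posrE//; lra.
    have -> : (1 / 8)^-1 = 8 :> R by field.
    lra.
  apply: (le_trans (cabsB _ _)); apply: lerD.
    rewrite cabsV cabsX -[leLHS]mul1r ler_pdivrMr ?exprn_gt0// -exprMn -wE.
    by rewrite exprn_ege1// ltW.
  by rewrite cabsM ler_wpM2l ?(ltW c2)//; apply: hKe => //; lra.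
have m0 : 0 < cabs w by rewrite cabs_gt0.
have happ := cothv_approx hw w0 w1; rewrite -/v in happ.
(* |v| <= |v + 1/w| + 1/|w| <= 50 |w| + 1/|w|, and |w| <= 1 <= 1/|w|. *)
set M := 51 * (cabs w)^-1.
have iw : 1 <= (cabs w)^-1 by rewrite invf_ge1.
have M1 : 1 <= M by rewrite /M; lra.
have hwM : cabs (- w^-1) <= M by rewrite cabsN cabsV /M; lra.
have hvM : cabs v <= M.
  have -> : v = (v + w^-1) - w^-1 by rewrite addrK.
  apply: (le_trans (cabsB _ _)); rewrite cabsV /M.
  have : cabs w <= (cabs w)^-1 by lra.
  lra.
(* Evenness of k removes the sign of (- 1/w)^(k+2), so the leading term of [eulerp] reproduces the
   pole of the lattice sum exactly. *)
have tauE : (tau ^+ k.+2)^-1 = lipc k.+1 * (k.+1`!%:R * (- w^-1) ^+ k.+2).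
  have gen (A B T : C) : A != 0 -> B != 0 -> T != 0 -> T^-1 = A / B * (B * (A * T)^-1).
    by move=> A0 B0 T0; field; rewrite A0 B0 T0.
  have -> : (- w^-1) ^+ k.+2 = (w ^+ k.+2)^-1.
    by rewrite exprNn -signr_odd /= negbK (negbTE ek) mul1r exprVn.
  have -> : w ^+ k.+2 = (2 * pi%:C * 'i%C) ^+ k.+2 * tau ^+ k.+2 by rewrite exprMn.
  apply: gen; last by rewrite expf_neq0// -cabs_gt0.
    by apply: expf_neq0; apply: contraNneq w0 => e; rewrite /w e mul0r; exact: eqxx.
  by rewrite pnatr_eq0 -lt0n fact_gt0.
rewrite tauE eulE hornerD hornerZ hornerXn -mulrBr opprD addrA -mulrBr.
rewrite cabsM /K1 -mulrA ler_wpM2l ?(ltW c2)//.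
apply: (@le_trans _ _ ((k.+1`!%:R * (k.+2%:R * 51 ^+ k.+1 * 50) + Kr * 51 ^+ k) * (cabs w ^+ k)^-1)); last first.
  rewrite ler_wpM2l ?addr_ge0 ?mulr_ge0 ?exprn_ge0 ?(ltW Kr0)//.
  by rewrite lef_pV2 ?posrE ?exprn_gt0// ler_expr_base// ltW.
apply: (le_trans (cabsB _ _)); rewrite mulrDl; apply: lerD.
  rewrite cabsM cabs_nat -mulrA ler_wpM2l//.
  apply: (le_trans (cabs_expB k.+1 hwM hvM)).
  rewrite -mulrA -[in leRHS]mulrA -[in leRHS]mulrA ler_wpM2l//.
  rewrite /M exprMn -mulrA ler_wpM2l ?exprn_ge0//.
  have -> : 50 * (cabs w ^+ k)^-1 = (cabs w)^-1 ^+ k.+1 * (50 * cabs w).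
    rewrite exprS exprVn; field; rewrite expf_neq0 ?gt_eqF//.
  rewrite ler_wpM2l ?exprn_ge0 ?invr_ge0 ?(ltW m0)//.
  by rewrite cabsC opprK.
apply: (le_trans (hKr _ _ M1 hvM)).
by rewrite /M exprMn exprVn mulrA.
Qed.

Lemma lipS_eq0 k tau : ~~ odd k -> 0 < complex.Im tau -> lipS k tau = 0.
Proof.
move=> ek y0; set Y := complex.Im tau.
have [K K0 hK] := lipS_bound ek y0.
(* Periodicity carries the bound from the strip to all points of height at most Y, and halving a
   point keeps its height below Y. *)
have b0 (t : C) : 0 < complex.Im t -> complex.Im t <= Y ->
    cabs (lipS k t) <= K * (complex.Im t ^+ k)^-1.
  move=> t0 tY.
  have [|s [sI sR sE]] := @shift_reduce _ (lipS k) t.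
    by move=> s hs; apply: lipS_periodic; rewrite hs.
  by rewrite -sE -sI; apply: hK => //; rewrite sI.
have bn n (t : C) : 0 < complex.Im t -> complex.Im t <= Y ->
    cabs (lipS k t) <= K / 2 ^+ n * (complex.Im t ^+ k)^-1.
  elim: n t => [|n IH] t t0 tY; first by rewrite expr0 divr1 b0.
  have h2 : 0 < 2 ^+ k.+2 :> R by rewrite exprn_gt0.
  rewrite -(ler_pM2l h2).
  have -> : 2 ^+ k.+2 * cabs (lipS k t) = cabs (2 ^+ k.+2 * lipS k t).
    by rewrite cabsM cabsX cabs_nat.
  rewrite lipS_dup//; apply: (le_trans (cabsD _ _)).
  have h3 := IH (t / 2); rewrite Im_half in h3.
  have h4 := IH ((t + 1) / 2); rewrite Im_half cImD /= addr0 in h4.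
  have p1 : 0 < complex.Im t / 2 by rewrite divr_gt0.
  have p2 : complex.Im t / 2 <= Y.
    by apply: le_trans tY; rewrite ler_pdivrMr// ler_peMr ?(ltW t0) ?ler1n.
  apply: (le_trans (lerD (h3 p1 p2) (h4 p1 p2))).
  rewrite exprMn exprVn invfM invrK !exprS le_eqVlt; apply/orP; left; apply/eqP.
  by field; rewrite !expf_neq0 ?gt_eqF.
apply/eqP; rewrite -cabs_eq0 eq_le cabs_ge0 andbT.
apply/ler_addgt0Pl => e e0; rewrite addr0.
set B := K * (Y ^+ k)^-1.
have [N hN] := small_inv B e0; have := hN N (leqnn N).
have B0 : 0 <= B by rewrite mulr_ge0 ?invr_ge0 ?exprn_ge0 ?ltW.
move=> h; apply: le_trans h; apply: (le_trans (bn N.+1 tau y0 (lexx _))).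
rewrite mulrAC -/B ler_wpM2l// lef_pV2 ?posrE ?exprn_gt0 ?ltr0n//.
by rewrite -natrX ler_nat ltnW// ltn_expl.
Qed.

Lemma lipschitz_formula k tau : ~~ odd k -> 0 < complex.Im tau ->
  lsum k.+2 tau = lipc k.+1 * powser k.+1 (nome tau).
Proof. by move=> ek y0; apply/eqP; rewrite -subr_eq0; apply/eqP; exact: lipS_eq0. Qed.

End Lipschitz.

(** * Modularity of the Eisenstein series *)

Section EisensteinModular.
Variable R : realType.
Local Notation C := R[i].
Implicit Types (tau q : C).

Definition sigc j n : C := if n is 0%N then 0 else (sigma j n)%:R.

Lemma sigma_dvdE j N i : (0 < i)%N -> (i <= N)%N ->
  sigma j i = (\sum_(1 <= d < N.+1 | d %| i) d ^ j)%N.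
Proof.
move=> i0 iN; rewrite /sigma -[RHS]big_filter; apply: perm_big; apply: uniq_perm.
- exact: divisors_uniq.
- by rewrite filter_uniq// iota_uniq.
- move=> d; rewrite mem_filter -dvdn_divisors// mem_index_iota.
  case hd: (d %| i)%N => //=; apply/esym/andP; split.
    by apply: dvdn_gt0 hd.
  by rewrite ltnS; apply: leq_trans iN; apply: dvdn_leq hd.
Qed.

Lemma sigmaE j N i : (0 < i)%N -> (i <= N)%N ->
  sigma j i = (\sum_(m < N) \sum_(n < N) if m.+1 * n.+1 == i then n.+1 ^ j else 0)%N.
Proof.
move=> i0 iN; rewrite exchange_big /= (sigma_dvdE j i0 iN).
rewrite big_add1 big_mkord /= big_mkcond /=; apply: eq_bigr => n _.
case: ifPn => hd; last first.
  rewrite big1// => m _; case: eqP => // e; move/negP: hd; case.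
  by rewrite -e dvdn_mull.
have /dvdnP[m hm] := hd.
have m0 : (0 < m)%N by move: i0; rewrite hm muln_gt0 => /andP[].
have mN : (m.-1 < N)%N.
  by rewrite prednK//; apply: leq_trans iN; rewrite hm leq_pmulr.
rewrite (bigD1 (Ordinal mN)) //= prednK// -hm eqxx big1 ?addn0// => m' hm'.
case: eqP => // e; case/negP: hm'; apply/eqP; apply: val_inj => /=.
have : (m'.+1 == m)%N by rewrite -(eqn_pmul2r (ltn0Sn n)) e hm.
by move=> /eqP <-.
Qed.

(** A truncated Lambert series: the pairs (m, n) are regrouped by their product, and both ranges may
    stop at N since the product is at most N. *)
Lemma sigma_sum j N (q : C) :
  \sum_(i < N.+1) sigc j i * q ^+ i =
  \sum_(m < N) \sum_(n < N) (if (m.+1 * n.+1 <= N)%N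
     then n.+1%:R ^+ j * (q ^+ m.+1) ^+ n.+1 else 0).
Proof.
rewrite big_ord_recl mul0r add0r.
rewrite (eq_bigr (fun i : 'I_N => \sum_(m < N) \sum_(n < N)
    if (m.+1 * n.+1 == i.+1)%N then n.+1%:R ^+ j * (q ^+ m.+1) ^+ n.+1 else 0)).
  rewrite exchange_big; apply: eq_bigr => m _.
  rewrite exchange_big; apply: eq_bigr => n _.
  case: ifPn => h; last first.
    rewrite big1// => i _; case: eqP => // e; case/negP: h.
    by rewrite e.
  have h1 : ((m.+1 * n.+1).-1 < N)%N by rewrite prednK.
  have e1 : (m.+1 * n.+1 == (Ordinal h1).+1)%N by apply/eqP.
  rewrite (bigD1 (Ordinal h1)) //= e1 big1 ?addr0// => i hi.
  case: eqP => // e; case/negP: hi; apply/eqP; apply: val_inj => /=.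
  exact: esym (succn_inj e).
move=> i _; rewrite lift0 /sigc (@sigmaE j N)// natr_sum mulr_suml; apply: eq_bigr => m _.
rewrite natr_sum mulr_suml; apply: eq_bigr => n _; case: eqP => [e|_]; last by rewrite mul0r.
by rewrite natrX -exprM e.
Qed.

Lemma sigma_le j n : (0 < n)%N -> (sigma j n <= n ^ j.+1)%N.
Proof.
move=> n0; rewrite (sigma_dvdE j n0 (leqnn n)) big_mkcond /=.
apply: (@leq_trans (\sum_(1 <= d < n.+1) n ^ j)).
  apply: leq_sum => d _; case: ifP => // hd.
  by case: j => // j; rewrite leq_exp2r// dvdn_leq.
by rewrite sum_nat_const_nat subn1 /= expnS.
Qed.

Lemma tame_sigc j : tame (sigc j).
Proof.
apply: (@tame_poly _ _ j.+1) => n; case: n => [|n]; first by rewrite cabs0.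
rewrite /sigc cabs_nat -natrX ler_nat; apply: (leq_trans (sigma_le _ _)) => //.
by rewrite leq_exp2r.
Qed.

(** Only pairs with product beyond N separate the full rows from the truncated sum. With r = sqrt
    |q|, one half of the exponent supplies r^N and the other half a summable power, so N rows cost
    O(N r^N) = O(1/N). *)
Lemma lambert j q : cabs q < 1 ->
  clim (fun N => \sum_(m < N) powser j.+1 (q ^+ m.+1)) (pser (sigc j.+1) q).
Proof.
move=> q1; have q0 := cabs_ge0 q.
set r := Num.sqrt (cabs q).
have r0 : 0 <= r by exact: sqrtr_ge0.
have rr : r ^+ 2 = cabs q by rewrite sqr_sqrtr.
have r1 : r < 1 by rewrite -(@ltr_pXn2r _ 2) ?nnegrE// expr1n rr.
have [K K0 hK] := polygeo j.+1 r0 r1.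
have [M M0 hM] := polygeo 2 r0 r1.
have hs := clim_sub (s := S) leqnSn (pserP (tame_sigc j.+1) q1).
apply: (clim_squeeze (w := fun N => K * M / N.+1%:R)) hs _ _.
  by move=> e e0; exact: small_inv.
move=> N.
have qm m : cabs (q ^+ m.+1) < 1 by rewrite cabsX exprn_ilt1.
have hl : clim (fun L => \sum_(m < N) \sum_(i < L) i%:R ^+ j.+1 * (q ^+ m.+1) ^+ i)
    (\sum_(m < N) powser j.+1 (q ^+ m.+1)).
  by apply: clim_sum => m; exact: (pserP (tame_pow j.+1)).
apply: (clim_bound (N := N.+1) hl) => L hL.
rewrite sigma_sum -sumrB; apply: (le_trans (cabs_sum _ _ _)).
have cell m : cabs (\sum_(i < L) i%:R ^+ j.+1 * (q ^+ m.+1) ^+ i -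
    \sum_(n < N) (if (m.+1 * n.+1 <= N)%N then n.+1%:R ^+ j.+1 * (q ^+ m.+1) ^+ n.+1 else 0))
    <= r ^+ N * K.
  rewrite -(subnKC hL) big_split_ord /= big_ord_recl expr0n mul0r add0r.
  rewrite addrAC -sumrB.
  apply: (le_trans (cabsD _ _)).
  apply: (@le_trans _ _ (\sum_(n < N + (L - N.+1)) r ^+ N * (n.+1%:R ^+ j.+1 * r ^+ n))); last first.
    by rewrite -mulr_sumr ler_wpM2l ?exprn_ge0.
  have bd n : (N < m.+1 * n.+1)%N ->
      cabs (n.+1%:R ^+ j.+1 * (q ^+ m.+1) ^+ n.+1) <= r ^+ N * (n.+1%:R ^+ j.+1 * r ^+ n).
    move=> h; rewrite cabsM !cabsX cabs_nat mulrCA ler_wpM2l ?exprn_ge0//.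
    rewrite -rr -!exprM -exprD ler_wiXn2l// ?(ltW r1)//; nia.
  rewrite big_split_ord /=; apply: lerD; apply: (le_trans (cabs_sum _ _ _)); apply: ler_sum => n _.
    rewrite /bump leq0n add1n; case: ifPn; rewrite -?ltnNge => h; last by rewrite subr0 bd.
    by rewrite subrr cabs0 !mulr_ge0 ?exprn_ge0.
  rewrite addSn; apply: bd; nia.
apply: (@le_trans _ _ (\sum_(m < N) r ^+ N * K)); first by apply: ler_sum => m _.
rewrite sumr_const card_ord -(mulr_natr (r ^+ N * K)) ler_pdivlMr ?ltr0n//.
have h2 : N.+1%:R ^+ 2 * r ^+ N <= M.
  apply: le_trans (hM N.+1); rewrite big_ord_recr /= lerDr.
  by apply: sumr_ge0 => i _; rewrite mulr_ge0 ?exprn_ge0.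
have -> : r ^+ N * K * N%:R * N.+1%:R = K * (r ^+ N * (N%:R * N.+1%:R)) by ring.
rewrite ler_wpM2l ?(ltW K0)//; apply: le_trans h2; rewrite mulrC ler_wpM2r ?exprn_ge0//.
by rewrite expr2 ler_wpM2r// ler_nat.
Qed.

Definition zetac K : C := csum (fun n => (n.+1%:R ^+ K)^-1).

Lemma zetacP k : clim (fun N => \sum_(n < N) (n.+1%:R ^+ k.+2)^-1) (zetac k.+2).
Proof.
apply: (csumP (u := fun n => (n.+1%:R ^+ k.+2)^-1) (K := 2)) => n.
apply: le_trans (inv_sq_sum _ n); apply: ler_sum => i _.
rewrite cabsV cabsX cabs_nat lef_pV2 ?posrE ?exprn_gt0 ?ltr0n//.
by rewrite ler_weXn2l ?ler1n.
Qed.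

(* Partial sums over the squares |m|, |n| <= N, which are invariant under inversion. *)
Definition Gpart K N tau : C :=
  2 * (\sum_(n < N) (n.+1%:R ^+ K)^-1) + 2 * \sum_(m < N) lpart K (m.+1%:R * tau) N.

(** Inversion exchanges the roles of m and n up to a sign, which an even weight ignores; the two
    coordinate axes trade places. *)
Lemma Gpart_inv K N tau : ~~ odd K -> tau != 0 ->
  Gpart K N (- tau^-1) = tau ^+ K * Gpart K N tau.
Proof.
move=> eK t0.
have evenN (z : C) : (- z) ^+ K = z ^+ K by rewrite exprNn -signr_odd (negbTE eK) mul1r.
have hG t : Gpart K N t = 2 * (\sum_(n < N) (n.+1%:R ^+ K)^-1)
   + 2 * (\sum_(m < N) ((m.+1%:R * t) ^+ K)^-1) +
   2 * (\sum_(m < N) \sum_(n < N) lterm K (m.+1%:R * t) n).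
  by rewrite /Gpart /lpart big_split /= mulrDr addrA.
rewrite !hG !mulrDr; congr (_ + _); last first.
  rewrite mulrCA; congr (_ * _); rewrite exchange_big mulr_sumr; apply: eq_bigr => m _.
  rewrite mulr_sumr; apply: eq_bigr => n _; rewrite /lterm.
  have -> : n.+1%:R * - tau^-1 + m.+1%:R = (m.+1%:R * tau - n.+1%:R) / tau by field.
  have -> : n.+1%:R * - tau^-1 - m.+1%:R = - (m.+1%:R * tau + n.+1%:R) / tau by field.
  by rewrite !exprMn evenN !invfM !exprVn !invrK; ring.
rewrite addrC; congr (_ + _); rewrite mulrCA; congr (_ * _); rewrite mulr_sumr; apply: eq_bigr => m _.
  by rewrite mulrN evenN !exprMn !invfM !exprVn !invrK mulrC.
by rewrite exprMn invfM mulrCA divff ?mulr1// expf_neq0.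
Qed.

Lemma Im_opp_inv tau : complex.Im (- tau^-1) = complex.Im tau / cabs tau ^+ 2.
Proof. by rewrite cabs_sqr; case: tau => a b /=; rewrite opprK. Qed.

Lemma upper_inv tau : 0 < complex.Im tau -> 0 < complex.Im (- tau^-1).
Proof.
move=> y0; rewrite Im_opp_inv divr_gt0// exprn_gt0//.
apply: lt_le_trans (cabsIm _); apply: lt_le_trans y0 _; exact: ler_norm.
Qed.

Lemma upper_neq0 tau : 0 < complex.Im tau -> tau != 0.
Proof. by apply: contraTneq => ->; rewrite ltxx. Qed.

(** The unnormalized G_(k+2); the factor 2 accounts for the symmetry (m, n) -> (- m, - n). *)
Definition Geis k tau : C :=
  2 * zetac k.+2 + 2 * (lipc R k.+1 * pser (sigc k.+1) (nome tau)).

(** Each row of the square is compared with its full sum, which the Lipschitz formula evaluates; the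
    errors of the rows add up to O(N^-k). *)
Lemma GpartP k tau : ~~ odd k -> (0 < k)%N -> 0 < complex.Im tau ->
  clim (fun N => Gpart k.+2 N.+1 tau) (Geis k tau).
Proof.
move=> ek k0 y0; have q1 := cabs_nome_lt1 y0.
have [c c0 hf] := lattice_far y0.
apply: climD; first by apply/climZ/(clim_sub (s := S) leqnSn (zetacP k)).
apply: climZ.
have h := climZ (lipc R k.+1) (clim_sub (s := S) leqnSn (lambert k q1)).
set K := 2 * (c ^+ k.+2)^-1.
have K0 : 0 <= K by rewrite mulr_ge0 ?invr_ge0 ?exprn_ge0 ?(ltW c0).
apply: (clim_squeeze (w := fun N => K / N.+1%:R)) h _ _.
  by move=> e e0; exact: small_inv.
move=> N; rewrite mulr_sumr -sumrB; apply: (le_trans (cabs_sum _ _ _)).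
apply: (@le_trans _ _ (\sum_(m < N.+1) K * (N.+1%:R ^+ k.+1)^-1)).
  apply: ler_sum => m _; rewrite cabsC -nomeMn -lipschitz_formula//; last first.
    by rewrite cImM cIm_nat cRe_nat mul0r addr0 mulr_gt0// ltr0n.
  exact: lsum_tail.
rewrite sumr_const card_ord -(mulr_natr (K / N.+1%:R ^+ k.+1)) -[leLHS]mulrA; apply: ler_wpM2l => //.
rewrite exprSr invfM mulfVK ?pnatr_eq0// lef_pV2 ?posrE ?exprn_gt0 ?ltr0n//.
by rewrite -[leLHS]expr1 ler_weXn2l ?ler1n.
Qed.

Theorem Geis_inv k tau : ~~ odd k -> (0 < k)%N -> 0 < complex.Im tau ->
  Geis k (- tau^-1) = tau ^+ k.+2 * Geis k tau.
Proof.
move=> ek k0 y0; have h1 := GpartP ek k0 (upper_inv y0).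
have h2 := climZ (tau ^+ k.+2) (GpartP ek k0 y0).
apply: (clim_unique h1); apply: (clim_eq (N := 0%N)) h2 => n _.
by rewrite Gpart_inv ?upper_neq0//= negbK.
Qed.

End EisensteinModular.

(** * Zeta values from the Lipschitz formula at the boundary point 1/2 *)

Section ZetaValues.
Variable R : realType.
Local Notation C := R[i].

(** The points 1/2 + n are halves of odd integers, and the sum over odd integers is the full sum
    minus the even part. The range from - (2N - 1) to 2N + 1 leaves one term unpaired. *)
Lemma lpart_half k N : ~~ odd k -> lpart k (2^-1 : C) N =
  2 * 2 ^+ k * (\sum_(n < N.*2) (n.+1%:R ^+ k)^-1)
  - 2 * (\sum_(n < N) (n.+1%:R ^+ k)^-1) + ((2^-1 + N%:R) ^+ k)^-1.
Proof.
move=> ek; have evenN (z : C) : (- z) ^+ k = z ^+ k.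
  by rewrite exprNn -signr_odd (negbTE ek) mul1r.
have two0 : (2 : C) != 0 by rewrite pnatr_eq0.
elim: N => [|N IH]; first by rewrite /lpart !big_ord0 !mulr0 subrr !addr0 add0r.
have -> : lpart k (2^-1 : C) N.+1 = lpart k 2^-1 N + lterm k 2^-1 N.
  by rewrite /lpart big_ord_recr addrA.
rewrite IH doubleS !big_ord_recr /= /lterm.
have dN : N.*2%:R = 2 * N%:R :> C by rewrite -mul2n natrM.
have -> : 2^-1 - N.+1%:R = - (N.*2.+1%:R / 2) :> C by rewrite -!natr1 dN; field.
have -> : 2^-1 + N%:R = N.*2.+1%:R / 2 :> C by rewrite -!natr1 dN; field.
have -> : N.+1%:R = N.*2.+2%:R / 2 :> C by rewrite -!natr1 dN; field.
rewrite evenN !inv_half_pow; ring.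
Qed.

Lemma lsum_half k : ~~ odd k ->
  lsum k.+2 (2^-1 : C) = 2 * (2 ^+ k.+2 - 1) * zetac R k.+2.
Proof.
move=> ek; have hf : far (2^-1) (2^-1 : C).
  apply: strip_far; have -> : (2 : C)^-1 = (2^-1)%:C by rewrite fmorphV rmorph_nat.
  by rewrite /= ger0_norm.
have i0 : 0 < (2^-1 : R) by rewrite invr_gt0.
have dle n : (n <= n.+1.*2)%N by rewrite -addnn; lia.
have [l1 _] := inv_pow_to0 k.+1 i0 hf.
have h2 := climD (climB (climZ (2 * 2 ^+ k.+2) (clim_sub dle (zetacP k)))
   (climZ 2 (clim_sub (s := S) leqnSn (zetacP k)))) l1.
have -> : 2 * (2 ^+ k.+2 - 1) * zetac R k.+2 =
  2 * 2 ^+ k.+2 * zetac R k.+2 - 2 * zetac R k.+2 + 0 by ring.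
apply: clim_unique (clim_sub (s := S) leqnSn (lpartP k i0 hf)) _.
by apply: (clim_eq (N := 0%N)) h2 => n _; rewrite -lpart_half//= negbK.
Qed.

(** Moving a real point vertically increases its modulus, so both inverses stay below 1/a. *)
Lemma inv_pow_diff K (y a : R) (z : C) : 0 < a -> complex.Im z = 0 ->
  a <= cabs z -> 0 <= y ->
  cabs (((z + 'i%C * y%:C) ^+ K.+1)^-1 - (z ^+ K.+1)^-1) <= K.+1%:R * y * (a ^+ K.+2)^-1.
Proof.
move=> a0 zi az y0; set w := z + 'i%C * y%:C.
have aw : a <= cabs w.
  apply: (le_trans az); rewrite -(ler_pXn2r (n := 2)) ?nnegrE ?cabs_ge0//.
  rewrite !cabs_sqr zi expr0n addr0 /w cReD cReM /= mul0r mulr0 subr0 addr0.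
  by rewrite lerDl sqr_ge0.
have wz : w - z = 'i%C * y%:C by rewrite /w addrAC subrr add0r.
have z0 : z != 0 by rewrite -cabs_gt0; exact: lt_le_trans az.
have w0 : w != 0 by rewrite -cabs_gt0; exact: lt_le_trans aw.
rewrite -!exprVn.
have iz : cabs z^-1 <= a^-1 by rewrite cabsV lef_pV2 ?posrE ?cabs_gt0.
have iw : cabs w^-1 <= a^-1 by rewrite cabsV lef_pV2 ?posrE ?cabs_gt0.
apply: (le_trans (cabs_expB K iw iz)).
have -> : w^-1 - z^-1 = - (w^-1 * z^-1 * ('i%C * y%:C)) by rewrite -wz; field; rewrite w0 z0.
rewrite cabsN !cabsM cabsi mul1r cabs_real (ger0_norm y0).
have -> : K.+1%:R * y * a^-1 ^+ K.+2 = K.+1%:R * a^-1 ^+ K * (a^-1 * a^-1 * y).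
  by rewrite !exprS; ring.
rewrite ler_wpM2l ?mulr_ge0 ?exprn_ge0 ?invr_ge0 ?(ltW a0)//.
by rewrite ler_wpM2r// ler_pM ?cabs_ge0.
Qed.

Lemma lsum_half_near k (y : R) : 0 <= y ->
  cabs (lsum k.+2 (2^-1 + 'i%C * y%:C : C) - lsum k.+2 2^-1) <=
    5 * k.+2%:R * 2 ^+ k.+3 * y.
Proof.
move=> y0; have hE : (2 : C)^-1 = (2^-1)%:C by rewrite fmorphV rmorph_nat.
have i0 : 0 < (2^-1 : R) by rewrite invr_gt0.
have h1 : far (2^-1) (2^-1 : C) by apply: strip_far; rewrite hE /= ger0_norm.
have h2 : far (2^-1) (2^-1 + 'i%C * y%:C : C).
  by apply: strip_far; rewrite hE cReD cReM /= mul0r mulr0 subr0 addr0 ger0_norm.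
have hl := climB (lpartP k i0 h2) (lpartP k i0 h1).
rewrite -[X in cabs X]subr0; apply: (clim_bound (N := 0%N) hl) => N _.
rewrite subr0 /lpart opprD addrACA -sumrB.
set M := k.+2%:R * 2 ^+ k.+3 * y.
have M0 : 0 <= M by apply: mulr_ge0 => //; apply: mulr_ge0 => //; exact: exprn_ge0.
have -> : 5 * k.+2%:R * 2 ^+ k.+3 * y = M + M * 2 * 2 by rewrite /M; ring.
apply: (le_trans (cabsD _ _)); apply: lerD.
  have -> : M = k.+2%:R * y * (2^-1 ^+ k.+3)^-1 by rewrite /M [2^-1 ^+ _]exprVn invrK mulrAC.
  apply: inv_pow_diff => //; first by rewrite hE.
  by rewrite cabsV cabs_nat.
apply: (le_trans (cabs_sum _ _ _)).
apply: (@le_trans _ _ (\sum_(n < N) M * 2 * (n.+1%:R ^+ 2)^-1)); last first.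
  rewrite -mulr_sumr; apply: ler_wpM2l; last exact: inv_sq_sum.
  by apply: mulr_ge0.
apply: ler_sum => n _; rewrite /lterm opprD addrACA.
have [f1 f2] := h1 n.
pose a : R := 2^-1 * n.+1%:R.
have a0 : 0 < a by rewrite mulr_gt0 ?ltr0n.
have bnd (z : C) : complex.Im z = 0 -> a <= cabs z ->
   cabs (((z + 'i%C * y%:C) ^+ k.+2)^-1 - (z ^+ k.+2)^-1) <= M * (n.+1%:R ^+ 2)^-1.
  move=> zi az; apply: (le_trans (inv_pow_diff k.+1 a0 zi az y0)).
  have -> : M * (n.+1%:R ^+ 2)^-1 = k.+2%:R * y * (2 ^+ k.+3 * (n.+1%:R ^+ 2)^-1) by rewrite /M; ring.
  apply: ler_wpM2l; first by rewrite mulr_ge0.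
  rewrite /a exprMn invfM exprVn invrK ler_wpM2l ?exprn_ge0//.
  by rewrite lef_pV2 ?posrE ?exprn_gt0 ?ltr0n// ler_weXn2l ?ler1n.
have e1 : 2^-1 + 'i%C * y%:C + n.+1%:R = 2^-1 + n.+1%:R + 'i%C * y%:C :> C by ring.
have e2 : 2^-1 + 'i%C * y%:C - n.+1%:R = 2^-1 - n.+1%:R + 'i%C * y%:C :> C by ring.
rewrite e1 e2; apply: (le_trans (cabsD _ _)).
have := bnd (2^-1 + n.+1%:R); rewrite cImD hE cIm_nat /= addr0 -hE => /(_ erefl f1).
have := bnd (2^-1 - n.+1%:R); rewrite cImD cImN hE cIm_nat /= subr0 -hE => /(_ erefl f2).
move=> ha hb; apply: (le_trans (lerD hb ha)).
by rewrite [M * 2]mulr_natr mulr2n mulrDl.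
Qed.

(** At tau = 1/2 the nome is - 1 and [cothv] vanishes, but the point lies on the boundary. The
    Lipschitz formula is applied at 1/2 + i y, and both sides move by O(y) as y tends to 0. *)
Lemma zeta_eulerp k : ~~ odd k ->
  2 * (2 ^+ k.+2 - 1) * zetac R k.+2 = lipc R k.+1 * (eulerp R k.+1).[0].
Proof.
move=> ek; rewrite -lsum_half//.
set P := eulerp R k.+1.
have /factor_theorem[Q hQ] : root (P - P.[0]%:P) 0 by rewrite /root hornerD hornerN hornerC subrr.
have hPv (v : C) : P.[v] - P.[0] = Q.[v] * v.
  by rewrite -[X in _ - X](hornerC P.[0] v) -hornerN -hornerD hQ hornerM hornerXsubC subr0.
clear hQ; have [K K0 hK] := @horner_bound _ Q (size Q) (leqnSn _).
set c := lipc R k.+1; have c0 := cabs_ge0 c.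
pose B : R := 5 * k.+2%:R * 2 ^+ k.+3 + cabs c * (K * 4).
apply/eqP; rewrite -subr_eq0 -cabs_eq0 eq_le cabs_ge0 andbT.
apply/ler_addgt0Pl => e e0; rewrite addr0.
have [N hN] := small_inv B e0; apply: le_trans (hN N (leqnn N)).
set y : R := N.+1%:R^-1.
have y0 : 0 < y by rewrite invr_gt0 ltr0n.
have hE : (2 : C)^-1 = (2^-1)%:C by rewrite fmorphV rmorph_nat.
set t : C := 2^-1 + 'i%C * y%:C.
have ti : complex.Im t = y by rewrite /t hE cImD cImM /= mul0r mul1r !add0r.
have h1 := @lsum_half_near k y (ltW y0).
rewrite -/t (lipschitz_formula ek) ?ti// powserE in h1; last first.
  have ty : 0 < complex.Im t by rewrite ti.
  exact: cabs_nome_lt1 ty.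
rewrite -/c -/P in h1; set v := cothv (nome t) in h1.
have nE : nome t = - (expR (- (2 * pi * y)))%:C.
  have cis0 : cos 0 +i* sin 0 = 1 :> C by rewrite cos0 sin0.
  rewrite /t nomeD nome_half nomeE !cReM !cImM /= !mul0r !mul1r subr0 add0r !mulr0.
  by rewrite cis0 mulr1 mulN1r.
set r := expR (- (2 * pi * y)) in nE.
have r0 : 0 < r by exact: expR_gt0.
have hr : 1 - r <= 8 * y.
  have := expR_ge1Dx (- (2 * pi * y)); rewrite -/r; have := @pi_le4 R; nra.
have r1 : r < 1 by rewrite expR_lt1 oppr_lt0 !mulr_gt0 ?pi_gt0.
have vE : v = ((1 - r) / (2 * (1 + r)))%:C.
  rewrite /v /cothv nE opprK.
  have -> : (1 : C) + r%:C = (1 + r)%:C by rewrite rmorphD.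
  rewrite hE -fmorphV -rmorphB; congr _%:C; field; lra.
have hv : cabs v <= 4 * y /\ cabs v <= 1.
  rewrite vE cabs_real ger0_norm; last by rewrite divr_ge0//; lra.
  have p0 : 0 < 2 * (1 + r) by lra.
  by rewrite !ler_pdivrMr//; split; nra.
have h2 : cabs (c * P.[v] - c * P.[0]) <= cabs c * (K * 4) * y.
  rewrite -mulrBr hPv cabsM -mulrA ler_wpM2l// cabsM -mulrA.
  apply: ler_pM; rewrite ?cabs_ge0//; last exact: hv.1.
  by have := hK v 1 (lexx _) hv.2; rewrite expr1n mulr1.
apply: (le_trans (cabs_triB _ (c * P.[v]) _)); rewrite (cabsC (lsum _ _)).
by rewrite /B mulrDl; apply: lerD.
Qed.

Lemma coef_eulerpS j :
  [/\ (eulerp R j.+1)`_0 = - (4^-1 * (eulerp R j)`_1),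
      (eulerp R j.+1)`_1 = - (4^-1 * ((eulerp R j)`_2 *+ 2)) &
      forall i, (eulerp R j.+1)`_i.+2 =
        (eulerp R j)`_i.+1 *+ i.+1 - 4^-1 * ((eulerp R j)`_i.+3 *+ i.+3)].
Proof.
by split=> [||i]; rewrite [eulerp R j.+1]/= mulrBl coefB coefXnM coefCM !coef_deriv
  ?mulr1n ?add0r//= subSS subn1.
Qed.

Lemma coef_eulerp0 : [/\ (eulerp R 0)`_0 = 2^-1, (eulerp R 0)`_1 = 1 &
  forall i, (eulerp R 0)`_i.+2 = 0].
Proof. by split=> [||i]; rewrite /= coefD coefX coefC /= ?add0r ?addr0. Qed.

Lemma eulerp3 : (eulerp R 3).[0] = 8^-1.
Proof.
have [a b c] := coef_eulerp0; have two0 : (2 : C) != 0 by rewrite pnatr_eq0.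
have [a1 b1 c1] := coef_eulerpS 0; have [a2 b2 c2] := coef_eulerpS 1.
have [a3 b3 c3] := coef_eulerpS 2.
by rewrite horner_coef0 a3 b2 c1 b c; field.
Qed.

Lemma eulerp5 : (eulerp R 5).[0] = - 4^-1.
Proof.
have [a b c] := coef_eulerp0; have two0 : (2 : C) != 0 by rewrite pnatr_eq0.
have [a1 b1 c1] := coef_eulerpS 0; have [a2 b2 c2] := coef_eulerpS 1.
have [a3 b3 c3] := coef_eulerpS 2; have [a4 b4 c4] := coef_eulerpS 3.
have [a5 b5 c5] := coef_eulerpS 4.
by rewrite horner_coef0 a5 b4 c3 !(b2, c2, b1, c1, b, c); field.
Qed.

End ZetaValues.

(** * Second-order smoothness, jets and strict differentiability at 0 *)

Section SmoothFunctions.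
Variable R : realType.
Local Notation C := R[i].
Implicit Types (F G : C -> C) (q u : C).

(** The remainder is cubic because the comparison at four points gains x^2 and can afford O(x^3). K
    and d are uniform on the disc because x is chosen before the point. *)
Definition smooth2 F := forall r : R, 0 < r -> r < 1 ->
  exists2 K : R, 0 < K & exists2 d : R, 0 < d & forall q, cabs q <= r ->
    exists a b, [/\ cabs (F q) <= K, cabs a <= K, cabs b <= K &
      forall u, cabs u <= d ->
        cabs (F (q + u) - F q - a * u - b * u ^+ 2) <= K * cabs u ^+ 3].

Lemma smooth2_pser c : tame c -> smooth2 (pser c).
Proof.
move=> hc r r0 r1; have [K K0 hK] := pser_taylor hc r0 r1.
exists K => //; exists ((1 - r) / 2); first by lra.
move=> q hq; have [h0 h1 h2 h3] := hK q hq.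
by exists (pser1 c q), (pser2 c q).
Qed.

Lemma smooth2_cst a : smooth2 (fun=> a).
Proof.
move=> r r0 r1; exists (1 + cabs a); first by rewrite ltr_wpDr ?cabs_ge0.
exists 1 => // q _; exists 0, 0; have a0 := cabs_ge0 a; rewrite cabs0; split; try lra.
move=> u _; rewrite subrr !mul0r !subr0 cabs0 mulr_ge0 ?exprn_ge0 ?cabs_ge0//; lra.
Qed.

Lemma smooth2D F G : smooth2 F -> smooth2 G -> smooth2 (fun q => F q + G q).
Proof.
move=> hF hG r r0 r1; have [K K0 [d d0 hK]] := hF r r0 r1.
have [L L0 [e e0 hL]] := hG r r0 r1.
exists (K + L); first by rewrite addr_gt0.
exists (Num.min d e); first by rewrite lt_min d0 e0.
move=> q hq; have [a [b [f0 f1 f2 f3]]] := hK q hq.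
have [a' [b' [g0 g1 g2 g3]]] := hL q hq.
exists (a + a'), (b + b'); split.
- by apply: (le_trans (cabsD _ _)); apply: lerD.
- by apply: (le_trans (cabsD _ _)); apply: lerD.
- by apply: (le_trans (cabsD _ _)); apply: lerD.
move=> u; rewrite le_min => /andP[ud ue].
have -> : F (q + u) + G (q + u) - (F q + G q) - (a + a') * u - (b + b') * u ^+ 2 =
  (F (q + u) - F q - a * u - b * u ^+ 2) + (G (q + u) - G q - a' * u - b' * u ^+ 2) by ring.
by apply: (le_trans (cabsD _ _)); rewrite mulrDl lerD ?f3 ?g3.
Qed.

Lemma smooth2M F G : smooth2 F -> smooth2 G -> smooth2 (fun q => F q * G q).
Proof.
move=> hF hG r r0 r1; have [K K0 [d d0 hK]] := hF r r0 r1.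
have [L L0 [e e0 hL]] := hG r r0 r1.
have KL : 0 < K * L by rewrite mulr_gt0.
exists (10 * (K * L)); first by rewrite mulr_gt0.
exists (Num.min 1 (Num.min d e)); first by rewrite !lt_min ltr01 d0 e0.
move=> q hq; have [a [b [f0 f1 f2 f3]]] := hK q hq.
have [a' [b' [g0 g1 g2 g3]]] := hL q hq.
have bd (x y : C) : cabs x <= K -> cabs y <= L -> cabs (x * y) <= K * L.
  by move=> hx hy; rewrite cabsM ler_pM ?cabs_ge0.
exists (a * G q + F q * a'), (b * G q + a * a' + F q * b'); split.
- have := bd _ _ f0 g0; lra.
- apply: (le_trans (cabsD _ _)); have := bd _ _ f1 g0; have := bd _ _ f0 g1; lra.
- apply: (le_trans (cabsD _ _)); apply: (le_trans (lerD (cabsD _ _) (lexx _))).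
  have := bd _ _ f2 g0; have := bd _ _ f1 g1; have := bd _ _ f0 g2; lra.
move=> u; rewrite !le_min => /and3P[u1 ud ue].
have {}f3 := f3 u ud; have {}g3 := g3 u ue.
move: f3 g3; set s := _ - b * u ^+ 2; set t := _ - b' * u ^+ 2 => hs ht.
have u0 := cabs_ge0 u.
have u2 : cabs u ^+ 2 <= 1 by rewrite exprn_ile1.
have u3 : cabs u ^+ 3 <= 1 by rewrite exprn_ile1.
have n3 : 0 <= cabs u ^+ 3 by rewrite exprn_ge0.
have hGu : cabs (G (q + u)) <= 4 * L.
  have -> : G (q + u) = G q + a' * u + b' * u ^+ 2 + t by rewrite /t; ring.
  apply: (le_trans (cabsD _ _)); apply: (le_trans (lerD (cabsD _ _) (lexx _))).
  apply: (le_trans (lerD (lerD (cabsD _ _) (lexx _)) (lexx _))).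
  have h1 : cabs (a' * u) <= L * 1 by rewrite cabsM ler_pM ?cabs_ge0.
  have h2 : cabs (b' * u ^+ 2) <= L * 1 by rewrite cabsM cabsX ler_pM ?exprn_ge0 ?cabs_ge0.
  have h3 : L * cabs u ^+ 3 <= L * 1 by rewrite ler_wpM2l ?(ltW L0).
  lra.
have hFu : cabs (F q + a * u + b * u ^+ 2) <= 3 * K.
  apply: (le_trans (cabsD _ _)); apply: (le_trans (lerD (cabsD _ _) (lexx _))).
  have h1 : cabs (a * u) <= K * 1 by rewrite cabsM ler_pM ?cabs_ge0.
  have h2 : cabs (b * u ^+ 2) <= K * 1 by rewrite cabsM cabsX ler_pM ?exprn_ge0 ?cabs_ge0.
  lra.
have -> : F (q + u) * G (q + u) - F q * G q - (a * G q + F q * a') * u -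
    (b * G q + a * a' + F q * b') * u ^+ 2 =
    s * G (q + u) + (F q + a * u + b * u ^+ 2) * t + (a * b' + b * a' + b * b' * u) * u ^+ 3.
  have -> : G (q + u) = G q + a' * u + b' * u ^+ 2 + t by rewrite /t; ring.
  have -> : F (q + u) = F q + a * u + b * u ^+ 2 + s by rewrite /s; ring.
  ring.
have k1 : cabs (s * G (q + u)) <= K * cabs u ^+ 3 * (4 * L) by rewrite cabsM ler_pM ?cabs_ge0.
have k2 : cabs ((F q + a * u + b * u ^+ 2) * t) <= 3 * K * (L * cabs u ^+ 3) by rewrite cabsM ler_pM ?cabs_ge0.
have k3 : cabs ((a * b' + b * a' + b * b' * u) * u ^+ 3) <= 3 * (K * L) * cabs u ^+ 3.
  rewrite cabsM cabsX ler_wpM2r//.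
  apply: (le_trans (cabsD _ _)); apply: (le_trans (lerD (cabsD _ _) (lexx _))).
  have h1 : cabs (b * b' * u) <= K * L * 1.
    by rewrite cabsM ler_pM ?cabs_ge0 ?bd.
  have := bd _ _ f1 g2; have := bd _ _ f2 g1; lra.
apply: (le_trans (cabsD _ _)); apply: (le_trans (lerD (cabsD _ _) (lexx _))).
lra.
Qed.

Lemma smooth2X F n : smooth2 F -> smooth2 (fun q => F q ^+ n).
Proof.
move=> hF; elim: n => [|n IH].
  by have := smooth2_cst 1; congr smooth2; apply/funext => q; rewrite expr0.
by have := smooth2M hF IH; congr smooth2; apply/funext => q; rewrite exprS.
Qed.

Lemma smooth2Z F a : smooth2 F -> smooth2 (fun q => a * F q).
Proof. by move=> hF; apply: smooth2M => //; exact: smooth2_cst. Qed.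

Lemma smooth2_sum (I : Type) (s : seq I) (F : I -> C -> C) :
  (forall i, smooth2 (F i)) -> smooth2 (fun q => \sum_(i <- s) F i q).
Proof.
move=> h; elim: s => [|i s IH].
  by have := smooth2_cst 0; congr smooth2; apply/funext => q; rewrite big_nil.
by have := smooth2D (h i) IH; congr smooth2; apply/funext => q; rewrite big_cons.
Qed.

Lemma smooth2B F G : smooth2 F -> smooth2 G -> smooth2 (fun q => F q - G q).
Proof.
move=> hF hG; have := smooth2D hF (smooth2Z (-1) hG).
by congr smooth2; apply/funext => q; rewrite mulN1r.
Qed.

(* The point [q = 0] is left out, so that quotients by powers of [q] have jets. *)
Definition jet F (p : {poly C}) n :=
  exists2 K : R, 0 < K & forall q, 0 < cabs q -> cabs q <= 1 / 2 ->
    cabs (F q - p.[q]) <= K * cabs q ^+ n.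

Lemma poly_bound_half (p : {poly C}) : exists2 K : R, 0 < K &
  forall q, cabs q <= 1 / 2 -> cabs p.[q] <= K.
Proof.
have [K K0 hK] := @horner_bound _ p (size p) (leqnSn _); exists K => // q hq.
by have := hK q 1 (lexx _); rewrite expr1n mulr1; apply; lra.
Qed.

Lemma jet_pser c n : tame c -> jet (pser c) (\poly_(i < n) c i) n.
Proof.
move=> hc; have [|K K0 hK] := @pser_jet _ c (1 / 2) n hc ltac:(lra); first by lra.
by exists K => // q q0 hq; rewrite horner_poly; exact: hK.
Qed.

Lemma jet_poly p n : jet (fun q => p.[q]) p n.
Proof.
exists 1 => // q _ _.
by rewrite subrr cabs0 mul1r exprn_ge0 ?cabs_ge0.
Qed.

Lemma jetD F G (p s : {poly C}) n : jet F p n -> jet G s n -> jet (fun q => F q + G q) (p + s) n.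
Proof.
move=> [K K0 hK] [L L0 hL]; exists (K + L); first by rewrite addr_gt0.
move=> q q0 hq; rewrite hornerD opprD addrACA mulrDl.
by apply: (le_trans (cabsD _ _)); rewrite lerD ?hK ?hL.
Qed.

Lemma jetM F G p s n : jet F p n -> jet G s n -> jet (fun q => F q * G q) (p * s) n.
Proof.
move=> [K K0 hK] [L L0 hL].
have [P P0 hP] := poly_bound_half p; have [S S0 hS] := poly_bound_half s.
exists (K * (S + L) + P * L); first by rewrite addr_gt0 ?mulr_gt0 ?addr_gt0.
move=> q q0 hq; have fq := hK q q0 hq; have gq := hL q q0 hq.
have n0 : 0 <= cabs q ^+ n by rewrite exprn_ge0 ?cabs_ge0.
have q1 : cabs q ^+ n <= 1 by rewrite exprn_ile1 ?cabs_ge0//; lra.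
have hG : cabs (G q) <= S + L.
  rewrite -[G q](subrK s.[q]) addrC; apply: (le_trans (cabsD _ _)).
  apply: lerD; first exact: hS.
  by apply: (le_trans gq); rewrite ler_piMr// ltW.
rewrite hornerM.
have -> : F q * G q - p.[q] * s.[q] = (F q - p.[q]) * G q + p.[q] * (G q - s.[q]) by ring.
apply: (le_trans (cabsD _ _)); rewrite !cabsM.
rewrite [leRHS](_ : _ = K * cabs q ^+ n * (S + L) + P * (L * cabs q ^+ n)); last by ring.
by apply: lerD; apply: ler_pM; rewrite ?cabs_ge0 ?hP.
Qed.

Lemma jetX F p n m : jet F p n -> jet (fun q => F q ^+ m) (p ^+ m) n.
Proof.
move=> hF; elim: m => [|m IH].
  have := jet_poly 1 n; rewrite expr0; congr jet.
  by apply/funext => q; rewrite hornerC expr0.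
by rewrite exprS; have := jetM hF IH; congr jet; apply/funext => q; rewrite exprS.
Qed.

Lemma jetZ F p n a : jet F p n -> jet (fun q => a * F q) (a *: p) n.
Proof.
move=> hF; rewrite -mul_polyC; have := jetM (jet_poly a%:P n) hF.
by congr jet; apply/funext => q; rewrite hornerC.
Qed.

Lemma jet_sum (I : Type) (s : seq I) (F : I -> C -> C) (p : I -> {poly C}) n :
  (forall i, jet (F i) (p i) n) -> jet (fun q => \sum_(i <- s) F i q) (\sum_(i <- s) p i) n.
Proof.
move=> h; elim: s => [|i s IH].
  rewrite big_nil; have := jet_poly 0 n; congr jet.
  by apply/funext => q; rewrite big_nil horner0.
by rewrite big_cons; have := jetD (h i) IH; congr jet; apply/funext => q; rewrite big_cons.
Qed.

Lemma jet_ext F G p n : (forall q, 0 < cabs q -> cabs q <= 1 / 2 -> F q = G q) ->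
  jet F p n -> jet G p n.
Proof. by move=> e [K K0 h]; exists K => // q q0 hq; rewrite -e// h. Qed.

Lemma jet_trunc F (p s : {poly C}) n : (forall i, (i < n)%N -> p`_i = s`_i) -> jet F p n -> jet F s n.
Proof.
move=> hps [K K0 hK].
have [Q hQ] : exists Q : {poly C}, p - s = 'X^n * Q.
  exists (drop_poly n (p - s)); rewrite -{1}(poly_take_drop n (p - s)) mulrC.
  rewrite (_ : take_poly n (p - s) = 0) ?add0r//.
  apply/polyP => i; rewrite coef_take_poly coef0; case: ifP => // hi.
  by rewrite coefB hps// subrr.
have [M M0 hM] := poly_bound_half Q.
exists (K + M); first by rewrite addr_gt0.
move=> q q0 hq; have -> : F q - s.[q] = (F q - p.[q]) + (p - s).[q].
  by rewrite hornerD hornerN; ring.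
apply: (le_trans (cabsD _ _)); rewrite mulrDl; apply: lerD; first exact: hK.
rewrite hQ hornerM hornerXn cabsM cabsX mulrC ler_wpM2r ?exprn_ge0 ?cabs_ge0//.
exact: hM.
Qed.

(** Strict differentiability at 0 with a rate: on the disc of radius x, F is its linear part plus a
    function of Lipschitz constant O(x). *)
Definition lip1 F a :=
  exists2 K : R, 0 < K & forall (x : R) q q', x <= 1 / 2 -> cabs q <= x -> cabs q' <= x ->
    cabs (F q - F q' - a * (q - q')) <= K * x * cabs (q - q').

Lemma lip1_pser c : tame c -> lip1 (pser c) (c 1%N).
Proof.
move=> hc; have [|K K0 hK] := @pser_lip _ c (1 / 2) hc ltac:(lra); first by lra.
by exists K => // x q q' hx; exact: hK.
Qed.

Lemma lip1_cst b : lip1 (fun=> b) 0.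
Proof.
exists 1 => // x q q' _ hq _; have x0 := le_trans (cabs_ge0 _) hq.
by rewrite subrr mul0r subr0 cabs0 mul1r mulr_ge0 ?cabs_ge0.
Qed.

Lemma lip1D F G a b : lip1 F a -> lip1 G b -> lip1 (fun q => F q + G q) (a + b).
Proof.
move=> [K K0 hK] [L L0 hL]; exists (K + L); first by rewrite addr_gt0.
move=> x q q' hx hq hq'; have h1 := hK x q q' hx hq hq'; have h2 := hL x q q' hx hq hq'.
have -> : F q + G q - (F q' + G q') - (a + b) * (q - q') =
  (F q - F q' - a * (q - q')) + (G q - G q' - b * (q - q')) by ring.
by apply: (le_trans (cabsD _ _)); rewrite !mulrDl; apply: lerD.
Qed.

Lemma lip1_lip F a : lip1 F a -> exists2 K : R, 0 < K &
  forall q q', cabs q <= 1 / 2 -> cabs q' <= 1 / 2 ->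
    cabs (F q - F q') <= K * cabs (q - q') /\ cabs (F q) <= K.
Proof.
move=> [K K0 hK]; exists (K + cabs a + cabs (F 0)).
  by rewrite -addrA ltr_wpDr ?addr_ge0 ?cabs_ge0.
have f0 := cabs_ge0 (F 0); have a0 := cabs_ge0 a.
have main q q' : cabs q <= 1 / 2 -> cabs q' <= 1 / 2 ->
    cabs (F q - F q') <= (K + cabs a) * cabs (q - q').
  move=> hq hq'; have := hK (1 / 2) q q' (lexx _) hq hq'.
  rewrite -[X in _ -> cabs X <= _](subrK (a * (q - q'))) => h.
  apply: (le_trans (cabsD _ _)); rewrite cabsM mulrDl; apply: lerD => //.
  by apply: (le_trans h); rewrite ler_wpM2r ?cabs_ge0//; lra.
move=> q q' hq hq'; split.
  by apply: (le_trans (main q q' hq hq')); rewrite ler_wpM2r ?cabs_ge0//; lra.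
have h := main q 0 hq; rewrite cabs0 subr0 in h; have {}h := h ltac:(lra).
have := cabs_subl (F q) (F 0); have := cabs_ge0 q; nra.
Qed.

Lemma lip1M F G a b : lip1 F a -> lip1 G b ->
  lip1 (fun q => F q * G q) (a * G 0 + F 0 * b).
Proof.
move=> hF hG; have [K1 K10 hK1] := lip1_lip hF; have [L1 L10 hL1] := lip1_lip hG.
move: hF hG => [K K0 hK] [L L0 hL].
have a0 := cabs_ge0 a; have b0 := cabs_ge0 b.
exists (K * L1 + K1 * L + cabs a * L1 + K1 * cabs b).
  by rewrite -addrA ltr_wpDr ?addr_gt0 ?addr_ge0 ?mulr_ge0 ?mulr_gt0 ?(ltW L10) ?(ltW K10).
move=> x q q' hx hq hq'; have x0 := le_trans (cabs_ge0 _) hq.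
have z0 : cabs (0 : C) <= 1 / 2 by rewrite cabs0; lra.
have hq2 := le_trans hq hx; have hq2' := le_trans hq' hx.
have h1 := hK x q q' hx hq hq'; have h2 := hL x q q' hx hq hq'.
have [_ gq] := hL1 q q hq2 hq2; have [_ fq'] := hK1 q' q' hq2' hq2'.
have [g0 _] := hL1 q 0 hq2 z0; have [f0 _] := hK1 q' 0 hq2' z0.
rewrite subr0 in f0; rewrite subr0 in g0.
have -> : F q * G q - F q' * G q' - (a * G 0 + F 0 * b) * (q - q') =
   (F q - F q' - a * (q - q')) * G q + F q' * (G q - G q' - b * (q - q'))
   + (a * (G q - G 0) + (F q' - F 0) * b) * (q - q') by ring.
apply: (le_trans (cabsD _ _)); apply: (le_trans (lerD (cabsD _ _) (lexx _))).
have m0 := cabs_ge0 (q - q').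
have k1 : cabs ((F q - F q' - a * (q - q')) * G q) <= K * x * cabs (q - q') * L1.
  by rewrite cabsM ler_pM ?cabs_ge0.
have k2 : cabs (F q' * (G q - G q' - b * (q - q'))) <= K1 * (L * x * cabs (q - q')).
  by rewrite cabsM ler_pM ?cabs_ge0.
have k3 : cabs ((a * (G q - G 0) + (F q' - F 0) * b) * (q - q')) <=
    (cabs a * (L1 * x) + K1 * x * cabs b) * cabs (q - q').
  rewrite cabsM ler_wpM2r//; apply: (le_trans (cabsD _ _)); rewrite !cabsM; apply: lerD.
    by rewrite ler_wpM2l//; apply: (le_trans g0); rewrite ler_wpM2l ?(ltW L10).
  by rewrite ler_wpM2r//; apply: (le_trans f0); rewrite ler_wpM2l ?(ltW K10).
by rewrite [leRHS](_ : _ = K * x * cabs (q - q') * L1 + K1 * (L * x * cabs (q - q')) +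
  (cabs a * (L1 * x) + K1 * x * cabs b) * cabs (q - q')); [lra|ring].
Qed.

End SmoothFunctions.

(** * The series E_4, E_6 and Delta near the cusp *)

Section Discriminant.
Variable R : realType.
Local Notation C := R[i].
Implicit Types (F G : C -> C) (q tau : C).

(* Modularity of [F (nome tau)]: invariance under translation is built in. *)
Definition modq k F := forall tau, 0 < complex.Im tau ->
  F (nome (- tau^-1)) = tau ^+ k * F (nome tau).

Lemma modqM k l F G : modq k F -> modq l G -> modq (k + l) (fun q => F q * G q).
Proof. by move=> hF hG tau y0; rewrite hF// hG// exprD mulrACA. Qed.

Lemma modqX k F n : modq k F -> modq (k * n) (fun q => F q ^+ n).
Proof. by move=> hF tau y0; rewrite hF// exprMn exprM. Qed.

Lemma modqZ k F a : modq k F -> modq k (fun q => a * F q).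
Proof. by move=> hF tau y0; rewrite hF// mulrCA. Qed.

Lemma modqB k F G : modq k F -> modq k G -> modq k (fun q => F q - G q).
Proof. by move=> hF hG tau y0; rewrite hF// hG// mulrBr. Qed.

Lemma modq_sum (I : Type) (s : seq I) k (F : I -> C -> C) :
  (forall i, modq k (F i)) -> modq k (fun q => \sum_(i <- s) F i q).
Proof.
move=> h tau y0; rewrite mulr_sumr; apply: eq_bigr => i _; exact: h.
Qed.

Lemma lipc_neq0 k : lipc R k != 0.
Proof.
rewrite /lipc mulf_neq0 ?invr_eq0 ?pnatr_eq0 -?lt0n ?fact_gt0// expf_neq0//.
rewrite !mulf_neq0 ?pnatr_eq0//; first by rewrite eq_complex /= gt_eqF// pi_gt0.
by rewrite eq_complex /= oner_eq0 andbF.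
Qed.

(* E_(k+2) up to a scalar. *)
Definition eisq k q : C := zetac R k.+2 / lipc R k.+1 + pser (sigc R k.+1) q.

Lemma modq_eisq k : ~~ odd k -> (0 < k)%N -> modq k.+2 (eisq k).
Proof.
move=> ek k0 tau y0.
have hG t : eisq k (nome t) = (2 * lipc R k.+1)^-1 * Geis k t.
  rewrite /eisq /Geis; have := lipc_neq0 k.+1; move: (lipc R k.+1) => c c0.
  by field; rewrite c0.
by rewrite !hG Geis_inv// mulrCA.
Qed.

Lemma smooth2_eisq k : smooth2 (eisq k).
Proof. apply: smooth2D; [exact: smooth2_cst|exact/smooth2_pser/tame_sigc]. Qed.

Lemma lip1_eisq k : lip1 (eisq k) 1.
Proof.
have := lip1D (lip1_cst (zetac R k.+2 / lipc R k.+1)) (lip1_pser (tame_sigc k.+1)).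
by rewrite add0r /sigc /sigma big_seq1 exp1n.
Qed.

Definition E4q q : C := 240 * eisq 2 q.
Definition E6q q : C := - 504 * eisq 4 q.
Definition Dq q : C := (E4q q ^+ 3 - E6q q ^+ 2) / 12 ^+ 3.

(** The constant term 240 zeta(4) / [lipc 3] equals 1 by [zeta_eulerp] and [eulerp3]. *)
Lemma E4qE q : E4q q = 1 + 240 * pser (sigc R 3) q.
Proof.
rewrite /E4q /eisq mulrDr; congr (_ + _).
have := @zeta_eulerp R 2 isT; rewrite eulerp3.
have := lipc_neq0 3; move: (lipc R 3) (zetac R 4) => c z c0.
have -> : 2 * (2 ^+ 4 - 1) = 30 :> C by ring.
move=> h; have -> : z = c * 8^-1 / 30 by rewrite -h; field.
by field.
Qed.

Lemma E6qE q : E6q q = 1 - 504 * pser (sigc R 5) q.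
Proof.
rewrite /E6q /eisq mulrDr mulNr; congr (_ + _); last by rewrite mulNr.
have := @zeta_eulerp R 4 isT; rewrite eulerp5.
have := lipc_neq0 5; move: (lipc R 5) (zetac R 6) => c z c0.
have -> : 2 * (2 ^+ 6 - 1) = 126 :> C by ring.
move=> h; have -> : z = - (c * 4^-1 / 126) by rewrite -mulrN -[LHS](mulKf (_ : 126 != 0)) ?h// ?pnatr_eq0//; field.
by field.
Qed.

Lemma modq_E4 : modq 4 E4q. Proof. exact/modqZ/modq_eisq. Qed.
Lemma modq_E6 : modq 6 E6q. Proof. exact/modqZ/modq_eisq. Qed.

Lemma modq_D : modq 12 Dq.
Proof.
have h3 := modqX 3 modq_E4; have h2 := modqX 2 modq_E6.
move=> tau y0; move: (h3 tau y0) (h2 tau y0); rewrite /Dq.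
move: (E4q _) (E4q _) (E6q _) (E6q _) => a b c d -> ->.
by rewrite -mulrBr mulrA.
Qed.

Lemma smooth2_E4 : smooth2 E4q. Proof. exact/smooth2Z/smooth2_eisq. Qed.
Lemma smooth2_E6 : smooth2 E6q. Proof. exact/smooth2Z/smooth2_eisq. Qed.

Lemma smooth2_D : smooth2 Dq.
Proof.
have := smooth2Z (12 ^+ 3)^-1 (smooth2B (smooth2X 3 smooth2_E4) (smooth2X 2 smooth2_E6)).
by congr smooth2; apply/funext => q; rewrite mulrC.
Qed.

Lemma csum_head (c : nat -> C) q n : tame c -> cabs q < 1 ->
  pser c q = \sum_(i < n) c i * q ^+ i + q ^+ n * pser (fun i => c (n + i)%N) q.
Proof.
move=> hc q1; have h1 := pserP hc q1.
have ht : tame (fun i => c (n + i)%N).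
  move=> r r0 r1; have [K hK] := hc r r0 r1; exists (K / r ^+ n) => m.
  by rewrite ler_pdivlMr ?exprn_gt0// -mulrA -exprD addnC.
have h2 := climD (clim_cst (\sum_(i < n) c i * q ^+ i)) (climZ (q ^+ n) (pserP ht q1)).
apply: clim_unique (clim_sub (s := fun m => (n + m)%N) (fun m => leq_addl n m) h1) _.
apply: (clim_eq (N := 0%N)) h2 => m _; rewrite big_split_ord /=; congr (_ + _).
by rewrite mulr_sumr; apply: eq_bigr => i _; rewrite exprD mulrCA.
Qed.

Lemma sigma_values : [/\ sigma 3 1 = 1, sigma 3 2 = 9, sigma 5 1 = 1 & sigma 5 2 = 33]%N.
Proof.
have d1 : divisors 1 = [:: 1%N] by [].
have d2 : divisors 2 = [:: 1; 2]%N by [].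
by rewrite /sigma d1 d2 !big_cons !big_nil.
Qed.

(** A bounds (4/3)^(j+1), hence every ratio ((n+4)/(n+3))^(j+1); so sigma_j(n+3) <= (n+3)^(j+1) <=
    3^(j+1) A^n and the tail is geometric. *)
Lemma sigc_tail j (A : nat) q : (4 ^ j.+1 <= A * 3 ^ j.+1)%N -> (A < 190)%N ->
  cabs q <= 190^-1 ->
  cabs (pser (fun i => sigc R j (3 + i)%N) q) <= (3 ^ j.+1)%:R / (1 - A%:R / 190).
Proof.
move=> hA A190 hq.
have a1 : A%:R / 190 < 1 :> R by rewrite ltr_pdivrMr// mul1r ltr_nat.
have a0 : 0 <= A%:R / 190 :> R by rewrite divr_ge0.
apply: (csum_le (v := fun n => (3 ^ j.+1)%:R * (A%:R / 190) ^+ n)).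
  move=> n; rewrite cabsM cabsX; apply: (@le_trans _ _ ((3 ^ j.+1 * A ^ n)%:R * (190^-1) ^+ n)).
    apply: ler_pM; rewrite ?exprn_ge0 ?cabs_ge0//; last by rewrite ler_expr_base ?cabs_ge0.
    rewrite /sigc /= cabs_nat ler_nat; apply: (leq_trans (sigma_le _ _)) => //.
    elim: n => [|n IH]; first by rewrite expn0 muln1.
    rewrite [(A ^ n.+1)%N]expnS mulnCA; apply: (@leq_trans (A * (3 + n) ^ j.+1)); last by rewrite leq_mul2l IH orbT.
    have h3 : (0 < 3 ^ j.+1)%N by rewrite expn_gt0.
    rewrite -(leq_pmul2r h3) -expnMn mulnAC.
    apply: (@leq_trans (4 ^ j.+1 * (3 + n) ^ j.+1)); last by rewrite leq_mul2r hA orbT.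
    by rewrite -expnMn leq_exp2r//; lia.
  by rewrite exprMn mulrA natrM [(A ^ n)%:R]natrX.
move=> n; rewrite -mulr_sumr ler_wpM2l//.
have := geometric_bin_sum 0 a0 a1 n; rewrite expr1.
by under eq_bigr do rewrite addn0 bin0 mul1r.
Qed.

(** Delta = q (1 + W) with |W| <= 9/10: the low coefficients are explicit and the tails from degree
    3 on are bounded by [sigc_tail]. *)
Lemma Dq_lb q : cabs q <= 190^-1 -> cabs q / 10 <= cabs (Dq q).
Proof.
move=> hq; have q0 := cabs_ge0 q.
have q1 : cabs q < 1 by lra.
have [v31 v32 v51 v52] := sigma_values.
have := @sigc_tail 3 4 q isT isT hq; have := @sigc_tail 5 6 q isT isT hq.
rewrite /Dq E4qE E6qE (csum_head 3 (tame_sigc 3) q1) (csum_head 3 (tame_sigc 5) q1).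
rewrite !big_ord_recl !big_ord0 /sigc /= /bump /= v31 v32 v51 v52.
have -> : (3 ^ 4)%N = 81%N by []. have -> : (3 ^ 6)%N = 729%N by [].
move: (pser _ _) (pser _ _) => S T hT hS.
have {}hS : cabs S <= 83 by apply: (le_trans hS); rewrite ler_pdivrMr; lra.
have {}hT : cabs T <= 760 by apply: (le_trans hT); rewrite ler_pdivrMr; lra.
set p2 := q ^+ 2 * S; set s2 := q ^+ 2 * T; set p := 9 * q + p2; set s := 33 * q + s2.
have m2 : cabs q ^+ 2 <= 190^-1 ^+ 2 by rewrite ler_expr_base.
have hp2 : cabs p2 <= 24 / 10000.
  rewrite cabsM cabsX; apply: (@le_trans _ _ (190^-1 ^+ 2 * 83)); last by lra.
  by apply: ler_pM; rewrite ?exprn_ge0 ?cabs_ge0.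
have hs2 : cabs s2 <= 22 / 1000.
  rewrite cabsM cabsX; apply: (@le_trans _ _ (190^-1 ^+ 2 * 760)); last by lra.
  by apply: ler_pM; rewrite ?exprn_ge0 ?cabs_ge0.
have hp : cabs p <= 5 / 100.
  apply: (le_trans (cabsD _ _)); rewrite cabsM cabs_nat.
  by move: hq hp2; move: (cabs q) (cabs p2) => x y; clear; lra.
have hs : cabs s <= 196 / 1000.
  apply: (le_trans (cabsD _ _)); rewrite cabsM cabs_nat.
  by move: hq hs2; move: (cabs q) (cabs s2) => x y; clear; lra.
(* Here E_4 = 1 + 240 q (1 + p) and E_6 = 1 - 504 q (1 + s). The linear coefficient 23 + 100 - 147 =
   - 24 of W is collected beforehand, since bounding its parts separately would exceed 1. *)
have -> : (((1 + 240 * (0 * q ^+ 0 + (1 * q ^+ (1 + 0) + (9 * q ^+ (1 + (1 + 0)) + 0)) + q ^+ 3 * S)) ^+ 3 -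
   (1 - 504 * (0 * q ^+ 0 + (1 * q ^+ (1 + 0) + (33 * q ^+ (1 + (1 + 0)) + 0)) + q ^+ 3 * T)) ^+ 2) / 12 ^+ 3)
  = q * (1 + (- (24 * q) + (5 / 12 * p2 + 7 / 12 * s2) +
      q * (200 * p + 100 * p ^+ 2 - (294 * s + 147 * s ^+ 2)) + 20 ^+ 3 * q ^+ 2 * (1 + p) ^+ 3)) :> C.
  by rewrite /s /p /s2 /p2; field.
set W := _ + 20 ^+ 3 * _ * _.
have hW : cabs W <= 9 / 10.
  have k1 : cabs (- (24 * q)) <= 24 * 190^-1 by rewrite cabsN cabsM cabs_nat ler_wpM2l.
  have k2 : cabs (5 / 12 * p2 + 7 / 12 * s2) <= 5 / 12 * (24 / 10000) + 7 / 12 * (22 / 1000).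
    apply: (le_trans (cabsD _ _)).
    rewrite [cabs (_ * p2)]cabsM [cabs (_ * s2)]cabsM [cabs (5 / 12)]cabsM [cabs (7 / 12)]cabsM !cabsV !cabs_nat.
    by apply: lerD; apply: ler_wpM2l => //; rewrite divr_ge0.
  have k3 : cabs (200 * p + 100 * p ^+ 2) <= 200 * (5 / 100) + 100 * (5 / 100) ^+ 2.
    apply: (le_trans (cabsD _ _)); rewrite [cabs (200 * _)]cabsM [cabs (100 * _)]cabsM cabsX !cabs_nat.
    by apply: lerD; apply: ler_wpM2l; rewrite ?ler0n ?hp ?hs ?ler_expr_base ?cabs_ge0 ?hp ?hs.
  have k4 : cabs (294 * s + 147 * s ^+ 2) <= 294 * (196 / 1000) + 147 * (196 / 1000) ^+ 2.
    apply: (le_trans (cabsD _ _)); rewrite [cabs (294 * _)]cabsM [cabs (147 * _)]cabsM cabsX !cabs_nat.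
    by apply: lerD; apply: ler_wpM2l; rewrite ?ler0n ?hp ?hs ?ler_expr_base ?cabs_ge0 ?hp ?hs.
  have k5 : cabs (q * (200 * p + 100 * p ^+ 2 - (294 * s + 147 * s ^+ 2))) <= 190^-1 *
     (200 * (5 / 100) + 100 * (5 / 100) ^+ 2 + (294 * (196 / 1000) + 147 * (196 / 1000) ^+ 2)).
    by rewrite cabsM ler_pM ?cabs_ge0// (le_trans (cabsB _ _))// lerD.
  have k6 : cabs (20 ^+ 3 * q ^+ 2 * (1 + p) ^+ 3) <= 20 ^+ 3 * 190^-1 ^+ 2 * (1 + 5 / 100) ^+ 3.
    rewrite [cabs (_ * (1 + p) ^+ 3)]cabsM [cabs (20 ^+ 3 * _)]cabsM !cabsX cabs_nat.
    apply: ler_pM; rewrite ?exprn_ge0 ?mulr_ge0 ?exprn_ge0 ?cabs_ge0//.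
      by rewrite ler_wpM2l ?exprn_ge0.
    apply: ler_expr_base; first exact: cabs_ge0.
    by apply: (le_trans (cabsD _ _)); rewrite cabs1 lerD2l.
  rewrite /W; apply: (le_trans (cabsD _ _)); apply: (le_trans (lerD (cabsD _ _) (lexx _))).
  apply: (le_trans (lerD (lerD (cabsD _ _) (lexx _)) (lexx _))).
  apply: (le_trans (lerD (lerD (lerD k1 k2) k5) k6)); clear; lra.
rewrite cabsM; apply: ler_wpM2l => //.
have := cabs_addl 1 W; rewrite cabs1; move: hW; move: (cabs W) (cabs (1 + W)) => x y; clear; lra.
Qed.

(** The derivative of Delta at 0 is (3 * 240 + 2 * 504) / 12^3 = 1. *)
Lemma lip1_D : exists2 K : R, 0 < K & forall (x : R) q q', x <= 1 / 2 -> cabs q <= x -> cabs q' <= x ->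
    cabs (Dq q - Dq q' - (q - q')) <= K * x * cabs (q - q').
Proof.
have e0 : E4q 0 = 1.
  rewrite E4qE (csum_head 1 (tame_sigc 3)) ?cabs0// big_ord_recl big_ord0 /sigc.
  by rewrite !(mul0r, addr0, mulr0).
have s0 : E6q 0 = 1.
  rewrite E6qE (csum_head 1 (tame_sigc 5)) ?cabs0// big_ord_recl big_ord0 /sigc.
  by rewrite !(mul0r, addr0, mulr0, subr0).
have h4 := lip1M (lip1_cst 240) (lip1_eisq 2).
have h6 := lip1M (lip1_cst (- 504)) (lip1_eisq 4).
rewrite mul0r add0r mulr1 -/(E4q) in h4.
rewrite mul0r add0r mulr1 -/(E6q) in h6.
have hD p : Dq p = (12 ^+ 3)^-1 * (E4q p * (E4q p * E4q p) + -1 * (E6q p * E6q p)).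
  by rewrite /Dq; move: (E4q p) (E6q p) => u v; rewrite mulrC mulN1r !exprS expr0 !mulr1.
move: (E4q) (E6q) (Dq) h4 h6 e0 s0 hD => e s d h4 h6 e0 s0 hD.
have h := lip1M (lip1_cst (12 ^+ 3)^-1) (lip1D (lip1M h4 (lip1M h4 h4)) (lip1M (lip1_cst (-1)) (lip1M h6 h6))).
have [K K0 hK] := h; exists K => // x q q' hx hq hq'.
have := hK x q q' hx hq hq'; rewrite e0 s0 -!hD.
rewrite !(mul0r, mulr1, mul1r, add0r).
have -> : (12 ^+ 3)^-1 * (240 + (240 + 240) + -1 * (- 504 - 504)) = 1 :> C.
  have t0 : 24 != 0 :> C by rewrite pnatr_eq0.
  have -> : 240 = 10 * 24 :> C by rewrite -natrM.
  have -> : 504 = 21 * 24 :> C by rewrite -natrM.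
  by field.
by rewrite mul1r.
Qed.

End Discriminant.

(** * The Sturm bound *)

Section Reduction.
Variable R : realType.
Local Notation C := R[i].
Implicit Types (F G : C -> C) (q tau u : C).

(** 2 pi (17/20) >= 527/100, and e^(527/100) is the 32nd power of e^(527/3200), which is bounded
    below by its Taylor polynomial. The rationals are successive squares rounded down. *)
Lemma nome_small tau : 17 / 20 <= complex.Im tau -> cabs (nome tau) <= 190^-1.
Proof.
move=> hy; rewrite cabs_nome expRN lef_pV2 ?posrE ?expR_gt0//.
have hx : 32 * (527 / 3200) <= 2 * pi * complex.Im tau.
  have := @pi_ge31 R; nra.
have h1 : (119 / 101) ^+ 32 <= expR (32 * (527 / 3200) : R).
  rewrite expRM_natl; apply: ler_expr_base; first by lra.
  apply: le_trans (exp_ge_taylor2 _); lra.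
apply: (@le_trans _ _ (expR (32 * (527 / 3200)))); last by rewrite ler_expR.
apply: le_trans h1.
have sq (a x y : R) : 0 <= a -> a <= x ^+ 2 -> x ^+ 2 <= y -> a ^+ 2 <= y ^+ 2.
  by move=> a0 ax xy; apply: ler_expr_base => //; exact: le_trans xy.
have p (x : R) : x ^+ 32 = ((((x ^+ 2) ^+ 2) ^+ 2) ^+ 2) ^+ 2 by rewrite -!exprM.
rewrite p; set y := 119 / 101.
apply: (@le_trans _ _ ((2757 / 200) ^+ 2)); first by lra.
apply: (@sq _ (427 / 115)); [lra|lra|].
apply: (@sq _ (422 / 219)); [lra|lra|].
apply: (@sq _ (211 / 152)); [lra|lra|].
apply: ler_expr_base; rewrite /y; lra.
Qed.

(** In the strip below height 17/20 one has |t|^2 <= 1/4 + (17/20)^2 = 389/400, so each inversion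
    multiplies the height by at least 400/389. Stopping below sqrt 3 / 2 leaves a definite gain at
    every step, and no minimality argument over the orbit is required. *)
Lemma modular_reduce (T : Type) (f : C -> T) tau :
  (forall t, 0 < complex.Im t -> f (t + 1) = f t) ->
  (forall t, 0 < complex.Im t -> f (- t^-1) = f t) -> 0 < complex.Im tau ->
  exists t, [/\ 17 / 20 <= complex.Im t & f t = f tau].
Proof.
move=> fT fS; set r : R := 389 / 400.
have r0 : 0 < r by rewrite /r; lra.
have r1 : r < 1 by rewrite /r; lra.
have red n : forall t, 0 < complex.Im t -> 17 / 20 * r ^+ n <= complex.Im t ->
    exists t', [/\ 17 / 20 <= complex.Im t' & f t' = f t].
  elim: n => [|n IH] t t0 ht; first by exists t; split=> //; move: ht; rewrite expr0 mulr1.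
  have [|hlt] := leP (17 / 20) (complex.Im t); first by exists t.
  have [|t1 [im1 re1 f1]] := @shift_reduce R T f t; first by move=> s hs; apply: fT; rewrite hs.
  have t10 : 0 < complex.Im t1 by rewrite im1.
  have hc : cabs t1 ^+ 2 <= r.
    rewrite cabs_sqr im1; have : complex.Re t1 ^+ 2 <= 2^-1 ^+ 2.
      by rewrite -real_normK ?num_real// ler_expr_base.
    have : complex.Im t ^+ 2 <= (17 / 20) ^+ 2 by rewrite ler_expr_base// ltW.
    rewrite /r; lra.
  have c0 : 0 < cabs t1 ^+ 2 by rewrite exprn_gt0// cabs_gt0 upper_neq0.
  have [||t' [h1 h2]] := IH (- t1^-1); last by exists t'; rewrite h1 h2 fS// f1.
    exact: upper_inv.
  rewrite Im_opp_inv im1 ler_pdivlMr//; apply: le_trans ht.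
  have aux (p s x : R) : 0 <= p -> x <= s -> p * x <= p * s by move=> *; rewrite ler_wpM2l.
  rewrite [leRHS](_ : _ = 17 / 20 * r ^+ n * r); last by rewrite [r ^+ n.+1]exprSr mulrA.
  apply: aux hc.
  by rewrite mulr_ge0 ?exprn_ge0 ?(ltW r0)//; lra.
move=> y0; have [K K0 hK] := polygeo 0 (ltW r0) r1.
have e0 : 0 < 20 / 17 * complex.Im tau by rewrite mulr_gt0//; lra.
have [N hN] := small_inv K e0.
apply: (red N) => //.
suff h : r ^+ N <= K / N.+1%:R.
  have {h hN} := le_trans h (hN N (leqnn _)).
  move: (r ^+ N) (complex.Im tau) => a b; clear -a b; lra.
rewrite ler_pdivlMr ?ltr0n//; apply: le_trans (hK N.+1).
rewrite mulr_natr -[X in _ *+ X]card_ord -sumr_const; apply: ler_sum => i _.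
rewrite expr0 mul1r ler_wiXn2l ?(ltW r0) ?(ltW r1)//.
by rewrite -ltnS.
Qed.

Lemma Dq_neq0 tau : 0 < complex.Im tau -> Dq (nome tau) != 0.
Proof.
(* The reduced quantity is the truth value of the nonvanishing, which is invariant although Delta is
   not. *)
move=> y0; have [||t [ht <-]] := @modular_reduce bool (fun t => Dq (nome t) != 0) tau _ _ y0.
- by move=> t _; rewrite nomeD1.
- move=> t t0; rewrite (modq_D t0); congr (~~ _).
  by rewrite mulf_eq0 expf_eq0 /= (negPf (upper_neq0 t0)).
rewrite -cabs_gt0; apply: lt_le_trans (Dq_lb (nome_small ht)).
by rewrite divr_gt0// cabs_gt0 nome_neq0.
Qed.

(** Composition with the increment q (e^(c u) - 1), c = 2 pi i; the witnesses are the coefficients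
    of the composite up to order 2, and |c| <= 8 controls the constants. *)
Lemma smooth2_nome F (r : R) : 0 < r -> r < 1 -> smooth2 F -> exists2 K : R, 0 < K & exists2 d : R, 0 < d &
  forall tau, cabs (nome tau) <= r -> exists a b,
   [/\ cabs (F (nome tau)) <= K, cabs a <= K, cabs b <= K & forall u, cabs u <= d ->
     cabs (F (nome (tau + u)) - F (nome tau) - a * u - b * u ^+ 2) <= K * cabs u ^+ 3].
Proof.
move=> r0 r1 hF; have [K K0 [d d0 hK]] := hF r r0 r1.
pose c : C := 2 * pi%:C * 'i%C.
have c8 : cabs c <= 8.
  rewrite /c !cabsM cabs_nat cabsi cabs_real mulr1 ger0_norm ?pi_ge0//.
  have := @pi_le4 R; lra.
have c0 := cabs_ge0 c.
have c82 : cabs c ^+ 2 <= 8 ^+ 2 by rewrite ler_expr_base.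
have c83 : cabs c ^+ 3 <= 8 ^+ 3 by rewrite ler_expr_base.
exists (256 * 8 ^+ 3 * K); first by apply: mulr_gt0 => //; apply: mulr_gt0; rewrite ?exprn_gt0 ?ltr0n.
exists (Num.min 8^-1 (d / 48)); first by rewrite lt_min divr_gt0// andbT.
move=> tau hq; have [a [b [f0 f1 f2 f3]]] := hK _ hq.
set q := nome tau in hq f0 f3 *.
have q1 : cabs q <= 1 by lra.
have q0 := cabs_ge0 q.
exists (a * q * c), ((a * q / 2 + b * q ^+ 2) * c ^+ 2); split.
- by apply: (le_trans f0); nra.
- rewrite [cabs (_ * c)]cabsM [cabs (a * q)]cabsM; apply: (@le_trans _ _ (K * 1 * 8)); last by lra.
  by apply: ler_pM; rewrite ?mulr_ge0 ?cabs_ge0// ler_pM ?cabs_ge0.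
- rewrite [cabs (_ * c ^+ 2)]cabsM [cabs (c ^+ 2)]cabsX.
  apply: (@le_trans _ _ (2 * K * 8 ^+ 2)); last by lra.
  apply: ler_pM; rewrite ?exprn_ge0 ?cabs_ge0//.
  apply: (le_trans (cabsD _ _)); rewrite [cabs (_ / 2)]cabsM [cabs (a * q)]cabsM
    [cabs (b * _)]cabsM cabsX cabsV cabs_nat.
  have : cabs a * cabs q <= K * 1 by rewrite ler_pM ?cabs_ge0.
  have : cabs b * cabs q ^+ 2 <= K * 1 by rewrite ler_pM ?exprn_ge0 ?cabs_ge0 ?exprn_ile1.
  lra.
move=> u; rewrite le_min => /andP[u8 ud].
have u0 := cabs_ge0 u.
set U := c * u.
have hU : cabs U <= 8 * cabs u by rewrite cabsM ler_wpM2r.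
have U0 := cabs_ge0 U.
have U1 : cabs U <= 1 by lra.
have -> : nome (tau + u) = q + q * (cexp U - 1) by rewrite nomeD -/q /nome -/U; ring.
have t1 := cexp_taylor U1; have t2 := cexp_lin U1.
set E := cexp U - (1 + U + U ^+ 2 / 2) in t1; set L := cexp U - 1 - U in t2.
have U2 : cabs U ^+ 2 <= cabs U by rewrite expr2 ler_piMl.
have hw : cabs (cexp U - 1) <= 6 * cabs U.
  have -> : cexp U - 1 = L + U by rewrite /L; ring.
  apply: (le_trans (cabsD _ _)); lra.
set w := q * (cexp U - 1).
have hw2 : cabs w <= 6 * cabs U.
  by rewrite cabsM; apply: le_trans hw; rewrite ler_piMl ?cabs_ge0.
have {}f3 := f3 w ltac:(lra).
set S := F (q + w) - F q - a * w - b * w ^+ 2 in f3.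
have -> : F (q + w) - F q - a * q * c * u - (a * q / 2 + b * q ^+ 2) * c ^+ 2 * u ^+ 2 =
   S + a * (q * E) + b * (q ^+ 2 * (L * (2 * U + L))).
  have gen (s t z p : C) : s - t - a * p * c * u - (a * p / 2 + b * p ^+ 2) * c ^+ 2 * u ^+ 2 =
    (s - t - a * (p * (z - 1)) - b * (p * (z - 1)) ^+ 2) + a * (p * (z - (1 + c * u + (c * u) ^+ 2 / 2)))
    + b * (p ^+ 2 * ((z - 1 - c * u) * (2 * (c * u) + (z - 1 - c * u)))) by field.
  exact: gen.
have U30 : 0 <= cabs U ^+ 3 by rewrite exprn_ge0.
have hS : cabs S <= K * (216 * cabs U ^+ 3).
  apply: (le_trans f3); rewrite ler_wpM2l ?(ltW K0)//.
  have -> : 216 * cabs U ^+ 3 = (6 * cabs U) ^+ 3 by ring.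
  by rewrite ler_expr_base ?cabs_ge0.
have h2 : cabs (a * (q * E)) <= K * (1 * (4 * cabs U ^+ 3)).
  rewrite cabsM; apply: ler_pM; rewrite ?cabs_ge0// cabsM; apply: ler_pM; rewrite ?cabs_ge0//.
have h3 : cabs (b * (q ^+ 2 * (L * (2 * U + L)))) <= K * (1 * (5 * cabs U ^+ 2 * (7 * cabs U))).
  rewrite cabsM; apply: ler_pM; rewrite ?cabs_ge0// cabsM; apply: ler_pM; rewrite ?cabs_ge0//.
    by rewrite cabsX exprn_ile1.
  rewrite cabsM; apply: ler_pM; rewrite ?cabs_ge0//.
  apply: (le_trans (cabsD _ _)); rewrite cabsM cabs_nat; lra.
have U3 : cabs U ^+ 3 <= 8 ^+ 3 * cabs u ^+ 3.
  by rewrite -exprMn ler_expr_base.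
apply: (le_trans (cabsD _ _)); apply: (le_trans (lerD (cabsD _ _) (lexx _))).
apply: (@le_trans _ _ (256 * (K * cabs U ^+ 3))).
  have -> : cabs U ^+ 3 = cabs U ^+ 2 * cabs U by rewrite exprSr.
  have : 0 <= K * (cabs U ^+ 2 * cabs U) by rewrite mulr_ge0 ?(ltW K0)// mulr_ge0 ?exprn_ge0.
  rewrite exprSr in hS h2; lra.
have := ler_wpM2l (ltW K0) U3; lra.
Qed.

End Reduction.

(** * Products of values at four surrounding points *)

Section FourPoints.
Variable R : realType.
Local Notation C := R[i].
Implicit Types (F G : C -> C) (q tau u : C).

Lemma prod4_perturb (P e : R) (p1 p2 p3 p4 e1 e2 e3 e4 : C) :
  cabs p1 <= P -> cabs p2 <= P -> cabs p3 <= P -> cabs p4 <= P ->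
  cabs (p1 + e1) <= P -> cabs (p2 + e2) <= P -> cabs (p3 + e3) <= P ->
  cabs e1 <= e -> cabs e2 <= e -> cabs e3 <= e -> cabs e4 <= e ->
  cabs ((p1 + e1) * (p2 + e2) * (p3 + e3) * (p4 + e4) - p1 * p2 * p3 * p4) <= 4 * P ^+ 3 * e.
Proof.
move=> a1 a2 a3 a4 b1 b2 b3 c1 c2 c3 c4.
have mul4 (x y z t : C) (A B D E : R) : cabs x <= A -> cabs y <= B -> cabs z <= D -> cabs t <= E ->
    cabs (x * y * z * t) <= A * B * D * E.
  move=> *; rewrite [cabs (_ * t)]cabsM [cabs (_ * z)]cabsM [cabs (x * y)]cabsM.
  by apply: ler_pM; rewrite ?mulr_ge0 ?cabs_ge0// ler_pM ?mulr_ge0 ?cabs_ge0// ler_pM ?cabs_ge0.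
have -> : (p1 + e1) * (p2 + e2) * (p3 + e3) * (p4 + e4) - p1 * p2 * p3 * p4 =
  e1 * p2 * p3 * p4 + (p1 + e1) * e2 * p3 * p4 + (p1 + e1) * (p2 + e2) * e3 * p4
  + (p1 + e1) * (p2 + e2) * (p3 + e3) * e4 by ring.
have h1 := mul4 _ _ _ _ _ _ _ _ c1 a2 a3 a4.
have h2 := mul4 _ _ _ _ _ _ _ _ b1 c2 a3 a4.
have h3 := mul4 _ _ _ _ _ _ _ _ b1 b2 c3 a4.
have h4 := mul4 _ _ _ _ _ _ _ _ b1 b2 b3 c4.
apply: (le_trans (cabsD _ _)); apply: (le_trans (lerD (cabsD _ _) (lexx _))).
apply: (le_trans (lerD (lerD (cabsD _ _) (lexx _)) (lexx _))).
rewrite [leRHS](_ : _ = e * P * P * P + P * e * P * P + P * P * e * P + P * P * P * e); last by ring.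
by rewrite !lerD.
Qed.

(* Averaging over U, -U, iU, -iU kills the terms of degree 1, 2 and 3. *)
Lemma four_point (K x : R) (h a b U : C) (S : C -> C) :
  cabs h <= K -> cabs a <= K -> cabs b <= K -> cabs U <= x -> x <= 1 ->
  (forall V, cabs V <= x -> cabs (S V - h - a * V - b * V ^+ 2) <= K * x ^+ 3) ->
  cabs (S U * S (- U) * S ('i * U) * S (- ('i * U)) - h ^+ 4) <= 300 * K ^+ 4 * x ^+ 3.
Proof.
move=> hh ha hb hU x1 hS.
have K0 : 0 <= K by apply: le_trans hh; exact: cabs_ge0.
have x0 : 0 <= x by apply: le_trans hU; exact: cabs_ge0.
have x30 : 0 <= x ^+ 3 by rewrite exprn_ge0.
have x31 : x ^+ 3 <= 1 by rewrite exprn_ile1.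
pose p V := h + a * V + b * V ^+ 2; pose e V := S V - h - a * V - b * V ^+ 2.
have SE V : S V = p V + e V by rewrite /p /e; ring.
have V3 V : cabs V <= x -> cabs (p V) <= 3 * K.
  move=> hV; have V1 := le_trans hV x1.
  have h1 : cabs (a * V) <= K * 1 by rewrite cabsM ler_pM ?cabs_ge0.
  have h2 : cabs (b * V ^+ 2) <= K * 1 by rewrite cabsM cabsX ler_pM ?exprn_ge0 ?cabs_ge0 ?exprn_ile1 ?cabs_ge0.
  apply: (le_trans (cabsD _ _)); apply: (le_trans (lerD (cabsD _ _) (lexx _))); lra.
have V4 V : cabs V <= x -> cabs (p V + e V) <= 4 * K.
  move=> hV; apply: (le_trans (cabsD _ _)); have := V3 V hV; have := hS V hV.
  have : K * x ^+ 3 <= K * 1 by rewrite ler_wpM2l.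
  rewrite -/(e V); lra.
have w1 : cabs (- U) <= x by rewrite cabsN.
have w2 : cabs ('i * U) <= x by rewrite cabsM cabsi mul1r.
have w3 : cabs (- ('i * U)) <= x by rewrite cabsN.
have V34 V : cabs V <= x -> cabs (p V) <= 4 * K by move=> /V3; lra.
rewrite !SE; have := prod4_perturb (V34 _ hU) (V34 _ w1) (V34 _ w2) (V34 _ w3)
  (V4 _ hU) (V4 _ w1) (V4 _ w2) (hS _ hU) (hS _ w1) (hS _ w2) (hS _ w3).
rewrite -!/(e _).
set A := _ * (p (- ('i * U)) + _); set B := _ * p (- ('i * U)) => hAB.
(* With X = U^2 the pair U, - U contributes (h + b X)^2 - a^2 X, and multiplication by i replaces X
   by - X; hence the product contains only even powers of X. *)
have hB : B - h ^+ 4 = (U ^+ 2) ^+ 2 * (2 * h ^+ 2 * b ^+ 2 + b ^+ 4 * (U ^+ 2) ^+ 2 - (2 * h * b - a ^+ 2) ^+ 2).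
  have i2 : 'i * 'i = -1 :> C by rewrite -expr2 sqr_i.
  have -> : B = ((h + b * U ^+ 2) ^+ 2 - a ^+ 2 * U ^+ 2)
     * ((h + b * U ^+ 2 * ('i * 'i)) ^+ 2 - a ^+ 2 * U ^+ 2 * ('i * 'i)) by rewrite /B /p; ring.
  rewrite i2; ring.
have -> : A - h ^+ 4 = (A - B) + (B - h ^+ 4) by ring.
apply: (le_trans (cabsD _ _)).
have hX : cabs (U ^+ 2) <= x ^+ 2 by rewrite cabsX ler_expr_base ?cabs_ge0.
have X0 := cabs_ge0 (U ^+ 2).
have hX2 : cabs ((U ^+ 2) ^+ 2) <= x ^+ 3.
  rewrite -exprM cabsX; apply: (@le_trans _ _ (x ^+ 4)); first by rewrite ler_expr_base ?cabs_ge0.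
  by rewrite exprSr ler_piMr.
have h1 : cabs (2 * h ^+ 2 * b ^+ 2 + b ^+ 4 * (U ^+ 2) ^+ 2 - (2 * h * b - a ^+ 2) ^+ 2) <= 12 * K ^+ 4.
  have k0 : cabs (2 * h ^+ 2 * b ^+ 2) <= 2 * K ^+ 2 * K ^+ 2.
    rewrite [cabs (_ * b ^+ 2)]cabsM [cabs (2 * _)]cabsM !cabsX cabs_nat.
    by apply: ler_pM; rewrite ?mulr_ge0 ?exprn_ge0 ?cabs_ge0// ?ler_wpM2l// ler_expr_base ?cabs_ge0.
  have k1 : cabs (b ^+ 4 * (U ^+ 2) ^+ 2) <= K ^+ 4 * 1.
    rewrite cabsM cabsX; apply: ler_pM; rewrite ?exprn_ge0 ?cabs_ge0// ?ler_expr_base ?cabs_ge0//.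
    exact: le_trans x31.
  have k2 : cabs (2 * h * b - a ^+ 2) <= 2 * K * K + K ^+ 2.
    apply: (le_trans (cabsB _ _)); rewrite [cabs (_ * b)]cabsM [cabs (2 * _)]cabsM cabsX cabs_nat.
    apply: lerD; last by rewrite ler_expr_base ?cabs_ge0.
    by apply: ler_pM; rewrite ?mulr_ge0 ?cabs_ge0// ler_wpM2l.
  have k3 : cabs ((2 * h * b - a ^+ 2) ^+ 2) <= (2 * K * K + K ^+ 2) ^+ 2.
    by rewrite cabsX ler_expr_base ?cabs_ge0.
  apply: (le_trans (cabsB _ _)); apply: (le_trans (lerD (cabsD _ _) (lexx _))).
  apply: (le_trans (lerD (lerD k0 k1) k3)).
  by rewrite le_eqVlt; apply/orP; left; apply/eqP; ring.
have h2 : cabs (B - h ^+ 4) <= x ^+ 3 * (12 * K ^+ 4).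
  by rewrite hB cabsM; apply: ler_pM; rewrite ?cabs_ge0.
apply: (le_trans (lerD hAB h2)).
have : 0 <= K ^+ 4 * x ^+ 3 by rewrite mulr_ge0 ?exprn_ge0.
rewrite [4 * (4 * K) ^+ 3 * (K * x ^+ 3)](_ : _ = 256 * (K ^+ 4 * x ^+ 3)); last by ring.
by rewrite [x ^+ 3 * (12 * K ^+ 4)]mulrC -!mulrA; lra.
Qed.

Lemma smooth2_four F : smooth2 F -> exists2 L : R, 0 < L & exists2 d : R, 0 < d &
  forall tau (x : R), cabs (nome tau) <= 1 / 2 -> 0 <= x -> x <= d ->
    cabs (F (nome (tau + x%:C)) * F (nome (tau - x%:C)) * F (nome (tau + 'i * x%:C))
          * F (nome (tau - 'i * x%:C)) - F (nome tau) ^+ 4) <= L * x ^+ 3.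
Proof.
move=> hF; have [||K K0 [d d0 hK]] := smooth2_nome (r := 1 / 2) _ _ hF; try lra.
exists (300 * K ^+ 4); first by apply: mulr_gt0; [rewrite ltr0n|exact: exprn_gt0].
exists (Num.min 1 d); first by rewrite lt_min ltr01.
move=> tau x hq x0; rewrite le_min => /andP[x1 xd].
have [a [b [h0 h1 h2 h3]]] := hK tau hq.
have hx : cabs (x%:C : C) <= x by rewrite cabs_real ger0_norm.
apply: (four_point h0 h1 h2 hx x1 (S := fun V => F (nome (tau + V)))) => V hV.
apply: (le_trans (h3 V (le_trans hV xd))).
by rewrite ler_wpM2l ?(ltW K0)// ler_expr_base ?cabs_ge0.
Qed.

End FourPoints.

(** * The maximum principle *)

Section Sturm.
Variable R : realType.
Local Notation C := R[i].
Implicit Types (F G : C -> C) (q tau u : C).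

(** f0 and g0 are the sizes of F and Delta^m at a nearly maximal point of height y0, and pf, pg, py
    are products over its four neighbours. Relative to T^4 the lower bound on pf loses O(x^3), while
    the upper bound carries the factor 1 - x^2/Y^2 because v > 0; for small x these are
    incompatible. *)
Lemma four_point_contradiction (f0 g0 M y0 Y x c1 c2 L L' pf pg py : R) (v : nat) :
  (0 < v)%N -> 0 < M -> 0 < x -> x <= 1 / 2 -> 1 <= Y -> 17 / 20 <= y0 -> y0 <= Y ->
  0 < c1 -> 0 < c2 -> c1 <= f0 -> c2 <= g0 -> 0 < L -> 0 < L' ->
  f0 <= M * g0 * y0 ^+ v -> (1 - x ^+ 3) * (M * g0 * y0 ^+ v) <= f0 ->
  f0 ^+ 4 - L * x ^+ 3 <= pf -> pg <= g0 ^+ 4 + L' * x ^+ 3 ->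
  pf <= M ^+ 4 * pg * py -> py = (y0 ^+ 2 * (y0 ^+ 2 - x ^+ 2)) ^+ v ->
  x * (Y ^+ 2 * (4 + L / c1 ^+ 4 + L' / c2 ^+ 4)) < 1 -> False.
Proof.
move=> v0 M0 x0 x2 Y1 y17 yY c10 c20 c1f c2g L0 L0' fT Tf hpf hpg hp hpy hx.
have Y0 : 0 < Y by lra.
have y00 : 0 < y0 by lra.
have g00 : 0 < g0 by lra.
have f00 : 0 < f0 by lra.
set T := M * g0 * y0 ^+ v in fT Tf.
have T0 : 0 < T by rewrite !mulr_gt0 ?exprn_gt0.
have T40 : 0 < T ^+ 4 by rewrite exprn_gt0.
have x30 : 0 < x ^+ 3 by rewrite exprn_gt0.
have x20 : 0 < x ^+ 2 by rewrite exprn_gt0.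
have x31 : x ^+ 3 <= 1 / 8.
  rewrite (_ : 1 / 8 = (1 / 2) ^+ 3); last by field.
  by rewrite ler_expr_base ?(ltW x0).
have hxy : x ^+ 2 <= y0 ^+ 2 by rewrite ler_expr_base ?(ltW x0)//; lra.
have hy0 : 0 <= 1 - x ^+ 2 / y0 ^+ 2.
  by rewrite subr_ge0 ler_pdivrMr ?exprn_gt0// mul1r.
have hpy' : py <= (y0 ^+ v) ^+ 4 * (1 - x ^+ 2 / Y ^+ 2).
  have -> : py = (y0 ^+ v) ^+ 4 * (1 - x ^+ 2 / y0 ^+ 2) ^+ v.
    rewrite hpy -!exprM mulnC exprM -exprMn; congr (_ ^+ _).
    by field; rewrite gt_eqF.
  rewrite ler_wpM2l ?exprn_ge0 ?(ltW y00)//.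
  apply: (@le_trans _ _ (1 - x ^+ 2 / y0 ^+ 2)).
    case: v v0 {T fT Tf T0 T40 hpy} => // v _; rewrite exprS ler_piMr// exprn_ile1//.
    by rewrite gerBl divr_ge0// ?ltW// exprn_gt0.
  rewrite lerD2l lerN2 ler_pM2l// lef_pV2 ?posrE ?exprn_gt0//.
  by rewrite ler_expr_base// ltW.
have Y20 : 0 < Y ^+ 2 by rewrite exprn_gt0.
have xY : x ^+ 2 / Y ^+ 2 <= 1.
  by rewrite ler_pdivrMr// mul1r ler_expr_base ?(ltW x0)//; lra.
have xY0 : 0 < x ^+ 2 / Y ^+ 2 by rewrite divr_gt0.
have pg0 : M ^+ 4 * pg * py <= M ^+ 4 * (g0 ^+ 4 + L' * x ^+ 3) * ((y0 ^+ v) ^+ 4 * (1 - x ^+ 2 / Y ^+ 2)).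
  have py0 : 0 <= py.
    by rewrite hpy exprn_ge0// mulr_ge0 ?subr_ge0// exprn_ge0// ltW.
  apply: (@le_trans _ _ (M ^+ 4 * (g0 ^+ 4 + L' * x ^+ 3) * py)).
    by rewrite ler_wpM2r// ler_wpM2l// exprn_ge0// ltW.
  rewrite ler_wpM2l// mulr_ge0 ?exprn_ge0 ?addr_ge0 ?(ltW M0)//.
    by rewrite exprn_ge0// ltW.
  by rewrite mulr_ge0 ?ltW.
set al := L / c1 ^+ 4 in hx; set be := L' / c2 ^+ 4 in hx.
have c140 : 0 < c1 ^+ 4 by rewrite exprn_gt0.
have c240 : 0 < c2 ^+ 4 by rewrite exprn_gt0.
have al0 : 0 < al by rewrite divr_gt0.
have be0 : 0 < be by rewrite divr_gt0.
have hL : L <= al * T ^+ 4.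
  rewrite /al mulrAC ler_pdivlMr// ler_wpM2l ?(ltW L0)// ler_expr_base ?(ltW c10)//.
  exact: le_trans fT.
have hL' : L' <= be * g0 ^+ 4.
  by rewrite /be mulrAC ler_pdivlMr// ler_wpM2l ?(ltW L0')// ler_expr_base ?(ltW c20).
have TE : T ^+ 4 = M ^+ 4 * g0 ^+ 4 * (y0 ^+ v) ^+ 4 by rewrite /T !exprMn.
have h1 : T ^+ 4 * ((1 - x ^+ 3) ^+ 4 - al * x ^+ 3) <= pf.
  apply: le_trans hpf; rewrite mulrBr; apply: lerB.
    rewrite mulrC -exprMn ler_expr_base// mulr_ge0 ?(ltW T0)//; lra.
  by rewrite [leRHS](_ : _ = al * T ^+ 4 * x ^+ 3); [rewrite ler_wpM2r ?(ltW x30)|ring].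
have h2 : pf <= T ^+ 4 * ((1 + be * x ^+ 3) * (1 - x ^+ 2 / Y ^+ 2)).
  apply: (le_trans hp); apply: (le_trans pg0).
  rewrite TE [leRHS](_ : _ = M ^+ 4 * (g0 ^+ 4 + be * g0 ^+ 4 * x ^+ 3) * ((y0 ^+ v) ^+ 4 * (1 - x ^+ 2 / Y ^+ 2))).
    apply: ler_wpM2r.
      by apply: mulr_ge0; [rewrite exprn_ge0// exprn_ge0// ltW|rewrite subr_ge0].
    rewrite ler_wpM2l ?exprn_ge0 ?(ltW M0)// lerD2l ler_wpM2r ?(ltW x30)//.
  ring.
have {h1 h2} := le_trans h1 h2; rewrite ler_pM2l// => h.
have b1 : 1 - 4 * x ^+ 3 <= (1 - x ^+ 3) ^+ 4 by move: x30 x31; move: (x ^+ 3) => z; nra.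
have b2 : (1 + be * x ^+ 3) * (1 - x ^+ 2 / Y ^+ 2) <= 1 + be * x ^+ 3 - x ^+ 2 / Y ^+ 2.
  have : 0 <= be * x ^+ 3 * (x ^+ 2 / Y ^+ 2) by apply: mulr_ge0; [rewrite mulr_ge0 ?(ltW be0) ?(ltW x30)|exact: ltW].
  lra.
have : x ^+ 2 / Y ^+ 2 <= x ^+ 3 * (4 + al + be) by lra.
rewrite ler_pdivrMr// (_ : _ * Y ^+ 2 = x ^+ 2 * (x * (Y ^+ 2 * (4 + al + be)))); last by ring.
by rewrite ler_pMr// leNgt hx.
Qed.

Lemma prod4_le (M f0 f1 f2 f3 g0 g1 g2 g3 y0 y1 y2 y3 : R) :
  0 <= f0 -> 0 <= f1 -> 0 <= f2 -> 0 <= f3 ->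
  f0 <= M * (g0 * y0) -> f1 <= M * (g1 * y1) -> f2 <= M * (g2 * y2) -> f3 <= M * (g3 * y3) ->
  f0 * f1 * f2 * f3 <= M ^+ 4 * (g0 * g1 * g2 * g3) * (y0 * y1 * y2 * y3).
Proof.
move=> a0 a1 a2 a3 p0 p1 p2 p3.
rewrite [leRHS](_ : _ = M * (g0 * y0) * (M * (g1 * y1)) * (M * (g2 * y2)) * (M * (g3 * y3))); last by ring.
by rewrite ler_pM ?mulr_ge0// ler_pM ?mulr_ge0// ler_pM.
Qed.

(* The invariant function |F| / (|Delta|^m y^v) tends to 0 at the cusp, so that a
   positive supremum is almost attained at a bounded height. Over tau + x, tau - x,
   tau + ix, tau - ix the product of the values of F, or of Delta^m, is the fourth
   power of the value at tau up to O(x^3), while for y the relative error is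
   exactly - x^2 / y^2. *)
Lemma sturm F w m v : smooth2 F -> modq w F -> (w + v.*2 = 12 * m)%N -> (0 < v)%N ->
  jet F 0 m -> forall tau, 0 < complex.Im tau -> F (nome tau) = 0.
Proof.
move=> sF mF hw v0 [K K0 hK].
pose Phi (t : C) := cabs (F (nome t)) / (cabs (Dq (nome t)) ^+ m * complex.Im t ^+ v).
have den0 (t : C) : 0 < complex.Im t -> 0 < cabs (Dq (nome t)) ^+ m * complex.Im t ^+ v.
  by move=> t0; apply: mulr_gt0; apply: exprn_gt0 => //; rewrite cabs_gt0 Dq_neq0.
have Phi1 (t : C) : 0 < complex.Im t -> Phi (t + 1) = Phi t.
  by move=> _; rewrite /Phi nomeD1 cImD /= addr0.
have PhiS (t : C) : 0 < complex.Im t -> Phi (- t^-1) = Phi t.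
  move=> t0; rewrite /Phi (mF t t0) (modq_D t0) Im_opp_inv.
  rewrite [cabs (_ ^+ w * _)]cabsM [cabs (_ ^+ 12 * _)]cabsM !cabsX.
  have c0 : 0 < cabs t by rewrite cabs_gt0 upper_neq0.
  have d0 := den0 t t0.
  (* The balance w + 2 v = 12 m enters here: the powers of |t| cancel. *)
  have -> : (cabs t ^+ 12 * cabs (Dq (nome t))) ^+ m =
      cabs t ^+ w * cabs t ^+ v.*2 * cabs (Dq (nome t)) ^+ m by rewrite exprMn -exprM -hw exprD.
  have -> : (complex.Im t / cabs t ^+ 2) ^+ v = complex.Im t ^+ v / cabs t ^+ v.*2.
    by rewrite expr_div_n -exprM mul2n.
  move: (cabs (F _)) (cabs t) c0 d0 => s z z0.
  move: (cabs (Dq _) ^+ m) (complex.Im t ^+ v) => a b ab0.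
  have a0 : a != 0 by apply: contraTneq ab0 => ->; rewrite mul0r ltxx.
  have b0 : b != 0 by apply: contraTneq ab0 => ->; rewrite mulr0 ltxx.
  have p0 n : z ^+ n != 0 by rewrite expf_neq0 ?gt_eqF.
  move: (z ^+ w) (z ^+ v.*2) (p0 w) (p0 v.*2) => e1 e2 n1 n2.
  by field; rewrite a0 b0 n1 n2.
(* From |F| <= K |q|^m and |Delta| >= |q| / 10. *)
pose B := K * 10 ^+ m; have B0 : 0 < B by rewrite mulr_gt0 ?exprn_gt0.
have PhiB (t : C) : 17 / 20 <= complex.Im t -> Phi t <= B / complex.Im t ^+ v.
  move=> ht; have t0 : 0 < complex.Im t by lra.
  have hq := nome_small ht; have hD := Dq_lb hq.
  have q0 : 0 < cabs (nome t) by rewrite cabs_gt0 nome_neq0.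
  have := hK _ q0 ltac:(lra); rewrite horner0 subr0 => hF.
  rewrite /Phi invfM mulrA ler_wpM2r ?invr_ge0 ?exprn_ge0 ?(ltW t0)//.
  rewrite ler_pdivrMr ?exprn_gt0 ?cabs_gt0 ?Dq_neq0//; apply: (le_trans hF).
  rewrite /B -mulrA ler_wpM2l ?(ltW K0)// -exprMn ler_expr_base ?(ltW q0)//; lra.
have red (t : C) : 0 < complex.Im t -> exists t', 17 / 20 <= complex.Im t' /\ Phi t' = Phi t.
  exact: modular_reduce.
move=> tau1 t10; apply: contrapT => /eqP nz.
pose S : set R := [set x | exists2 t : C, 0 < complex.Im t & x = Phi t]%classic.
have Phi10 : 0 < Phi tau1 by rewrite divr_gt0 ?den0// cabs_gt0.
have hS : has_sup S.
  split; first by exists (Phi tau1), tau1.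
  exists (B / (17 / 20) ^+ v) => _ [t /red[t' [ht' <-]] ->].
  have t'0 : 0 < complex.Im t' by lra.
  have p17 : 0 < 17 / 20 :> R by lra.
  apply: (le_trans (PhiB t' ht')); rewrite ler_pM2l// lef_pV2 ?posrE ?exprn_gt0//.
  by apply: ler_expr_base => //; lra.
pose M := sup S.
have ubM (t : C) : 0 < complex.Im t -> Phi t <= M.
  by move=> ht; apply: ub_le_sup; [case: hS|exists t].
have M0 : 0 < M by apply: lt_le_trans (ubM tau1 t10).
(* Since Phi <= B / y^v, a point with Phi >= M/2 has height at most 1 or at most 2 B / M. *)
pose Y := 1 + 2 * B / M.
have Y1 : 1 <= Y by rewrite /Y lerDl; apply: divr_ge0; [rewrite mulr_ge0 ?(ltW B0)|exact: ltW].
pose c2 := (expR (- (2 * pi * Y)) / 10) ^+ m : R.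
pose c1 := M / 2 * c2 * (17 / 20) ^+ v.
have c20 : 0 < c2 by rewrite exprn_gt0// divr_gt0 ?expR_gt0.
have p17v : 0 < (17 / 20) ^+ v :> R by rewrite exprn_gt0// divr_gt0.
have c10 : 0 < c1 by rewrite mulr_gt0// mulr_gt0// divr_gt0.
have [L L0 [d d0 hL]] := smooth2_four sF.
have [L' L0' [d' d0' hL']] := smooth2_four (smooth2X m (@smooth2_D R)).
pose Q := Y ^+ 2 * (4 + L / c1 ^+ 4 + L' / c2 ^+ 4).
have Q0 : 0 < Q.
  have a1 : 0 < L / c1 ^+ 4 by apply: divr_gt0 => //; exact: exprn_gt0.
  have a2 : 0 < L' / c2 ^+ 4 by apply: divr_gt0 => //; exact: exprn_gt0.
  by rewrite mulr_gt0 ?exprn_gt0//; lra.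
pose x := Num.min (Num.min d d') (Num.min (1 / 2) (1 / (2 * Q))).
have x0 : 0 < x by rewrite !lt_min d0 d0' !divr_gt0// mulr_gt0.
have /and4P[xd xd' x2 xQ] : [&& x <= d, x <= d', x <= 1 / 2 & x <= 1 / (2 * Q)].
  by have := lexx x; rewrite {2}/x !le_min -!andbA.
have x31 : x ^+ 3 <= 1 / 2.
  apply: (@le_trans _ _ ((1 / 2) ^+ 3)); last by lra.
  by rewrite ler_expr_base ?(ltW x0).
have x30 : 0 < x ^+ 3 by rewrite exprn_gt0.
(* The step x is already fixed, so a point within M x^3 of the supremum can be requested. *)
have [_ [t0 ht0 ->] hM] := sup_adherent (mulr_gt0 M0 x30) hS.
rewrite -/M in hM; have [tau [ht hPhi]] := red t0 ht0; rewrite -hPhi in hM.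
set y0 := complex.Im tau in ht.
have y00 : 0 < y0 by lra.
have hPhiM : M / 2 <= Phi tau.
  have : M * x ^+ 3 <= M * (1 / 2) by rewrite ler_wpM2l ?(ltW M0).
  lra.
have yY : y0 <= Y.
  have [y1|y1] := leP y0 1; first exact: le_trans Y1.
  have := le_trans hPhiM (PhiB tau ht); rewrite -/y0 ler_pdivlMr ?exprn_gt0// => hh.
  have yv : y0 <= y0 ^+ v.
    case: (v) v0 => // n _; rewrite exprS ler_pMr// exprn_ege1//; exact: ltW.
  apply: (@le_trans _ _ (2 * B / M)); last by rewrite /Y; lra.
  rewrite ler_pdivlMr//; apply: (le_trans (ler_wpM2r (ltW M0) yv)); lra.
have hq := nome_small ht.
have hq2 : cabs (nome tau) <= 1 / 2 by lra.
set g0 := cabs (Dq (nome tau)) ^+ m; set f0 := cabs (F (nome tau)).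
have PhiE : f0 = Phi tau * (g0 * y0 ^+ v) by rewrite /Phi divfK// gt_eqF// den0.
have c2g : c2 <= g0.
  apply: ler_expr_base; first by rewrite divr_ge0 ?expR_ge0.
  apply: le_trans (Dq_lb hq); rewrite ler_wpM2r// cabs_nome ler_expR lerN2.
  by rewrite ler_wpM2l// mulr_ge0 ?pi_ge0.
have gy0 := den0 tau y00; rewrite -/y0 -/g0 in gy0.
have y17v : (17 / 20) ^+ v <= y0 ^+ v by apply: ler_expr_base => //; lra.
have c1f : c1 <= f0.
  rewrite PhiE /c1 -mulrA; apply: ler_pM => //; first by lra.
    by rewrite mulr_ge0 ?(ltW c20)// exprn_ge0//; lra.
  by apply: ler_pM => //; exact: ltW.
pose s j : C := [:: x%:C; - x%:C; 'i * x%:C; - ('i * x%:C)]`_j.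
have im j : (j < 4)%N -> 0 < complex.Im (tau + s j).
  have k1 : complex.Im (x%:C : C) = 0 by [].
  have k2 : complex.Im ('i * x%:C : C) = x by rewrite cImM /=; ring.
  have y2 : x < y0 by apply: le_lt_trans x2 (lt_le_trans _ ht); clear; lra.
  case: j => [|[|[|[|//]]]] _; rewrite cImD /s /= ?cImN ?k1 ?k2 -/y0 ?oppr0 ?addr0//.
    by rewrite mul0r add0r mul1r addr_gt0.
  by rewrite mul0r add0r mul1r subr_gt0.
have pt j : (j < 4)%N -> cabs (F (nome (tau + s j))) <=
    M * (cabs (Dq (nome (tau + s j)) ^+ m) * complex.Im (tau + s j) ^+ v).
  move=> /im hj; rewrite cabsX -ler_pdivrMr; first exact: ubM.
  exact: den0.
have h4 := hL tau x hq2 (ltW x0) xd; have h4' := hL' tau x hq2 (ltW x0) xd'.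
have := @four_point_contradiction f0 g0 M y0 Y x c1 c2 L L'
  (cabs (F (nome (tau + s 0%N))) * cabs (F (nome (tau + s 1%N))) * cabs (F (nome (tau + s 2%N))) * cabs (F (nome (tau + s 3%N))))
  (cabs (Dq (nome (tau + s 0%N)) ^+ m) * cabs (Dq (nome (tau + s 1%N)) ^+ m) *
   cabs (Dq (nome (tau + s 2%N)) ^+ m) * cabs (Dq (nome (tau + s 3%N)) ^+ m))
  ((y0 ^+ 2 * (y0 ^+ 2 - x ^+ 2)) ^+ v) v v0 M0 x0 x2 Y1 ht yY c10 c20 c1f c2g L0 L0'.
apply => //.
- rewrite PhiE -mulrA ler_wpM2r ?(ltW gy0)//; exact: ubM.
- have e4 (z a b c : R) : z * (a * b * c) = z * a * (b * c) by ring.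
  rewrite PhiE e4 ler_wpM2r ?(ltW gy0)//.
  by rewrite mulrBl mul1r [x ^+ 3 * M]mulrC; exact: ltW.
- rewrite -!cabsM -cabsX.
  have := cabs_subl (F (nome tau) ^+ 4) (F (nome (tau + s 0%N)) * F (nome (tau + s 1%N)) * F (nome (tau + s 2%N)) * F (nome (tau + s 3%N))).
  rewrite cabsC; move: h4; rewrite /s /=; lra.
- rewrite -!cabsM /g0 -!cabsX.
  set G := _ * _ ^+ m; have := cabs_subl G ((Dq (nome tau) ^+ m) ^+ 4).
  move: h4'; rewrite /G /s /=; lra.
- have -> : (y0 ^+ 2 * (y0 ^+ 2 - x ^+ 2)) ^+ v = complex.Im (tau + s 0%N) ^+ v * complex.Im (tau + s 1%N) ^+ v
      * complex.Im (tau + s 2%N) ^+ v * complex.Im (tau + s 3%N) ^+ v.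
    have k1 : complex.Im (x%:C : C) = 0 by [].
    have k2 : complex.Im ('i * x%:C : C) = x by rewrite cImM /=; ring.
    rewrite -!exprMn; congr (_ ^+ _); rewrite !cImD /s /= ?cImN ?k1 ?k2 -/y0.
    by clear; move: y0 x => y x; ring.
  by apply: prod4_le; rewrite ?cabs_ge0 ?pt.
- apply: (@le_lt_trans _ _ (1 / (2 * Q) * Q)); first by rewrite ler_wpM2r ?(ltW Q0).
  by rewrite invfM mul1r divfK ?gt_eqF//; lra.
Qed.

End Sturm.

(** * Coefficients of jets *)

Section Jets.
Variable R : realType.
Local Notation C := R[i].
Implicit Types (F G : C -> C) (q tau u : C) (p s : {poly C}).

Lemma jet_le F p n m : (m <= n)%N -> jet F p n -> jet F p m.
Proof.
move=> mn [K K0 hK]; exists K => // q q0 hq; apply: (le_trans (hK q q0 hq)).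
by rewrite ler_wpM2l ?(ltW K0)// ler_wiXn2l ?(ltW q0)//; lra.
Qed.

(** A nonzero constant term would violate the bound at a small real q; once it vanishes, q divides p
    and the exponent drops by one. *)
Lemma jet_zero_coef n p (K : R) :
  (forall q, 0 < cabs q -> cabs q <= 1 / 2 -> cabs p.[q] <= K * cabs q ^+ n) ->
  forall i, (i < n)%N -> p`_i = 0.
Proof.
elim: n p => // n IH p h.
pose s := drop_poly 1 p.
have pE : p = (p`_0)%:P + s * 'X.
  rewrite -{1}(poly_take_drop 1 p) expr1; congr (_ + _).
  by apply/polyP => i; rewrite coef_take_poly coefC; case: i.
have [L L0 hL] := poly_bound_half s.
have p0 : p`_0 = 0.
  apply/eqP; apply: contraT => nz; have a0 : 0 < cabs p`_0 by rewrite cabs_gt0.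
  have K0 : 0 <= K.
    have q2 : cabs ((1 / 2)%:C : C) = 1 / 2 by rewrite cabs_real ger0_norm; lra.
    have := h (1 / 2)%:C; rewrite q2 => /(_ ltac:(lra) (lexx _)) h2.
    have : 0 <= K * (1 / 2) ^+ n.+1 by apply: le_trans h2; exact: cabs_ge0.
    by rewrite pmulr_lge0// exprn_gt0; lra.
  pose x := Num.min (1 / 2) (cabs p`_0 / (2 * (K + L))).
  have KL : 0 < K + L by lra.
  have x0 : 0 < x by rewrite lt_min !divr_gt0// mulr_gt0.
  have xx : cabs (x%:C : C) = x by rewrite cabs_real ger0_norm ?(ltW x0).
  have x2 : x <= 1 / 2 by rewrite ge_min lexx.
  have xa : x <= cabs p`_0 / (2 * (K + L)) by rewrite ge_min lexx orbT.
  have h1 := h x%:C; rewrite xx in h1; have {}h1 := h1 x0 x2.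
  have h2 := hL x%:C; rewrite xx in h2; have {}h2 := h2 x2.
  move: h1; rewrite {1}pE hornerD hornerM hornerX hornerC => h1.
  have h3 := cabs_addl p`_0 (s.[x%:C] * x%:C); rewrite cabsM xx in h3.
  have h4 : cabs s.[x%:C] * x <= L * x by rewrite ler_wpM2r ?(ltW x0).
  have h5 : K * x ^+ n.+1 <= K * x.
    rewrite ler_wpM2l// exprS ler_piMr ?(ltW x0)// exprn_ile1 ?(ltW x0)//; lra.
  have h6 : x * (2 * (K + L)) <= cabs p`_0 by rewrite -ler_pdivlMr// mulr_gt0.
  clear -a0 h1 h3 h4 h5 h6; clearbody x.
  move: (cabs p`_0) (cabs (_ + _)) (cabs _.[_]) (x ^+ _) a0 h1 h3 h4 h5 h6 => c d e y; lra.
move=> [|i]; first by rewrite p0.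
rewrite ltnS => hi; rewrite -[i.+1]addn1 -coef_drop_poly; apply: IH hi => q q0 hq.
have := h q q0 hq; rewrite {1}pE p0 add0r hornerM hornerX cabsM exprSr mulrA.
by rewrite ler_pM2r.
Qed.

Lemma jet_unique F p s n : jet F p n -> jet F s n -> forall i, (i < n)%N -> p`_i = s`_i.
Proof.
move=> [K K0 hK] [L L0 hL] i hi; apply/eqP; rewrite -subr_eq0 -coefB; apply/eqP.
apply: (@jet_zero_coef n (p - s) (K + L)) hi => q q0 hq.
rewrite hornerD hornerN (_ : p.[q] - s.[q] = (F q - s.[q]) - (F q - p.[q])); last by ring.
apply: (le_trans (cabsB _ _)); rewrite mulrDl addrC; apply: lerD; [exact: hK|exact: hL].
Qed.

Lemma jet_shift F p n m : jet F p n -> jet (fun q => q ^+ m * F q) ('X^m * p) (m + n).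
Proof.
move=> [K K0 hK]; exists K => // q q0 hq.
rewrite hornerM hornerXn -mulrBr cabsM cabsX exprD mulrCA ler_wpM2l ?exprn_ge0 ?cabs_ge0//.
exact: hK.
Qed.

Lemma jet_unshift F p n m : jet F ('X^m * p) (m + n) -> jet (fun q => F q / q ^+ m) p n.
Proof.
move=> [K K0 hK]; exists K => // q q0 hq.
have qm : 0 < cabs q ^+ m by rewrite exprn_gt0.
have qn : q ^+ m != 0 by rewrite -cabs_gt0 cabsX.
have := hK q q0 hq; rewrite hornerM hornerXn exprD.
rewrite (_ : F q - q ^+ m * p.[q] = q ^+ m * (F q / q ^+ m - p.[q])).
  by rewrite cabsM cabsX mulrCA ler_pM2l.
by rewrite mulrBr mulrCA divff// mulr1.
Qed.

Lemma jetB F G p s n : jet F p n -> jet G s n -> jet (fun q => F q - G q) (p - s) n.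
Proof.
move=> hF hG; have := jetD hF (jetZ (-1) hG); rewrite scaleN1r.
by congr jet; apply/funext => q; rewrite mulN1r.
Qed.

(** Used in [sturm14], which reads off one coefficient beyond the known order of vanishing. *)
Definition alljets F := forall n, exists p, jet F p n.

Lemma alljets_pser c : tame c -> alljets (pser c).
Proof. by move=> hc n; eexists; exact: jet_pser. Qed.

Lemma alljets_cst a : alljets (fun=> a).
Proof.
move=> n; exists a%:P; have := jet_poly a%:P n; congr jet.
by apply/funext => q; rewrite hornerC.
Qed.

Lemma alljetsD F G : alljets F -> alljets G -> alljets (fun q => F q + G q).
Proof. by move=> hF hG n; have [p hp] := hF n; have [s hs] := hG n; exists (p + s); exact: jetD. Qed.

Lemma alljetsB F G : alljets F -> alljets G -> alljets (fun q => F q - G q).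
Proof. by move=> hF hG n; have [p hp] := hF n; have [s hs] := hG n; exists (p - s); exact: jetB. Qed.

Lemma alljetsM F G : alljets F -> alljets G -> alljets (fun q => F q * G q).
Proof. by move=> hF hG n; have [p hp] := hF n; have [s hs] := hG n; exists (p * s); exact: jetM. Qed.

Lemma alljetsX F m : alljets F -> alljets (fun q => F q ^+ m).
Proof. by move=> hF n; have [p hp] := hF n; exists (p ^+ m); exact: jetX. Qed.

Lemma alljetsZ F a : alljets F -> alljets (fun q => a * F q).
Proof. by move=> hF n; have [p hp] := hF n; exists (a *: p); exact: jetZ. Qed.

Lemma alljets_sum (I : Type) (r : seq I) (F : I -> C -> C) :
  (forall i, alljets (F i)) -> alljets (fun q => \sum_(i <- r) F i q).
Proof.
move=> h; elim: r => [|i r IH].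
  by have := alljets_cst 0; congr alljets; apply/funext => q; rewrite big_nil.
by have := alljetsD (h i) IH; congr alljets; apply/funext => q; rewrite big_cons.
Qed.

Definition E4p n : {poly C} := 1 + 240 *: \poly_(i < n) sigc R 3 i.
Definition E6p n : {poly C} := 1 - 504 *: \poly_(i < n) sigc R 5 i.
Definition Dp n : {poly C} := (12 ^+ 3)^-1 *: (E4p n ^+ 3 - E6p n ^+ 2).

Lemma jet_E4 n : jet (@E4q R) (E4p n) n.
Proof.
have := jetD (jet_poly 1 n) (jetZ 240 (jet_pser n (@tame_sigc R 3))).
by apply: jet_ext => q _ _; rewrite hornerC E4qE.
Qed.

Lemma jet_E6 n : jet (@E6q R) (E6p n) n.
Proof.
have := jetB (jet_poly 1 n) (jetZ 504 (jet_pser n (@tame_sigc R 5))).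
by apply: jet_ext => q _ _; rewrite hornerC E6qE.
Qed.

Lemma jet_D n : jet (@Dq R) (Dp n) n.
Proof.
have := jetZ (12 ^+ 3)^-1 (jetB (jetX 3 (jet_E4 n)) (jetX 2 (jet_E6 n))).
by apply: jet_ext => q _ _; rewrite /Dq mulrC.
Qed.

Lemma E4p_coef0 n : (E4p n)`_0 = 1.
Proof. by rewrite coefD coefZ coef_poly coef1 /sigc if_same mulr0 addr0. Qed.

Lemma E6p_coef0 n : (E6p n)`_0 = 1.
Proof. by rewrite coefB coefZ coef_poly coef1 /sigc if_same mulr0 subr0. Qed.

Lemma Dp_coef n : [/\ (Dp n)`_0 = 0, (Dp n.+2)`_1 = 1 & (Dp n.+3)`_2 = -24].
Proof.
have [v31 v32 v51 v52] := sigma_values.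
have a0 := E4p_coef0; have b0 := E6p_coef0.
have a1 m : (E4p m.+2)`_1 = 240 by rewrite coefD coefZ coef_poly coef1 /sigc v31 /= add0r mulr1.
have b1 m : (E6p m.+2)`_1 = -504 by rewrite coefB coefZ coef_poly coef1 /sigc v51 /= sub0r mulr1.
have a2 m : (E4p m.+3)`_2 = 240 * 9 by rewrite coefD coefZ coef_poly coef1 /sigc v32 /= add0r.
have b2 m : (E6p m.+3)`_2 = - (504 * 33) by rewrite coefB coefZ coef_poly coef1 /sigc v52 /= sub0r.
rewrite !coefZ !coefB !exprS expr0 !mulr1 !coefM !big_ord_recl !big_ord0 /= !coefM !big_ord_recl !big_ord0 /= /bump /=.
rewrite !(a0, b0, a1, b1, a2, b2).
have t0 : 24 != 0 :> C by rewrite pnatr_eq0.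
have -> : 240 = 10 * 24 :> C by rewrite -natrM.
have -> : 504 = 21 * 24 :> C by rewrite -natrM.
split; by field.
Qed.

End Jets.

(** * Vanishing in weight 12 m + 2 and identification of Eisenstein series *)

Section LevelOneForms.
Variable R : realType.
Local Notation C := R[i].
Implicit Types (F G : C -> C) (q tau u : C) (p s : {poly C}).

(** The series 1 - 24 q + ... of Delta / q. At q = 0 the division returns 0, which jets do not
    see. *)
Definition Vq q : C := Dq q / q.

Lemma jet_Vq n : exists2 p : {poly C}, jet Vq p n & p`_0 = 1 /\ ((1 < n)%N -> p`_1 = - 24).
Proof.
have [d0 d1 d2] := Dp_coef R n; exists (drop_poly 1 (Dp R n.+3)).
  apply: (@jet_le _ _ _ n.+2) => //; first by rewrite leqW.
  have h : jet (@Dq R) ('X^1 * drop_poly 1 (Dp R n.+3)) (1 + n.+2); last first.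
    by have := jet_unshift h; congr jet; apply/funext => q; rewrite expr1.
  rewrite expr1 mulrC; apply: jet_trunc (jet_D R n.+3) => i _.
  rewrite coefMX; case: i => [|i] /=; last by rewrite coef_drop_poly addn1.
  by have [-> _ _] := Dp_coef R n.+3.
by rewrite !coef_drop_poly; have [_ -> _] := Dp_coef R n.+1.
Qed.

Lemma nome_upper tau : cabs (nome tau) < 1 -> 0 < complex.Im tau.
Proof.
rewrite cabs_nome expR_lt1 oppr_lt0 pmulr_rgt0// mulr_gt0// pi_gt0//.
Qed.

Lemma jet_vanish F n : (forall tau, 0 < complex.Im tau -> F (nome tau) = 0) -> jet F 0 n.
Proof.
move=> h; have := jet_poly (0 : {poly C}) n; apply: jet_ext => q q0 hq.
have [|tau [_ _ hn]] := @nome_surj R q; first by rewrite -cabs_gt0.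
by rewrite horner0 -hn h// nome_upper// hn; lra.
Qed.

(* By the Sturm bound F^2 and F^3 are multiples of E_4 and E_6 times powers of
   Delta; if F were nonzero, E_4^3 and E_6^2 would be proportional. *)
Lemma sturm14 F m : smooth2 F -> modq (12 * m + 2) F -> alljets F -> jet F 0 m ->
  forall tau, 0 < complex.Im tau -> F (nome tau) = 0.
Proof.
move=> sF mF aF jF.
have [p hp] := aF m.+1.
have pz i : (i < m)%N -> p`_i = 0.
  by move=> hi; rewrite (jet_unique (jet_le (leqnSn m) hp) jF hi) coef0.
(* The candidate leading coefficient of F, to be shown zero. *)
set g := p`_m.
have jT : jet (fun q => F q / q ^+ m) g%:P 1.
  apply: jet_unshift; rewrite addn1; apply: jet_trunc hp => i hi.
  rewrite mulrC coefMXn coefC; case: ltngtP => him; first exact: pz.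
    by move: hi; rewrite ltnS leqNgt him.
  by rewrite him subnn.
have [v jV [v0 _]] := jet_Vq 1.
have {v v0}jV : jet Vq 1 1.
  by apply: jet_trunc jV => -[|//] _; rewrite v0 coef1.
have j4 : jet (@E4q R) 1 1.
  by apply: jet_trunc (jet_E4 R 1) => -[|//] _; rewrite E4p_coef0 coef1.
have j6 : jet (@E6q R) 1 1.
  by apply: jet_trunc (jet_E6 R 1) => -[|//] _; rewrite E6p_coef0 coef1.
(* F^n and g^n E Delta^(m n) share the coefficient of q^(m n), so their difference vanishes to order
   m n + 1; the weight then leaves 2 v = 12 - e > 0. *)
have key (E : C -> C) e n v : smooth2 E -> modq e E -> jet E 1 1 -> (0 < v)%N ->
   ((12 * m + 2) * n = e + 12 * (m * n))%N -> (e + v.*2 = 12)%N ->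
   forall tau, 0 < complex.Im tau -> F (nome tau) ^+ n = g ^+ n * (E (nome tau) * Dq (nome tau) ^+ (m * n)).
  move=> sE mE jE v0 he hv tau y0; apply/eqP; rewrite -subr_eq0; apply/eqP.
  pose G q := F q ^+ n - g ^+ n * (E q * Dq q ^+ (m * n)).
  apply: (@sturm R G ((12 * m + 2) * n) (m * n).+1 v _ _ _ v0 _ tau y0).
  - by apply: smooth2B; [exact: smooth2X|apply/smooth2Z/smooth2M => //; apply/smooth2X/smooth2_D].
  - apply: modqB; first exact: modqX.
    by rewrite he; apply/modqZ/modqM => //; apply/modqX/modq_D.
  - rewrite he; lia.
  have := jet_shift (m * n) (jetB (jetX n jT) (jetZ (g ^+ n) (jetM jE (jetX (m * n) jV)))).
  rewrite expr1n mulr1 addn1 (_ : _ * (_ - _) = 0).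
    apply: jet_ext => q q0 _; have qn0 : q ^+ (m * n) != 0 by rewrite expf_neq0// -cabs_gt0.
    rewrite /G /Vq expr_div_n -exprM [(Dq q / q) ^+ _]expr_div_n.
    move: (F q ^+ n) (E q) (Dq q ^+ _) (q ^+ _) qn0 => a b c d d0; by field.
  by rewrite -polyC_exp alg_polyC subrr mulr0.
move=> tau y0.
have h2 := key _ 4%N 2%N 4%N (@smooth2_E4 R) (@modq_E4 R) j4 isT ltac:(lia) ltac:(lia) tau y0.
have h3 := key _ 6%N 3%N 3%N (@smooth2_E6 R) (@modq_E6 R) j6 isT ltac:(lia) ltac:(lia) tau y0.
have D0 := Dq_neq0 y0.
have hD : E4q (nome tau) ^+ 3 - E6q (nome tau) ^+ 2 = 12 ^+ 3 * Dq (nome tau).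
  by rewrite /Dq mulrC divfK// expf_neq0// pnatr_eq0.
move: (F _) (E4q _) (E6q _) (Dq _) D0 hD h2 h3 => f a b d d0 hD h2 h3.
have g0 : g = 0.
  apply/eqP; apply: contraT => gn; have : g ^+ 6 * (a ^+ 3 - b ^+ 2) * d ^+ (m * 6) = 0.
    have gen (x y z : C) n : (x * (y * z)) ^+ n = x ^+ n * y ^+ n * z ^+ n by rewrite !exprMn mulrA.
    have e1 : f ^+ 6 = g ^+ 6 * a ^+ 3 * d ^+ (m * 6).
      by rewrite (exprM f 2 3) h2 gen -!exprM -mulnA.
    have e2 : f ^+ 6 = g ^+ 6 * b ^+ 2 * d ^+ (m * 6).
      by rewrite (exprM f 3 2) h3 gen -!exprM -mulnA.
    by rewrite mulrBr mulrBl -e1 -e2 subrr.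
  by move/eqP; rewrite hD !mulf_eq0 !expf_eq0 /= (negPf gn) (negPf d0) pnatr_eq0 !andbF.
by apply/eqP; move/eqP: h2; rewrite g0 expr0n mul0r expf_eq0.
Qed.

(** Subtracting z G, with z the constant term of [eisq k], leaves a form without constant term,
    hence zero; the coefficient of q then gives z b = 1. No zeta value enters for these weights. *)
Lemma eisenstein_span k b G : ~~ odd k -> (0 < k)%N -> smooth2 G -> modq k.+2 G ->
  alljets G -> jet G (1 + b *: 'X) 2 -> b != 0 ->
  (forall F, smooth2 F -> modq k.+2 F -> alljets F -> jet F 0 1 ->
     forall tau, 0 < complex.Im tau -> F (nome tau) = 0) ->
  forall tau, 0 < complex.Im tau -> 1 + b * pser (sigc R k.+1) (nome tau) = G (nome tau).
Proof.
move=> ek k0 sG mG aG jG b0 st tau y0.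
pose z := zetac R k.+2 / lipc R k.+1.
pose F q := eisq k q - z * G q.
have jE : jet (eisq k) (z%:P + 'X) 2.
  have := jetD (jet_poly z%:P 2) (jet_pser 2 (@tame_sigc R k.+1)).
  move/jet_trunc => /(_ (z%:P + 'X)); move=> h.
  have : jet (fun q => z%:P.[q] + pser (sigc R k.+1) q) (z%:P + 'X) 2.
    apply: h => -[|[|//]] _; rewrite !coefD coefC coef_poly coefX /sigc //=.
    by rewrite /sigma big_seq1 exp1n.
  by apply: jet_ext => q _ _; rewrite hornerC.
have jF : jet F ((1 - z * b) *: 'X) 2.
  have := jetB jE (jetZ z jG); congr jet.
  by rewrite -alg_polyC scalerDr scalerA scalerBl scale1r opprD addrACA subrr add0r.
have v : forall tau, 0 < complex.Im tau -> F (nome tau) = 0.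
  apply: st.
  - by apply: smooth2B; [exact: smooth2_eisq|exact: smooth2Z].
  - by apply: modqB; [exact: modq_eisq|exact: modqZ].
  - apply: alljetsB; last exact: alljetsZ.
    by apply: alljetsD; [exact: alljets_cst|exact/alljets_pser/tame_sigc].
  - by apply: jet_trunc (jet_le (leqnSn 1) jF) => -[|//] _; rewrite coefZ coefX mulr0 coef0.
have zb : z * b = 1.
  have := @jet_unique R F _ _ 2 jF (jet_vanish 2 v) 1%N isT.
  by rewrite coefZ coefX mulr1 coef0 => /eqP; rewrite subr_eq0 => /eqP.
have := v tau y0; rewrite /F /eisq -/z => /eqP; rewrite subr_eq0 => /eqP h.
move: (pser _ _) (G _) h => S g h.
have -> : g = b * (z * g) by rewrite mulrA [b * z]mulrC zb mul1r.
by rewrite -h mulrDr [b * z]mulrC zb.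
Qed.

End LevelOneForms.

(** * Bernoulli numbers *)

Lemma size_bernoulli_upto m : size (bernoulli_upto m) = m.
Proof. by elim: m => //= m IH; rewrite size_rcons IH. Qed.

(** A proposed value is verified against the recurrence multiplied by m + 1, so that only binomial
    coefficients are evaluated. *)
Lemma bernoulli_step m s bs (v : rat) : bernoulli_upto m = s ->
  [seq 'C(m.+1, j) | j <- iota 0 m] = bs ->
  \sum_(p <- zip bs s) p.1%:R * p.2 + m.+1%:R * v = (m == 0%N)%:R ->
  bernoulli_upto m.+1 = rcons s v.
Proof.
move=> hs hb h; have sz : size s = m by rewrite -hs size_bernoulli_upto.
rewrite [LHS]/= hs; congr rcons; rewrite -h.
have -> : \sum_(p <- zip bs s) p.1%:R * p.2 = \sum_(j < m) 'C(m.+1, j)%:R * s`_j :> rat.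
  rewrite (big_nth (0%N, 0)) size_zip -hb size_map size_iota sz minnn big_mkord.
  apply: eq_bigr => j _; rewrite nth_zip ?size_map ?size_iota ?sz//= (nth_map 0%N) ?size_iota//.
  by rewrite nth_iota.
by rewrite addrC addKr mulrC mulKf// pnatr_eq0.
Qed.

Ltac bern_step H := refine (bernoulli_step H _ _);
  [vm_compute; reflexivity | rewrite /= ?big_cons big_nil /=; by field].

Lemma bernoulli_values : [/\ bernoulli 4 = - (30^-1), bernoulli 6 = 42^-1, bernoulli 8 = - (30^-1),
  bernoulli 10 = 5 / 66 & bernoulli 14 = 7 / 6].
Proof.
have b0 : bernoulli_upto 0 = [::] by [].
have b1 : bernoulli_upto 1 = [:: 1] by bern_step b0.
have b2 : bernoulli_upto 2 = [:: 1; - (2^-1)] by bern_step b1.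
have b3 : bernoulli_upto 3 = [:: 1; - (2^-1); 6^-1] by bern_step b2.
have b4 : bernoulli_upto 4 = [:: 1; - (2^-1); 6^-1; 0] by bern_step b3.
have b5 : bernoulli_upto 5 = [:: 1; - (2^-1); 6^-1; 0; - (30^-1)] by bern_step b4.
have b6 : bernoulli_upto 6 = [:: 1; - (2^-1); 6^-1; 0; - (30^-1); 0] by bern_step b5.
have b7 : bernoulli_upto 7 = [:: 1; - (2^-1); 6^-1; 0; - (30^-1); 0; 42^-1] by bern_step b6.
have b8 : bernoulli_upto 8 = [:: 1; - (2^-1); 6^-1; 0; - (30^-1); 0; 42^-1; 0] by bern_step b7.
have b9 : bernoulli_upto 9 = [:: 1; - (2^-1); 6^-1; 0; - (30^-1); 0; 42^-1; 0; - (30^-1)] by bern_step b8.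
have b10 : bernoulli_upto 10 = [:: 1; - (2^-1); 6^-1; 0; - (30^-1); 0; 42^-1; 0; - (30^-1); 0] by bern_step b9.
have b11 : bernoulli_upto 11 = [:: 1; - (2^-1); 6^-1; 0; - (30^-1); 0; 42^-1; 0; - (30^-1); 0; 5 / 66] by bern_step b10.
have b12 : bernoulli_upto 12 = [:: 1; - (2^-1); 6^-1; 0; - (30^-1); 0; 42^-1; 0; - (30^-1); 0; 5 / 66; 0] by bern_step b11.
have b13 : bernoulli_upto 13 = [:: 1; - (2^-1); 6^-1; 0; - (30^-1); 0; 42^-1; 0; - (30^-1); 0; 5 / 66; 0; - (691 / 2730)] by bern_step b12.
have b14 : bernoulli_upto 14 = [:: 1; - (2^-1); 6^-1; 0; - (30^-1); 0; 42^-1; 0; - (30^-1); 0; 5 / 66; 0; - (691 / 2730); 0] by bern_step b13.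
have b15 : bernoulli_upto 15 = [:: 1; - (2^-1); 6^-1; 0; - (30^-1); 0; 42^-1; 0; - (30^-1); 0; 5 / 66; 0; - (691 / 2730); 0; 7 / 6] by bern_step b14.
have val m (s : seq rat) : bernoulli_upto m.+1 = s -> bernoulli m = s`_m by move=> <-.
split; [exact: val b5|exact: val b7|exact: val b9|exact: val b11|exact: val b15].
Qed.

(** * Eisenstein series of weight k' as products of E_4 and E_6 *)

Section EisensteinForms.
Variable R : realType.
Local Notation C := R[i].
Implicit Types (F G : C -> C) (q tau u : C) (p s : {poly C}).

(* E_k = E_4^(e4 k) E_6^(e6 k) for k = 0, 4, 6, 8, 10, 14. *)
Definition e4 (k : nat) : nat := if k \in [:: 4; 10]%N then 1 else if k \in [:: 8; 14]%N then 2 else 0.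
Definition e6 (k : nat) : nat := k \in [:: 6; 10; 14]%N.

Definition ekq k q : C := E4q q ^+ e4 k * E6q q ^+ e6 k.

Lemma smooth2_ekq k : smooth2 (ekq k).
Proof. apply: smooth2M; apply: smooth2X; [exact: smooth2_E4|exact: smooth2_E6]. Qed.

Lemma modq_ekq k : k \in [:: 0; 4; 6; 8; 10; 14]%N -> modq k (ekq k).
Proof.
have h := modqM (modqX (e4 k) (@modq_E4 R)) (modqX (e6 k) (@modq_E6 R)).
rewrite !inE => hk; suff e : (4 * e4 k + 6 * e6 k = k)%N by rewrite e in h.
by case/or4P: hk => [/eqP->|/eqP->|/eqP->|/orP[/eqP->|/orP[/eqP->|/eqP->]]].
Qed.

Definition ekp k n : {poly C} := E4p R n ^+ e4 k * E6p R n ^+ e6 k.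

Lemma jet_ekq k n : jet (ekq k) (ekp k n) n.
Proof. by apply: jetM; apply: jetX; [exact: jet_E4|exact: jet_E6]. Qed.

Lemma coef0X p n : (p ^+ n)`_0 = p`_0 ^+ n.
Proof. by rewrite -!horner_coef0 horner_exp. Qed.

Lemma ekp_coef0 k n : (ekp k n)`_0 = 1.
Proof. by rewrite coef0M !coef0X E4p_coef0 E6p_coef0 !expr1n mulr1. Qed.

Lemma alljets_ekq k : alljets (ekq k).
Proof. by move=> n; exists (ekp k n); exact: jet_ekq. Qed.

Lemma coef1X p n : p`_0 = 1 -> (p ^+ n)`_1 = n%:R * p`_1.
Proof.
move=> h; elim: n => [|n IH]; first by rewrite expr0 coef1 mul0r.
by rewrite exprS coefM !big_ord_recl big_ord0 /= coef0X h IH expr1n -natr1; ring.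
Qed.

Lemma jet_ekq1 k : jet (ekq k) (1 + (240 * (e4 k)%:R - 504 * (e6 k)%:R) *: 'X) 2.
Proof.
have [v31 v32 v51 v52] := sigma_values.
have a1 : (E4p R 2)`_1 = 240 by rewrite coefD coefZ coef_poly coef1 /sigc v31 /= add0r mulr1.
have b1 : (E6p R 2)`_1 = -504 by rewrite coefB coefZ coef_poly coef1 /sigc v51 /= sub0r mulr1.
apply: jet_trunc (jet_ekq k 2) => -[|[|//]] _; rewrite coefD coefZ coef1 coefX /= ?mulr0 ?addr0.
  exact: ekp_coef0.
rewrite coefM !big_ord_recl big_ord0 /= !coef0X !coef1X ?E4p_coef0 ?E6p_coef0// !expr1n a1 b1.
by move: (_%:R) (_%:R) => x y; rewrite /=; ring.
Qed.

Lemma pser_affine (c d : nat -> C) b q : tame d -> cabs q < 1 ->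
  c 0%N = 1 -> d 0%N = 0 -> (forall n, c n.+1 = b * d n.+1) -> pser c q = 1 + b * pser d q.
Proof.
move=> hd q1 c0 d0 h; apply: climP_csum.
have := climD (clim_cst 1) (climZ b (pserP hd q1)).
apply: (clim_eq (N := 1%N)) => -[//|n] _.
rewrite mulr_sumr !big_ord_recl d0 mul0r mulr0 add0r c0 mul1r expr0; congr (_ + _).
by apply: eq_bigr => i _; rewrite h mulrA.
Qed.

(** In weights 4 and 6 the coefficients are compared directly. In weights 8, 10 and 14 forms without
    constant term vanish, by [sturm] with weight + 2 v = 12 or by [sturm14] with m = 1, and
    [eisenstein_span] applies. *)
Lemma eisensteinE k tau : k \in [:: 0; 4; 6; 8; 10; 14]%N -> 0 < complex.Im tau ->
  eisenstein k tau = ekq k (nome tau).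
Proof.
move=> hk y0; have q1 := cabs_nome_lt1 y0.
have aff k' (b : C) : - ((2 * k'.+2)%:R / ratr (bernoulli k'.+2)) = b ->
    eisenstein k'.+2 tau = 1 + b * pser (sigc R k'.+1) (nome tau).
  move=> hb; apply: (@pser_affine (eisenstein_coef R k'.+2)) => //; first exact: tame_sigc.
  by move=> n; rewrite /eisenstein_coef /= hb.
have [B4 B6 B8 B10 B14] := bernoulli_values.
have small k' F : ~~ odd k' -> (0 < k' <= 8)%N -> smooth2 F -> modq k'.+2 F -> alljets F -> jet F 0 1 ->
     forall tau, 0 < complex.Im tau -> F (nome tau) = 0.
  move=> ok' hk' sF mF aF jF; apply: (@sturm R F k'.+2 1 (10 - k')./2 sF mF _ _ jF).
    have := odd_double_half (10 - k'); rewrite oddB; last by lia.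
    by rewrite (negPf ok') /=; lia.
  by rewrite half_gt0; lia.
have span k' (b : C) : ~~ odd k' -> (0 < k')%N -> k'.+2 \in [:: 0; 4; 6; 8; 10; 14]%N ->
    240 * (e4 k'.+2)%:R - 504 * (e6 k'.+2)%:R = b -> b != 0 ->
    - ((2 * k'.+2)%:R / ratr (bernoulli k'.+2)) = b ->
    (forall F, smooth2 F -> modq k'.+2 F -> alljets F -> jet F 0 1 ->
     forall tau, 0 < complex.Im tau -> F (nome tau) = 0) -> 
    eisenstein k'.+2 tau = ekq k'.+2 (nome tau).
  move=> ok' k0 hk' hb b0 hB hs; rewrite (aff _ _ hB).
  have hj : jet (ekq k'.+2) (1 + b *: 'X) 2 by rewrite -hb; exact: jet_ekq1.
  exact: (@eisenstein_span R k' b (ekq k'.+2) ok' k0 (smooth2_ekq k'.+2) (modq_ekq hk')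
    (alljets_ekq k'.+2) hj b0 hs tau y0).
have nz n : n.+1%:R != 0 :> C by rewrite pnatr_eq0.
move: hk; rewrite !inE => /or4P[/eqP->|/eqP->|/eqP->|/orP[/eqP->|/orP[/eqP->|/eqP->]]].
- rewrite /ekq /= !expr0 mulr1; apply: climP_csum.
  apply: (clim_eq (N := 1%N)) (clim_cst 1) => -[//|n] _.
  rewrite big_ord_recl big1 => [|i _].
    by rewrite addr0 expr0 mulr1 /eisenstein_coef eqxx.
  by rewrite /eisenstein_coef /= muln0 mul0r oppr0 !mul0r.
- have c : - ((2 * 4)%:R / ratr (bernoulli 4)) = 240 :> C.
    by rewrite B4 rmorphN fmorphV /= ratr_nat; field.
  have a : e4 4 = 1%N by []. have b : e6 4 = 0%N by [].
  by rewrite (aff 2%N _ c) /ekq a b expr1 expr0 mulr1 E4qE.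
- have c : - ((2 * 6)%:R / ratr (bernoulli 6)) = - 504 :> C.
    by rewrite B6 fmorphV /= ratr_nat; field.
  have a : e4 6 = 0%N by []. have b : e6 6 = 1%N by [].
  by rewrite (aff 4%N _ c) /ekq a b expr1 expr0 mul1r E6qE mulNr.
- have ha8 : e4 8 = 2%N by []. have hb8 : e6 8 = 0%N by [].
  have c : - ((2 * 8)%:R / ratr (bernoulli 8)) = 480 :> C.
    by rewrite B8 rmorphN fmorphV /= ratr_nat; field.
  apply: (span 6%N 480 isT isT isT _ (nz _) c (fun F => small 6%N F isT isT)).
  rewrite ha8 hb8; clear; ring.
- have ha10 : e4 10 = 1%N by []. have hb10 : e6 10 = 1%N by [].
  have c : - ((2 * 10)%:R / ratr (bernoulli 10)) = - 264 :> C.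
    by rewrite B10 fmorph_div /= !ratr_nat; field.
  apply: (span 8%N (- 264) isT isT isT _ _ c (fun F => small 8%N F isT isT)).
    rewrite ha10 hb10; clear; ring.
  by rewrite oppr_eq0.
- have ha14 : e4 14 = 2%N by []. have hb14 : e6 14 = 1%N by [].
  have c : - ((2 * 14)%:R / ratr (bernoulli 14)) = - 24 :> C.
    by rewrite B14 fmorph_div /= !ratr_nat; field.
  apply: (span 12%N (- 24) isT isT isT _ _ c (fun F => @sturm14 R F 1%N)).
    rewrite ha14 hb14; clear; ring.
  by rewrite oppr_eq0.
Qed.

End EisensteinForms.

(** * Factorization of the cusp form *)

Section ScaledCoefficients.
Variable R : realType.
Local Notation C := R[i].
Implicit Types (p V P U : {poly C}).

Lemma ffact_prod (N j : nat) : (N ^_ j)%:R = \prod_(i < j) (N%:R - i%:R) :> C.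
Proof.
elim: j => [|j IH]; first by rewrite ffactn0 big_ord0.
rewrite ffactnSr natrM big_ord_recr /= -IH.
have [h|h] := leqP j N; first by rewrite natrB.
by rewrite ffact_small// !mul0r.
Qed.

(** The quotient is 1/j! times j factors 24 (N - i) / s, each of them 1 + O(1/s) because s - 24 N is
    bounded. *)
Lemma binomial_scaled (A : R) j : 0 <= A -> exists2 K : R, 0 < K & forall N s : nat, (0 < s)%N ->
  `|s%:R - 24 * N%:R| <= A ->
  cabs (24 ^+ j * 'C(N, j)%:R / s%:R ^+ j - (j`!%:R)^-1) <= K / s%:R.
Proof.
move=> A0.
have [K K0 hK] : exists2 K : R, 0 < K & forall N s : nat, (0 < s)%N -> `|s%:R - 24 * N%:R| <= A ->
    cabs (\prod_(i < j) (24 * (N%:R - i%:R) / s%:R) - 1) <= K / s%:R.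
  elim: j => [|j [K K0 IH]].
    by exists 1 => // N s s0 _; rewrite big_ord0 subrr cabs0 divr_ge0.
  have B0 : 0 <= A + 24 * j%:R by rewrite addr_ge0// mulr_ge0.
  exists (K * (1 + (A + 24 * j%:R)) + (A + 24 * j%:R) + 1).
    by rewrite ltr_wpDl// addr_ge0// mulr_ge0 ?(ltW K0)//; lra.
  move=> N s s0 hs; rewrite big_ord_recr /=.
  have {}IH := IH N s s0 hs; set P := \prod_(i < j) _ in IH *.
  have S0 : 0 < s%:R :> R by rewrite ltr0n.
  have S1 : 1 <= s%:R :> R by rewrite ler1n.
  have SC : s%:R != 0 :> C by rewrite pnatr_eq0 -lt0n.
  set f := _ / s%:R.
  have hf : cabs (f - 1) <= (A + 24 * j%:R) / s%:R.
    have -> : f - 1 = - ((s%:R - 24 * N%:R + 24 * j%:R) / s%:R) by rewrite /f; field.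
    rewrite cabsN cabsM cabsV cabs_nat ler_wpM2r ?invr_ge0 ?(ltW S0)//.
    apply: (le_trans (cabsD _ _)); rewrite cabsM !cabs_nat lerD2r.
    have -> : s%:R - 24 * N%:R = ((s%:R - 24 * N%:R : R)%:C) :> C.
      by rewrite rmorphB rmorphM !rmorph_nat.
    by rewrite cabs_real.
  have hf1 : cabs f <= 1 + (A + 24 * j%:R).
    rewrite -(subrK 1 f) addrC; apply: (le_trans (cabsD _ _)); rewrite cabs1 lerD2l.
    by apply: (le_trans hf); rewrite ler_pdivrMr// ler_peMr.
  have -> : P * f - 1 = (P - 1) * f + (f - 1) by ring.
  apply: (le_trans (cabsD _ _)); rewrite cabsM.
  have h1 : cabs (P - 1) * cabs f <= K / s%:R * (1 + (A + 24 * j%:R)) by rewrite ler_pM ?cabs_ge0.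
  apply: (le_trans (lerD h1 hf)).
  rewrite mulrAC -mulrDl ler_wpM2r ?invr_ge0 ?(ltW S0)//; lra.
exists K => // N s s0 hs.
have j0 : j`!%:R != 0 :> C by rewrite pnatr_eq0 -lt0n fact_gt0.
have -> : 24 ^+ j * 'C(N, j)%:R / s%:R ^+ j - (j`!%:R)^-1 =
    (j`!%:R)^-1 * (\prod_(i < j) (24 * (N%:R - i%:R) / s%:R) - 1) :> C.
  rewrite mulrBr mulr1; congr (_ - _).
  under eq_bigr do rewrite mulrAC.
  rewrite big_split /= prodr_const card_ord -ffact_prod -bin_ffact natrM exprMn exprVn.
  by rewrite [RHS]mulrC [(_ / _) * _ in RHS]mulrA mulfK// mulrAC.
rewrite cabsM cabsV cabs_nat; apply: le_trans (hK N s s0 hs).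
by rewrite ler_piMl ?cabs_ge0// invf_le1 ?ler1n ?ltr0n ?fact_gt0.
Qed.

Lemma sum_ord_cut (F : nat -> C) a b : (a <= b)%N -> (forall i, (a <= i)%N -> F i = 0) ->
  \sum_(i < b) F i = \sum_(i < a) F i.
Proof.
move=> ab h; rewrite -(subnKC ab) big_split_ord /= [X in _ + X]big1 ?addr0// => i _.
by rewrite h// leq_addr.
Qed.

Lemma coef_pow_one_plus U N j : ((1 + U * 'X) ^+ N)`_j =
  \sum_(i < j.+1) 'C(N, i)%:R * (U ^+ i)`_(j - i).
Proof.
pose F i := 'C(N, i)%:R * ((U ^+ i)`_(j - i) *+ (i <= j)%N).
transitivity (\sum_(i < N.+1) F i).
  rewrite exprDn coef_sum; apply: eq_bigr => i _.
  rewrite expr1n mul1r exprMn coefMn coefMXn /F mulr_natl ltnNge.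
  by case: leqP => _ /=; rewrite ?mulr1n ?mulr0n.
have hF1 i : (N.+1 <= i)%N -> F i = 0 by move=> h; rewrite /F bin_small// mul0r.
have hF2 i : (j.+1 <= i)%N -> F i = 0 by move=> h; rewrite /F leqNgt h mulr0n mulr0.
rewrite -(sum_ord_cut (leq_addr j.+1 N.+1) hF1) (sum_ord_cut (leq_addl N.+1 j.+1) hF2).
by apply: eq_bigr => i _; rewrite /F -ltnS ltn_ord mulr1n.
Qed.

(** In (1 + q U)^N the term C(N,i) U^i q^i has size N^i; after division by s^j only i = j survives,
    with U(0)^j = (- 24)^j. *)
Lemma coef_pow_scaled (A : R) V j : 0 <= A -> V`_0 = 1 -> V`_1 = - 24 ->
  exists2 K : R, 0 < K & forall N s : nat, (0 < s)%N -> `|s%:R - 24 * N%:R| <= A ->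
    cabs ((V ^+ N)`_j / s%:R ^+ j - (-1) ^+ j / j`!%:R) <= K / s%:R.
Proof.
move=> A0 v0 v1; pose U := drop_poly 1 V.
have VE : V = 1 + U * 'X.
  rewrite -{1}(poly_take_drop 1 V) expr1; congr (_ + _).
  by apply/polyP => i; rewrite coef_take_poly coef1; case: i.
have u0 : U`_0 = - 24 by rewrite coef_drop_poly.
have hb i : exists K : R, 0 < K /\ forall N s : nat, (0 < s)%N -> `|s%:R - 24 * N%:R| <= A ->
    cabs (24 ^+ i * 'C(N, i)%:R / s%:R ^+ i - (i`!%:R)^-1) <= K / s%:R.
  by have [K K0 hK] := binomial_scaled i A0; exists K.
have [K hK] := choice hb.
pose c i := cabs (U ^+ i)`_(j - i).
exists (K j + \sum_(i < j) (K i + 1) * c i).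
  rewrite ltr_wpDr ?(hK j).1//; apply: sumr_ge0 => i _.
  by rewrite mulr_ge0 ?cabs_ge0// addr_ge0// ltW// (hK i).1.
move=> N s s0 hs.
have S0 : 0 < s%:R :> R by rewrite ltr0n.
have S1 : 1 <= s%:R :> R by rewrite ler1n.
have SC : s%:R != 0 :> C by rewrite pnatr_eq0 -lt0n.
have p24 i : 24 ^+ i != 0 :> C by rewrite expf_neq0// pnatr_eq0.
have hbin i : (i < j)%N -> cabs ('C(N, i)%:R / s%:R ^+ j : C) <= (K i + 1) / s%:R.
  move=> ij; have [Ki0 /(_ N s s0 hs) h] := hK i.
  have h1 : cabs (24 ^+ i * 'C(N, i)%:R / s%:R ^+ i : C) <= K i + 1.
    rewrite -[X in cabs X](subrK (i`!%:R)^-1); apply: (le_trans (cabsD _ _)); apply: lerD.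
      by apply: (le_trans h); rewrite ler_pdivrMr// ler_peMr// ltW.
    by rewrite cabsV cabs_nat invf_le1 ?ler1n ?ltr0n ?fact_gt0.
  have -> : 'C(N, i)%:R / s%:R ^+ j =
     (24 ^+ i * 'C(N, i)%:R / s%:R ^+ i) * ((24 ^+ i)^-1 / s%:R ^+ (j - i)) :> C.
    have := p24 i; rewrite -{1}(subnK (ltnW ij)) exprD; move: (24 ^+ i) => t t0.
    have := expf_neq0 i SC; have := expf_neq0 (j - i) SC.
    by move: (_ ^+ (j - i)) (_ ^+ i) => x y x0 y0; field; rewrite t0 x0 y0.
  rewrite cabsM ler_pM ?cabs_ge0// cabsM !cabsV !cabsX !cabs_nat.
  apply: (@le_trans _ _ (1 * (s%:R ^+ (j - i))^-1)).
    by rewrite ler_wpM2r ?invr_ge0 ?exprn_ge0 ?(ltW S0)// invf_le1 ?exprn_ege1 ?exprn_gt0//; lra.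
  rewrite mul1r lef_pV2 ?posrE ?exprn_gt0//.
  by rewrite -[leLHS]expr1 ler_weXn2l// subn_gt0.
have -> : (V ^+ N)`_j / s%:R ^+ j - (-1) ^+ j / j`!%:R =
   (-1) ^+ j * (24 ^+ j * 'C(N, j)%:R / s%:R ^+ j - (j`!%:R)^-1) +
   \sum_(i < j) ('C(N, i)%:R / s%:R ^+ j) * (U ^+ i)`_(j - i).
  rewrite {1}VE coef_pow_one_plus big_ord_recr /= subnn -!horner_coef0 horner_exp horner_coef0 u0.
  rewrite mulrDl -addrA addrC; congr (_ + _); last first.
    by rewrite mulr_suml; apply: eq_bigr => i _; rewrite mulrAC.
  rewrite -[- 24]mulN1r exprMn mulrBr; congr (_ - _).
  by move: (_ ^+ j) (_ ^+ j) (_%:R) (_^-1) => a b c0 d; ring.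
apply: (le_trans (cabsD _ _)); rewrite mulrDl; apply: lerD.
  by rewrite cabsM cabsX cabsN cabs1 expr1n mul1r; exact: (hK j).2.
apply: (le_trans (cabs_sum _ _ _)); rewrite mulr_suml; apply: ler_sum => i _.
by rewrite cabsM mulrAC ler_wpM2r ?cabs_ge0// hbin.
Qed.

(** A higher coefficient of P meets a lower coefficient of V^N, which costs at least one power of
    s. *)
Lemma coef_mul_pow_scaled (A : R) P V j : 0 <= A -> P`_0 = 1 -> V`_0 = 1 -> V`_1 = - 24 ->
  exists2 K : R, 0 < K & forall N s : nat, (0 < s)%N -> `|s%:R - 24 * N%:R| <= A ->
    cabs ((P * V ^+ N)`_j / s%:R ^+ j - (-1) ^+ j / j`!%:R) <= K / s%:R.
Proof.
move=> A0 p0 v0 v1.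
have hb i : exists K : R, 0 < K /\ forall N s : nat, (0 < s)%N -> `|s%:R - 24 * N%:R| <= A ->
    cabs ((V ^+ N)`_i / s%:R ^+ i - (-1) ^+ i / i`!%:R) <= K / s%:R.
  by have [K K0 hK] := coef_pow_scaled i A0 v0 v1; exists K.
have [K hK] := choice hb.
exists (K j + \sum_(i < j) cabs P`_i.+1 * (K (j - i.+1)%N + 1)).
  rewrite ltr_wpDr ?(hK j).1//; apply: sumr_ge0 => i _.
  by rewrite mulr_ge0 ?cabs_ge0// addr_ge0// ltW// (hK _).1.
move=> N s s0 hs.
have S0 : 0 < s%:R :> R by rewrite ltr0n.
have S1 : 1 <= s%:R :> R by rewrite ler1n.
have SC : s%:R != 0 :> C by rewrite pnatr_eq0 -lt0n.
rewrite coefM big_ord_recl subn0 p0 mul1r mulrDl -addrAC.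
apply: (le_trans (cabsD _ _)); rewrite mulrDl; apply: lerD; first exact: (hK j).2.
rewrite mulr_suml mulr_suml; apply: (le_trans (cabs_sum _ _ _)); apply: ler_sum => i _.
rewrite lift0.
have [Ki0 /(_ N s s0 hs) h] := hK (j - i.+1)%N.
have -> : P`_i.+1 * (V ^+ N)`_(j - i.+1) / s%:R ^+ j =
   P`_i.+1 * ((V ^+ N)`_(j - i.+1) / s%:R ^+ (j - i.+1)) / s%:R ^+ i.+1.
  have -> : s%:R ^+ j = s%:R ^+ (j - i.+1) * s%:R ^+ i.+1 :> C by rewrite -exprD subnK.
  by rewrite invfM !mulrA.
rewrite cabsM cabsM; apply: ler_pM; rewrite ?mulr_ge0 ?cabs_ge0//.
  rewrite ler_wpM2l ?cabs_ge0//.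
  rewrite -[X in cabs X](subrK ((-1) ^+ (j - i.+1) / (j - i.+1)`!%:R)).
  apply: (le_trans (cabsD _ _)); apply: lerD.
    by apply: (le_trans h); rewrite ler_pdivrMr// ler_peMr// ltW.
  by rewrite cabsM cabsX cabsN cabs1 expr1n mul1r cabsV cabs_nat invf_le1 ?ler1n ?ltr0n ?fact_gt0.
rewrite cabsV cabsX cabs_nat lef_pV2 ?posrE ?exprn_gt0//.
by rewrite -[leLHS]expr1 ler_weXn2l.
Qed.

Lemma triangular_solve (w : nat -> nat -> C) (a : nat -> C) n : (forall m, w m 0%N = 1) ->
  exists b : nat -> C, forall i, (i < n)%N -> \sum_(m < i.+1) b m * w m (i - m)%N = a i.
Proof.
move=> w0; elim: n => [|n [b hb]]; first by exists (fun=> 0).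
exists (fun m => if m == n then a n - \sum_(m < n) b m * w m (n - m)%N else b m) => i.
rewrite ltnS leq_eqVlt => /orP[/eqP->|hi].
  rewrite big_ord_recr /= eqxx subnn w0 mulr1.
  rewrite (eq_bigr (fun m : 'I_n => b m * w m (n - m)%N)); first by rewrite addrC subrK.
  by move=> m _; rewrite ltn_eqF.
rewrite -(hb i hi); apply: eq_bigr => m _; rewrite ltn_eqF//.
by apply: leq_ltn_trans hi; rewrite -ltnS.
Qed.

(** The coefficient of t^i in e^t e^(-t) = 1. *)
Lemma exp_inverse i : \sum_(m < i.+1) (m`!%:R)^-1 * ((-1) ^+ (i - m) / (i - m)`!%:R) = (i == 0%N)%:R :> C.
Proof.
have f0 n : n`!%:R != 0 :> C by rewrite pnatr_eq0 -lt0n fact_gt0.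
have : (-1 + 1) ^+ i = (i == 0%N)%:R :> C by rewrite addNr expr0n.
rewrite exprDn => h.
transitivity ((i`!%:R)^-1 * \sum_(m < i.+1) ((-1) ^+ (i - m) * 1 ^+ m *+ 'C(i, m)) : C); last first.
  by rewrite h; case: i {h} => [|i]; rewrite ?mulr0// mulr1 invr1.
rewrite mulr_sumr; apply: eq_bigr => m _.
rewrite expr1n mulr1 -[_ *+ 'C(i, m)]mulr_natr -(@bin_fact i m) -1?ltnS// !natrM.
have c0 : 'C(i, m)%:R != 0 :> C by rewrite pnatr_eq0 -lt0n bin_gt0 -ltnS.
have := f0 m; have := f0 (i - m)%N.
move: c0; move: ('C(i, m)%:R) (m`!%:R) ((i - m)`!%:R) (_ ^+ _) => a b c d a0 c0 b0.
by field; rewrite a0 b0 c0.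
Qed.

(** Induction on the size: subtracting [exp_inverse] from the last row expresses b_n - 1/n! through
    the earlier errors. The constant precedes S, w, a and b, so it is uniform in the form. *)
Lemma triangular_bound (K0 : R) n : 0 < K0 -> exists2 K : R, 0 < K &
  forall (S : R) (w : nat -> nat -> C) (a b : nat -> C), 1 <= S ->
  (forall m j, (m < n)%N -> (j < n)%N -> cabs (w m j - (-1) ^+ j / j`!%:R) <= K0 / S) ->
  (forall i, (i < n)%N -> cabs (a i - (i == 0%N)%:R) <= K0 / S) ->
  (forall m, w m 0%N = 1) ->
  (forall i, (i < n)%N -> \sum_(m < i.+1) b m * w m (i - m)%N = a i) ->
  forall i, (i < n)%N -> cabs (b i - (i`!%:R)^-1) <= K / S.
Proof.
move=> K00; elim: n => [|n [K Kp IH]]; first by exists 1.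
exists (K + K0 + n%:R * (K * (K0 + 1) + K0)).
  by rewrite ltr_wpDr ?addr_gt0// mulr_ge0// addr_ge0 ?mulr_ge0 ?(ltW Kp) ?addr_ge0 ?(ltW K00).
move=> S w a b S1 hw ha w0 hb i.
have S0 : 0 < S by lra.
have hm m : (m < n)%N -> cabs (b m - (m`!%:R)^-1) <= K / S.
  by apply: (IH S w a b) => // *; [apply: hw|apply: ha|apply: hb]; rewrite ltnW.
have KS : 0 <= K * (K0 + 1) + K0 by rewrite addr_ge0 ?mulr_ge0 ?(ltW Kp) ?addr_ge0 ?(ltW K00).
rewrite ltnS leq_eqVlt => /orP[/eqP->|hi]; last first.
  apply: (le_trans (hm i hi)); rewrite ler_wpM2r ?invr_ge0 ?(ltW S0)//.
  by rewrite -addrA lerDl addr_ge0 ?(ltW K00)// mulr_ge0.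
have := hb n (ltnSn n); have := exp_inverse n.
rewrite !big_ord_recr /= subnn expr0 fact0 invr1 !mulr1 w0 mulr1 => e1 e2.
have -> : b n - (n`!%:R)^-1 = (a n - (n == 0%N)%:R) -
   \sum_(m < n) (b m * w m (n - m)%N - (m`!%:R)^-1 * ((-1) ^+ (n - m) / (n - m)`!%:R)).
  by rewrite sumrB -e1 -e2; ring.
apply: (le_trans (cabsB _ _)); rewrite mulrDl; apply: lerD.
  apply: (le_trans (ha n (ltnSn n))); rewrite ler_wpM2r ?invr_ge0 ?(ltW S0)//; lra.
apply: (le_trans (cabs_sum _ _ _)).
rewrite -mulrA mulr_natl -[X in _ *+ X]card_ord -sumr_const; apply: ler_sum => m _.
set e := _ / (n - m)`!%:R.
have he : cabs e <= 1.
  by rewrite /e cabsM cabsX cabsN cabs1 expr1n mul1r cabsV cabs_nat invf_le1 ?ler1n ?ltr0n ?fact_gt0.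
have hwe := hw m (n - m)%N (ltnW (ltn_ord m)) (leq_subr _ _).
have hbe := hm m (ltn_ord m).
have hf : cabs ((m`!%:R)^-1 : C) <= 1 by rewrite cabsV cabs_nat invf_le1 ?ler1n ?ltr0n ?fact_gt0.
set f := (m`!%:R)^-1 in hbe hf *; set x := w m _ in hwe *.
have hx : cabs x <= K0 + 1.
  rewrite -(subrK e x); apply: (le_trans (cabsD _ _)); apply: lerD => //.
  by apply: (le_trans hwe); rewrite ler_pdivrMr// ler_peMr// ltW.
have -> : b m * x - f * e = (b m - f) * x + f * (x - e) by ring.
apply: (le_trans (cabsD _ _)); rewrite !cabsM.
have h1 : cabs (b m - f) * cabs x <= K / S * (K0 + 1) by rewrite ler_pM ?cabs_ge0.
have h2 : cabs f * cabs (x - e) <= 1 * (K0 / S) by rewrite ler_pM ?cabs_ge0.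
apply: (le_trans (lerD h1 h2)); rewrite mul1r mulrDl; apply: lerD => //.
by rewrite mulrAC.
Qed.

End ScaledCoefficients.

(** * Inverse zeros and roots of the perturbed polynomial *)

Section Roots.
Variable R : realType.
Local Notation C := R[i].

(** The value 1 / (1 + sum of 1/f) also covers an empty index set, where no minimum exists. *)
Lemma finite_lower (T : finType) (f : T -> R) : (forall t, 0 < f t) ->
  exists2 d : R, 0 < d & forall t, d <= f t.
Proof.
move=> f0; have s0 : 0 <= \sum_t (f t)^-1 by apply: sumr_ge0 => t _; rewrite invr_ge0 ltW.
exists (1 + \sum_t (f t)^-1)^-1; first by rewrite invr_gt0; lra.
move=> t; rewrite -[leRHS]invrK lef_pV2 ?posrE ?invr_gt0//; last by lra.
rewrite (bigD1 t)//= addrCA lerDl addr_ge0//.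
by apply: sumr_ge0 => u _; rewrite invr_ge0 ltW.
Qed.

Lemma finite_upper (T : finType) (f : T -> R) : exists2 K : R, 0 < K & forall t, f t <= K.
Proof.
have s0 : 0 <= \sum_t `|f t| by apply: sumr_ge0.
exists (1 + \sum_t `|f t|); first by lra.
move=> t; apply: (le_trans (ler_norm _)); rewrite (bigD1 t)//= addrCA lerDl addr_ge0//.
by apply: sumr_ge0.
Qed.

Section InverseZeros.
Variables (D : nat) (z : 'I_D -> C).
Hypothesis hz : inverse_zeros z.

Lemma trunc_exp_horner t : (trunc_exp R D).[t] = \prod_(r < D) (1 - z r * t).
Proof. by rewrite hz horner_prod; apply: eq_bigr => r _; rewrite !hornerE. Qed.

(** A vanishing z_r would lower the degree of the product, but the coefficient of t^D is 1/D!. *)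
Lemma inverse_zeros_neq0 r : z r != 0.
Proof.
apply/eqP => zr0; have f0 : D`!%:R != 0 :> C by rewrite pnatr_eq0 -lt0n fact_gt0.
have : (trunc_exp R D)`_D = 0.
  rewrite hz (bigD1 r)//= zr0 scale0r subr0 mul1r nth_default//.
  apply: (leq_trans (size_prod_leq _ _)); rewrite leq_subLR.
  have hs : (\sum_(i < D | i != r) size (1 - z i *: 'X : {poly C})%R <= \sum_(i < D | i != r) 2)%N.
    apply: leq_sum => i _; apply: (leq_trans (size_polyD _ _)).
    rewrite size_polyC oner_eq0 size_polyN geq_max /=.
    by apply: (leq_trans (size_scale_leq _ _)); rewrite size_polyX.
  have cD : #|[pred i : 'I_D | i != r]| = D.-1 by rewrite cardC1 card_ord.
  rewrite sum_nat_const cD in hs; rewrite cD; have := leq_ltn_trans (leq0n r) (ltn_ord r).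
  move: hs; move: (\sum_(_ | _) _)%N => s; lia.
by move/eqP; rewrite coef_poly ltnSn invr_eq0 (negPf f0).
Qed.

Lemma trunc_exp_root r : (trunc_exp R D).[(z r)^-1] = 0.
Proof.
by rewrite trunc_exp_horner (bigD1 r)//= mulfV ?inverse_zeros_neq0// subrr mul0r.
Qed.

Lemma inverse_zeros_eval r : \sum_(m < D.+1) (m`!%:R)^-1 * z r ^+ (D - m) = 0.
Proof.
have z0 := inverse_zeros_neq0 r.
have : z r ^+ D * (trunc_exp R D).[(z r)^-1] = 0 by rewrite trunc_exp_root mulr0.
rewrite horner_poly mulr_sumr => h; rewrite -[RHS]h; apply: eq_bigr => m _.
rewrite mulrCA; congr (_ * _); rewrite exprVn.
have hm : (m <= D)%N by rewrite -ltnS.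
have -> : z r ^+ D = z r ^+ (D - m) * z r ^+ m by rewrite -exprD subnK.
by rewrite mulfK// expf_neq0.
Qed.

Lemma deriv_trunc_exp (n : nat) : (trunc_exp R n)^`() = trunc_exp R n - (n`!%:R)^-1 *: 'X^n.
Proof.
apply/polyP => i; rewrite coef_deriv coefB coefZ coefXn !coef_poly ltnS ltnS.
have f0 k : k`!%:R != 0 :> C by rewrite pnatr_eq0 -lt0n fact_gt0.
case: ltngtP => hi.
- rewrite mulr0 subr0 -mulr_natr factS natrM.
  by field; rewrite f0 nat1r pnatr_eq0.
- by rewrite mulr0 subr0 mul0rn.
by rewrite hi mulr1 subrr mul0rn.
Qed.

(** A repeated root would also be a root of the derivative, which is the polynomial minus t^D/D!;
    that forces t = 0, whereas t = 1/z_r. *)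
Lemma inverse_zeros_inj : injective z.
Proof.
move=> r j hrj; apply/eqP; apply: contraT => nrj.
have z0 := inverse_zeros_neq0 r; set t := (z r)^-1.
have : (trunc_exp R D)^`().[t] = 0.
  rewrite hz (bigD1 r)//= (bigD1 j) 1?eq_sym//= derivM hornerD !hornerM.
  rewrite -hrj; set e := (1 - z r *: 'X); have e0 : e.[t] = 0.
    by rewrite !hornerE /t mulfV// subrr.
  by rewrite e0 mul0r !mulr0 mul0r addr0.
rewrite deriv_trunc_exp hornerD hornerN trunc_exp_root sub0r hornerZ hornerXn => /eqP.
by rewrite oppr_eq0 mulf_eq0 invr_eq0 expf_eq0 invr_eq0 (negPf z0) andbF orbF pnatr_eq0 -leqn0 leqNgt fact_gt0.
Qed.

End InverseZeros.

(** Separation and size bounds obtained for one fixed list thereby hold for every list, with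
    constants depending on D only. *)
Lemma inverse_zeros_same D (z z0 : 'I_D -> C) r : inverse_zeros z -> inverse_zeros z0 ->
  exists i, z r = z0 i.
Proof.
move=> hz hz0; have := trunc_exp_root hz r; rewrite (trunc_exp_horner hz0) => /eqP.
rewrite prodf_seq_eq0 => /hasP[i _] /=; rewrite subr_eq0 => /eqP h; exists i.
by rewrite -[RHS](divfK (inverse_zeros_neq0 hz r)) -h mul1r.
Qed.

(** Some x_i lies within d/4 of z_r, otherwise the product would be at least (d/4)^D. Separation
    makes this choice injective, hence a permutation, and the other D - 1 factors are at least
    d/2. *)
Lemma roots_near D (x z : 'I_D -> C) (d e : R) : 0 < d ->
  (forall r j, r != j -> d <= cabs (z r - z j)) ->
  (forall r, \prod_(i < D) cabs (z r - x i) <= e) -> e < (d / 4) ^+ D ->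
  exists s : 'I_D -> 'I_D, injective s /\ forall r, cabs (z r - x (s r)) <= e / (d / 2) ^+ D.-1.
Proof.
move=> d0 hd he ed.
have ex r : exists i, cabs (z r - x i) < d / 4.
  apply: contrapT => /forallNP h; move: ed; apply/negP; rewrite -leNgt.
  apply: le_trans (he r); rewrite -[X in _ ^+ X](card_ord D) -prodr_const.
  apply: ler_prod => i _; rewrite divr_ge0 ?(ltW d0)//= leNgt; apply/negP; exact: h.
have [s hs] := choice ex.
have si : injective s.
  move=> r j e1; apply/eqP; apply: contraT => rj.
  have h1 := hs r; have h2 := hs j; rewrite -e1 cabsC in h2.
  have := hd r j rj; have -> : z r - z j = (z r - x (s r)) + (x (s r) - z j) by ring.
  have := cabsD (z r - x (s r)) (x (s r) - z j); lra.
exists s; split=> // r.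
rewrite ler_pdivlMr ?exprn_gt0 ?divr_gt0//; apply: le_trans (he r).
rewrite (bigD1 (s r))//= ler_wpM2l ?cabs_ge0//.
have <- : #|[pred i | i != s r]| = D.-1 by rewrite cardC1 card_ord.
rewrite -prodr_const; apply: ler_prod => i ir; rewrite divr_ge0 ?(ltW d0)//=.
have [j hj] : exists j, s j = i by exists (invF si i); rewrite f_invF.
rewrite -hj in ir *.
have rj : r != j by apply: contraNneq ir => ->.
have := hd r j rj; have := hs j; have -> : z r - z j = (z r - x (s j)) - (z j - x (s j)) by ring.
have := cabsB (z r - x (s j)) (z j - x (s j)); lra.
Qed.

(** The reversed polynomial with coefficients 1/m! vanishes at z_r, so the perturbed one is O(1/S)
    there, and this value is the product of the distances from z_r to its roots. *)
Lemma roots_of_scaled D (Kb : R) : 0 < Kb -> exists K s0 : R, 0 < K /\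
  forall z : 'I_D -> C, inverse_zeros z -> forall (S : R) (b : nat -> C), 1 <= S -> s0 <= S ->
  b 0%N = 1 -> (forall m, (m <= D)%N -> cabs (b m - (m`!%:R)^-1) <= Kb / S) ->
  exists x : 'I_D -> C,
    \sum_(m < D.+1) b m *: 'X^(D - m) = \prod_(r < D) ('X - (x r)%:P) /\
    forall r, cabs (x r - z r) <= K / S.
Proof.
move=> Kb0.
(* K and s0 precede z, so a reference list is fixed here; if there is no list at all, the claim is
   vacuous. *)
have [[z0 hz0]|none] := pselect (exists z0 : 'I_D -> C, inverse_zeros z0); last first.
  by exists 1, 0; split=> // z hz; case: none; exists z.
have [d d0 hd] : exists2 d : R, 0 < d & forall r j, r != j -> d <= cabs (z0 r - z0 j).
  have [|d d0 hd] := @finite_lower ('I_D * 'I_D)%type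
      (fun p => if p.1 == p.2 then 1 else cabs (z0 p.1 - z0 p.2)).
    move=> [r j] /=; case: eqVneq => // rj; rewrite cabs_gt0 subr_eq0.
    by rewrite (inj_eq (inverse_zeros_inj hz0)).
  by exists d => // r j rj; have := hd (r, j); rewrite /= (negPf rj).
have [Cz Cz0 hCz] := finite_upper (fun r => \sum_(m < D.+1) cabs (z0 r) ^+ (D - m)).
pose d4 := (d / 4) ^+ D; have d40 : 0 < d4 by rewrite exprn_gt0 ?divr_gt0.
pose d2 := (d / 2) ^+ D.-1; have d20 : 0 < d2 by rewrite exprn_gt0 ?divr_gt0.
exists (Kb * Cz / d2), (Kb * Cz / d4 + 1); split; first by rewrite divr_gt0 ?mulr_gt0.
move=> z hz S b S1 Ss b0 hb.
have S0 : 0 < S by lra.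
set p := \sum_(m < D.+1) _.
have pE i : (i <= D)%N -> p`_i = b (D - i)%N.
  move=> hi; rewrite coef_sum.
  have hD : (D - i < D.+1)%N by rewrite ltnS leq_subr.
  rewrite (bigD1 (Ordinal hD))//= coefZ coefXn subKn// eqxx mulr1 big1 ?addr0// => m hm.
  rewrite coefZ coefXn; case: eqP => [e|_]; last by rewrite mulr0.
  case/negP: hm; apply/eqP/val_inj => /=; rewrite e subKn//; by rewrite -ltnS.
have sp : size p = D.+1.
  apply/eqP; rewrite eqn_leq; apply/andP; split; last first.
    by rewrite ltnNge; apply/negP => /leq_sizeP/(_ D (leqnn D)); rewrite pE// subnn b0 => /eqP; rewrite oner_eq0.
  apply: (leq_trans (size_sum _ _ _)); apply/bigmax_leqP => m _.
  by apply: (leq_trans (size_scale_leq _ _)); rewrite size_polyXn ltnS leq_subr.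
have [rs hrs] := closed_field_poly_normal p.
have lc : lead_coef p = 1 by rewrite lead_coefE sp /= pE// subnn.
rewrite lc scale1r in hrs.
have srs : size rs = D by have := congr1 (size : {poly C} -> nat) hrs; rewrite sp size_prod_XsubC => -[].
pose x0 (i : 'I_D) := rs`_i.
have hx0 : p = \prod_(i < D) ('X - (x0 i)%:P).
  by rewrite hrs (big_nth 0) srs big_mkord.
have hdz r j : r != j -> d <= cabs (z r - z j).
  move=> rj; have [i hi] := inverse_zeros_same r hz hz0; have [k hk] := inverse_zeros_same j hz hz0.
  rewrite hi hk; apply: hd; apply: contraNneq rj => e; apply/eqP/(inverse_zeros_inj hz).
  by rewrite hi hk e.
have hprod r : \prod_(i < D) cabs (z r - x0 i) <= Kb * Cz / S.
  rewrite -cabs_prod.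
  have -> : \prod_(i < D) (z r - x0 i) = p.[z r].
    by rewrite hx0 horner_prod; apply: eq_bigr => i _; rewrite !hornerE.
  have -> : p.[z r] = \sum_(m < D.+1) (b m - (m`!%:R)^-1) * z r ^+ (D - m).
    rewrite -[LHS]subr0 -[X in _ - X](inverse_zeros_eval hz r) /p horner_sum -sumrB.
    by apply: eq_bigr => m _; rewrite hornerZ hornerXn mulrBl.
  apply: (le_trans (cabs_sum _ _ _)).
  apply: (@le_trans _ _ (\sum_(m < D.+1) Kb / S * cabs (z r) ^+ (D - m))).
    apply: ler_sum => m _; rewrite cabsM cabsX ler_wpM2r ?exprn_ge0 ?cabs_ge0// hb//.
    by rewrite -ltnS.
  rewrite -mulr_sumr [Kb * Cz / S]mulrAC ler_wpM2l ?divr_ge0 ?(ltW Kb0) ?(ltW S0)//.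
  by have [i ->] := inverse_zeros_same r hz hz0.
have [|s [si hs]] := roots_near d0 hdz hprod.
  rewrite -/d4 ltr_pdivrMr// -ltr_pdivrMl//; apply: lt_le_trans Ss; rewrite mulrC; lra.
exists (x0 \o s); split.
  by rewrite hx0 (reindex_inj si).
by move=> r; rewrite cabsC; apply: (le_trans (hs r)); rewrite mulrAC.
Qed.

End Roots.

(** * The product formula for the cusp form *)

Section Factorization.
Variable R : realType.
Local Notation C := R[i].
Implicit Types (f : C -> C) (c : nat -> C).

Lemma qexp_clim f c tau : is_qexpansion f c -> 0 < complex.Im tau ->
  clim (fun n => \sum_(i < n) c i * nome tau ^+ i) (f tau).
Proof.
move=> h y0; have /climP := h tau y0; apply: (clim_eq (N := 0%N)) => n _.
by rewrite /series /= big_mkord.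
Qed.

(** Convergence at one point of nome r puts consecutive partial sums within 1 of the limit, so the
    terms are eventually at most 2. *)
Lemma qexp_tame f c : is_qexpansion f c -> tame c.
Proof.
move=> h r r0 r1.
have rr : cabs (r%:C : C) = r by rewrite cabs_real ger0_norm ?(ltW r0).
have [|tau [_ _ hn]] := @nome_surj R r%:C; first by rewrite -cabs_gt0 rr.
have y0 : 0 < complex.Im tau by apply: nome_upper; rewrite hn rr.
have [N hN] := qexp_clim h y0 ltr01; rewrite hn in hN.
pose t i := cabs (c i) * r ^+ i.
have t0 i : 0 <= t i by rewrite mulr_ge0 ?cabs_ge0 ?exprn_ge0 ?(ltW r0).
exists (2 + \sum_(i < N) t i) => n; rewrite -/(t n).
have [nN|Nn] := ltnP n N.
  rewrite (bigD1 (Ordinal nN))//= addrCA lerDl addr_ge0//.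
  by apply: sumr_ge0 => i _; exact: t0.
apply: (@le_trans _ _ 2); last by rewrite lerDl; apply: sumr_ge0 => i _; exact: t0.
have h1 := hN _ Nn; have h2 := hN _ (leqW Nn); rewrite big_ord_recr /= in h2.
have -> : t n = cabs (c n * r%:C ^+ n) by rewrite cabsM cabsX rr.
move: (\sum_(i < n) _) h1 h2 => s h1 h2.
have -> : c n * r%:C ^+ n = (s + c n * r%:C ^+ n - f tau) - (s - f tau) by ring.
by apply: (le_trans (cabsB _ _)); rewrite -[2]/(1 + 1) lerD.
Qed.

Lemma qexp_pser f c tau : is_qexpansion f c -> 0 < complex.Im tau -> f tau = pser c (nome tau).
Proof.
move=> h y0; apply: clim_unique (qexp_clim h y0) _.
by apply: pserP; [exact: qexp_tame h|exact: cabs_nome_lt1].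
Qed.

Lemma modq_qexp k f c : is_qexpansion f c -> slash_invariant k f -> modq k (pser c).
Proof.
move=> h hs tau y0; rewrite -(qexp_pser h y0) -(qexp_pser h (upper_inv y0)).
have := hs 0 (-1) 1 0 erefl tau y0; rewrite !(mulr0z, mulr1z, mulrN1z) mul0r add0r mul1r addr0.
by rewrite mulN1r.
Qed.

(** The polynomial identity evaluated at y / (S d) and cleared of denominators, to be used with y =
    E_4^3 and d = Delta. *)
Lemma homogeneous_prod D (b : nat -> C) (x : 'I_D -> C) (S y d : C) : S != 0 -> d != 0 ->
  \sum_(m < D.+1) b m *: 'X^(D - m) = \prod_(r < D) ('X - (x r)%:P) ->
  \sum_(m < D.+1) S ^+ m * b m * (d ^+ m * y ^+ (D - m)) = \prod_(r < D) (y - S * x r * d).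
Proof.
move=> S0 d0 h; have Sd : S * d != 0 by rewrite mulf_neq0.
have -> : \prod_(r < D) (y - S * x r * d) = (S * d) ^+ D * \prod_(r < D) (y / (S * d) - x r).
  rewrite -[X in _ ^+ X](card_ord D) -prodr_const -big_split /=; apply: eq_bigr => r _.
  by rewrite mulrBr mulrCA divff// mulr1 mulrAC.
have -> : \prod_(r < D) (y / (S * d) - x r) = (\prod_(r < D) ('X - (x r)%:P)).[y / (S * d)].
  by rewrite horner_prod; apply: eq_bigr => r _; rewrite !hornerE.
rewrite -h horner_sum mulr_sumr; apply: eq_bigr => m _; rewrite hornerZ hornerXn.
have hm : (m <= D)%N by rewrite -ltnS.
have -> : (S * d) ^+ D = (S * d) ^+ m * (S * d) ^+ (D - m) by rewrite -exprD subnKC.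
rewrite expr_div_n exprMn; have := expf_neq0 (D - m) Sd.
by move: (_ ^+ (D - m)) (_ ^+ (D - m)) (_ ^+ m) (_ ^+ m) (b m) => p t u v w p0; field.
Qed.

Definition wlist := [:: 0; 4; 6; 8; 10; 14]%N.

(** k', m and j range over a finite set, encoded by ordinals, so the constants of
    [coef_mul_pow_scaled] have a common bound. *)
Lemma uniform_jet_coef D : (0 < D)%N ->
  exists2 V : {poly C}, jet (@Vq R) V D.+1 & V`_0 = 1 /\ exists2 K : R, 0 < K &
  forall (k' m j N s : nat), k' \in wlist -> (m <= D)%N -> (j <= D)%N -> (0 < s)%N ->
    `|s%:R - 24 * N%:R| <= (28 + 24 * D)%:R :> R ->
    cabs ((ekp R k' D.+1 * E4p R D.+1 ^+ (3 * (D - m)) * V ^+ N)`_j / s%:R ^+ j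
           - (-1) ^+ j / j`!%:R) <= K / s%:R.
Proof.
move=> D0; have [V jV [v0 v1]] := jet_Vq R D.+1; exists V => //; split=> //.
have {}v1 : V`_1 = - 24 by apply: v1.
pose P (t : 'I_6 * 'I_D.+1 * 'I_D.+1) : {poly C} :=
  ekp R (nth 0%N wlist t.1.1) D.+1 * E4p R D.+1 ^+ (3 * (D - t.1.2)).
have P0 t : (P t)`_0 = 1 by rewrite /P coef0M ekp_coef0 coef0X E4p_coef0 expr1n mulr1.
have hb t : exists K : R, 0 < K /\ forall N s : nat, (0 < s)%N ->
    `|s%:R - 24 * N%:R| <= (28 + 24 * D)%:R :> R ->
    cabs ((P t * V ^+ N)`_t.2 / s%:R ^+ t.2 - (-1) ^+ t.2 / (t.2)`!%:R) <= K / s%:R.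
  by have [K K0 hK] := coef_mul_pow_scaled t.2 (ler0n R (28 + 24 * D)) (P0 t) v0 v1; exists K.
have [K hK] := choice hb; have [M M0 hM] := finite_upper K.
exists M => // k' m j N s hk hm hj s0 hs.
have hi : (index k' wlist < 6)%N by rewrite -[6%N]/(size wlist) index_mem.
have := (hK (Ordinal hi, Ordinal (hm : m < D.+1)%N, Ordinal (hj : j < D.+1)%N)).2 N s s0 hs.
rewrite /P /= nth_index// => h; apply: (le_trans h).
by rewrite ler_wpM2r ?invr_ge0.
Qed.

(** The difference is exactly 2 k' + 24 (D - m), and k' <= 14. *)
Lemma weight_gap k' D l m : k' \in wlist -> (D <= l)%N -> (m <= D)%N ->
  `|(2 * (12 * l + k'))%:R - 24 * (l - D + m)%:R| <= (28 + 24 * D)%:R :> R.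
Proof.
move=> hk hl hm.
have hk14 : (k' <= 14)%N by move: hk; rewrite !inE => /or4P[/eqP->|/eqP->|/eqP->|/orP[/eqP->|/orP[/eqP->|/eqP->]]].
have -> : (2 * (12 * l + k'))%:R - 24 * (l - D + m)%:R = (2 * k' + 24 * (D - m))%:R :> R.
  rewrite -natrM -natrB; last by lia.
  by congr (_%:R); lia.
by rewrite ger0_norm// ler_nat; lia.
Qed.

Lemma modq_weight k k' F : modq k F -> k = k' -> @modq R k' F.
Proof. by move=> h <-. Qed.

Lemma wlist_half k' : k' \in wlist -> k' != 14%N ->
  (k' + (12 - k')./2.*2 = 12)%N /\ (0 < (12 - k')./2)%N.
Proof.
by rewrite !inE => /or4P[/eqP->|/eqP->|/eqP->|/orP[/eqP->|/orP[/eqP->|/eqP->]]].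
Qed.

Lemma weight_term k' l D m : (m <= D)%N -> (D <= l)%N ->
  (k' + (12 * (l - D + m) + 4 * 3 * (D - m)) = 12 * l + k')%N.
Proof. lia. Qed.

(* The powers of Delta and of E_4^3 give a triangular system for the first
   D+1 coefficients; rescaled by (2k)^m it tends to [exp_inverse]. *)
Lemma cusp_form_factor D (Ca : R) : (0 < D)%N -> 0 < Ca -> exists K s0 : R, 0 < K /\
  forall z : 'I_D -> C, inverse_zeros z ->
  forall (k l k' : nat), k = (12 * l + k')%N -> k' \in wlist -> (D.+1 <= l)%N -> s0 <= k%:R ->
  forall (f : C -> C) (a : nat -> C), cusp_form k f -> has_shape f l D a ->
    (forall j, (1 <= j <= D)%N -> cabs (a j) <= Ca) ->
  exists w : 'I_D -> C, (forall r, cabs (w r - 2 * k%:R * z r) <= K) /\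
    forall tau, 0 < complex.Im tau -> f tau = ekq k' (nome tau) *
      (Dq (nome tau) ^+ (l - D) * \prod_(r < D) (E4q (nome tau) ^+ 3 - w r * Dq (nome tau))).
Proof.
move=> D0 Ca0.
have [V jV [v0 [K1 K10 hK1]]] := uniform_jet_coef D0.
have [Kb Kb0 hKb] := triangular_bound D.+1 (addr_gt0 K10 Ca0).
have [K [s0 [K0 hK]]] := roots_of_scaled D Kb0.
exists K, `|s0|; split=> // z hz k l k' kE hk' hl hs0 f a [[_ slash _] _] [c hc hcl] ha.
have lD : (D <= l)%N by apply: ltnW.
have k0 : (0 < k)%N by rewrite kE; lia.
pose s := (2 * k)%N; have sp : (0 < s)%N by rewrite muln_gt0.
pose S : C := s%:R; have S0 : S != 0 by rewrite pnatr_eq0 -lt0n.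
have S1 : 1 <= s%:R :> R by rewrite ler1n.
have Sp : 0 < s%:R :> R by rewrite ltr0n.
have Ss : s0 <= s%:R.
  by apply: (le_trans (ler_norm _)); apply: (le_trans hs0); rewrite ler_nat leq_pmull.
pose N m := (l - D + m)%N.
pose P m := ekp R k' D.+1 * E4p R D.+1 ^+ (3 * (D - m)).
pose w m j := (P m * V ^+ N m)`_j / S ^+ j.
pose A : {poly C} := 1 + \sum_(1 <= j < D.+1) a j *: 'X^j.
pose a' j := A`_j / S ^+ j.
have P0 m : (P m)`_0 = 1 by rewrite coef0M ekp_coef0 coef0X E4p_coef0 expr1n mulr1.
have w0 m : w m 0%N = 1 by rewrite /w expr0 divr1 coef0M coef0X v0 expr1n mulr1 P0.
have A0 : A`_0 = 1.
  rewrite coefD coef1 coef_sum big_nat_cond big1 ?addr0// => j /andP[/andP[j1 _] _].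
  by rewrite coefZ coefXn; case: j j1 => // j _; rewrite mulr0.
have Aj j : (1 <= j <= D)%N -> A`_j = a j.
  move=> /andP[j1 jD]; rewrite coefD coef1 coef_sum.
  rewrite (bigD1_seq j) ?mem_index_iota ?iota_uniq ?j1//= coefZ coefXn eqxx mulr1.
  rewrite big1 => [|i /negPf ij]; last by rewrite coefZ coefXn eq_sym ij mulr0.
  by rewrite addr0; case: j j1 {jD} => // j _; rewrite add0r.
have hw m j : (m < D.+1)%N -> (j < D.+1)%N -> cabs (w m j - (-1) ^+ j / j`!%:R) <= (K1 + Ca) / s%:R.
  move=> hm hj; have hwg := @weight_gap k' D l m hk' lD hm; rewrite -kE -/s in hwg.
  apply: (le_trans (hK1 k' m j (N m) s hk' hm hj sp hwg)).
  by rewrite ler_wpM2r ?invr_ge0// lerDl ltW.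
have ha' i : (i < D.+1)%N -> cabs (a' i - (i == 0%N)%:R) <= (K1 + Ca) / s%:R.
  case: i => [|i] hi.
    by rewrite /a' A0 expr0 divr1 subrr cabs0 divr_ge0// addr_ge0// ltW.
  rewrite /= subr0 /a' Aj// cabsM cabsV cabsX cabs_nat.
  apply: ler_pM; rewrite ?cabs_ge0 ?invr_ge0 ?exprn_ge0//.
    by apply: (le_trans (ha _ _)) => //; rewrite lerDr ltW.
  rewrite lef_pV2 ?posrE ?exprn_gt0//.
  by rewrite -[leLHS]expr1 ler_weXn2l.
have [b hb] := triangular_solve a' D.+1 w0.
have b0 : b 0%N = 1.
  by have := hb 0%N isT; rewrite big_ord_recl big_ord0 addr0 w0 mulr1 /a' A0 expr0 divr1.
have hbb := hKb s%:R w a' b S1 hw ha' w0 hb.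
have [x [hx hxz]] := hK z hz s%:R b S1 Ss b0 hbb.
exists (fun r => S * x r); split.
  move=> r; rewrite (_ : S * x r - _ = S * (x r - z r)); last by rewrite mulrBr /S /s natrM.
  rewrite cabsM cabs_nat mulrC -ler_pdivlMr//; exact: hxz.
(* T_m starts at q^(l-D+m), so b_m affects only coefficients from there on: this is the triangular
   shape. *)
pose T m q := S ^+ m * b m * (ekq k' q * (Dq q ^+ N m * (E4q q ^+ 3) ^+ (D - m))).
pose F q := pser c q - \sum_(m < D.+1) T m q.
have tc := qexp_tame hc.
have sT m : smooth2 (T m).
  apply/smooth2Z/smooth2M; first exact: smooth2_ekq.
  by apply: smooth2M; [exact/smooth2X/smooth2_D|exact/smooth2X/smooth2X/smooth2_E4].
have aT m : alljets (T m).
  apply/alljetsZ/alljetsM; first exact: alljets_ekq.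
  apply: alljetsM; apply: alljetsX; first by move=> n; exists (Dp R n); exact: jet_D.
  by apply: alljetsX => n; exists (E4p R n); exact: jet_E4.
have mT (m : 'I_D.+1) : modq k (T m).
  have hm : (m <= D)%N by rewrite -ltnS.
  apply: modqZ; apply: modq_weight (modqM (modq_ekq hk') (modqM (modqX (N m) (@modq_D R))
     (modqX (D - m) (modqX 3 (@modq_E4 R))))) _.
  by rewrite kE /N weight_term.
have jT : jet (fun q => \sum_(m < D.+1) T m q) ('X^(l - D) * A) (l - D + D.+1).
  pose p := \sum_(m < D.+1) (S ^+ m * b m) *: ('X^m * (P m * V ^+ N m)).
  have jp : jet (fun q => \sum_(m < D.+1) S ^+ m * b m * (q ^+ m *
      (ekq k' q * (E4q q) ^+ (3 * (D - m)) * Vq q ^+ N m))) p D.+1.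
    apply: jet_sum => m; apply: jetZ; apply: jetM.
      by have := jet_poly ('X^m : {poly C}) D.+1; congr jet; apply/funext => q; rewrite hornerXn.
    by apply: jetM; [apply: jetM; [exact: jet_ekq|apply: jetX; exact: jet_E4]|exact: jetX].
  have {}jp := jet_trunc (s := A) _ jp.
  have jA : forall i, (i < D.+1)%N -> p`_i = A`_i.
    move=> i hi; have := hb i hi; rewrite /a' => /(congr1 (fun u => u * S ^+ i)).
    rewrite divfK ?expf_neq0// => <-; rewrite coef_sum mulr_suml.
    pose G m := (S ^+ m * b m) * ('X^m * (P m * V ^+ N m))`_i.
    transitivity (\sum_(m < D.+1) G m); first by apply: eq_bigr => m _; rewrite coefZ.
    rewrite (sum_ord_cut (F := G) hi); last by move=> m hm; rewrite /G coefXnM hm mulr0.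
    apply: eq_bigr => m _; have hm : (m <= i)%N by rewrite -ltnS.
    rewrite /G coefXnM ltnNge hm /= /w.
    have -> : S ^+ i = S ^+ m * S ^+ (i - m) by rewrite -exprD subnKC.
    have := expf_neq0 (i - m) S0; move: (_ ^+ (i - m)) (_ ^+ m) (b m) (_`_(i - m)) => t u v y t0.
    by field.
  have := jet_shift (l - D) (jp jA); apply: jet_ext => q q0 _.
  rewrite mulr_sumr; apply: eq_bigr => m _.
  have q0' : q != 0 by rewrite -cabs_gt0.
  rewrite /T /Vq expr_div_n exprM /N [q ^+ (l - D + m)]exprD.
  have := expf_neq0 (l - D) q0'; have := expf_neq0 m q0'.
  move: (ekq _ _) (Dq q ^+ (l - D + m)) (_ ^+ (D - m)) (q ^+ m) (q ^+ (l - D)) (S ^+ m) (b m).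
  by move=> t u v y1 y2 e1 e2 n1 n2; field; rewrite n1 n2.
have jF : jet F 0 l.+1.
  have lE : (l - D + D.+1 = l.+1)%N by rewrite addnS subnK.
  rewrite -[0](subrr ('X^(l - D) * A)) -lE; apply: jetB => //.
  rewrite lE; apply: jet_trunc (jet_pser l.+1 tc) => i hi.
  by rewrite coef_poly hi hcl// -ltnS.
have sF : smooth2 F by apply: smooth2B; [exact: smooth2_pser|apply: smooth2_sum => m; exact: sT].
have mF : modq k F by apply: modqB; [exact: modq_qexp hc slash|apply: modq_sum => m; exact: mT].
have aF : alljets F by apply: alljetsB; [exact: alljets_pser|apply: alljets_sum => m; exact: aT].
have vF tau : 0 < complex.Im tau -> F (nome tau) = 0.
  (* Order l + 1 suffices in both cases: 12 l + 14 = 12 (l + 1) + 2, and otherwise k' + 2 v = 12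
     with v > 0. *)
  move=> y0; have [e14|n14] := eqVneq k' 14%N.
    apply: (@sturm14 R F l.+1 sF _ aF jF tau y0).
    by apply: modq_weight mF _; rewrite kE e14 -[14%N]/(12 + 2)%N addnA -mulnSr.
  have [hv v0'] := wlist_half hk' n14.
  by apply: (@sturm R F k l.+1 ((12 - k')./2) sF mF _ v0' jF tau y0); rewrite kE -addnA hv mulnSr.
move=> tau y0; have := vF tau y0; rewrite /F => /eqP; rewrite subr_eq0 => /eqP h.
rewrite (qexp_pser hc y0) h.
rewrite -(homogeneous_prod (E4q (nome tau) ^+ 3) S0 (Dq_neq0 y0) hx) mulr_sumr mulr_sumr.
apply: eq_bigr => m _; rewrite /T /N exprD.
move: (ekq _ _) (Dq _ ^+ (l - D)) (Dq _ ^+ m) (_ ^+ (D - m)) (S ^+ m) (b m) => *; ring.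
Qed.

End Factorization.

(** * Location of the zeros *)

Section Solve.
Variable R : realType.
Local Notation C := R[i].

(** The iterates of 0 stay in the disc because |N q| <= |q|/2 + |N 0|; their steps form a geometric
    series of sum at most 2 |N 0|, which also bounds the limit. *)
Lemma fixpoint (N : C -> C) (x : R) :
  (forall q q', cabs q <= x -> cabs q' <= x -> cabs (N q - N q') <= cabs (q - q') / 2) ->
  cabs (N 0) <= x / 2 -> exists2 q, cabs q <= 2 * cabs (N 0) & N q = q.
Proof.
move=> hN h0; have m0 := cabs_ge0 (N 0); have x0 : 0 <= x by lra.
have z0 : cabs (0 : C) <= x by rewrite cabs0.
pose u n := iter n N 0.
have ux n : cabs (u n) <= x.
  elim: n => [|n IH]; first by rewrite cabs0.
  rewrite /u /= -/(u n) -[N _](subrK (N 0)); apply: (le_trans (cabsD _ _)).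
  have := hN _ _ IH z0; rewrite subr0; lra.
have du n : cabs (u n.+1 - u n) <= cabs (N 0) * (1 / 2) ^+ n.
  elim: n => [|n IH]; first by rewrite /u /= subr0 mulr1.
  apply: (le_trans (hN _ _ (ux n.+1) (ux n))); rewrite exprSr; lra.
have sum n : \sum_(i < n) (u i.+1 - u i) = u n.
  by rewrite -(big_mkord predT (fun i => u i.+1 - u i)) telescope_sumr// subr0.
have hs n : \sum_(i < n) cabs (N 0) * (1 / 2) ^+ i <= 2 * cabs (N 0).
  rewrite -mulr_sumr mulrC ler_wpM2r//.
  have h2 : 0 <= 1 / 2 :> R by lra.
  have h3 : 1 / 2 < 1 :> R by lra.
  have := geometric_bin_sum 0 h2 h3 n; rewrite expr1.
  have -> : (1 - 1 / 2)^-1 = 2 :> R by field.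
  rewrite (eq_bigr (fun i : 'I_n => (1 / 2 : R) ^+ i)) // => i _.
  by rewrite addn0 bin0 (mul1r (_ ^+ _)).
have hu n : \sum_(i < n) cabs (u i.+1 - u i) <= 2 * cabs (N 0).
  by apply: le_trans (hs n); apply: ler_sum => i _; exact: du.
have cu := csumP (u := fun i => u i.+1 - u i) hu; set q := csum _ in cu.
have hq : cabs q <= 2 * cabs (N 0) by exact: csum_le du hs.
have {}cu : clim u q by apply: (clim_eq (N := 0%N)) cu => n _; exact: sum.
exists q => //; have qx : cabs q <= x by lra.
apply: (@clim_unique _ (fun n => u n.+1)); last first.
  by apply: clim_sub cu => n; exact: leqnSn.
move=> e e0; have [M hM] := cu e e0; exists M => n hn.
apply: (le_trans (hN _ _ (ux n) qx)); have := hM n hn; have := cabs_ge0 (u n - q); lra.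
Qed.

Lemma E4q0 : E4q (0 : C) = 1.
Proof.
rewrite E4qE (csum_head 1 (@tame_sigc R 3)) ?cabs0// big_ord_recl big_ord0 /sigc.
by rewrite !(mul0r, addr0, mulr0).
Qed.

Lemma E6q0 : E6q (0 : C) = 1.
Proof.
rewrite E6qE (csum_head 1 (@tame_sigc R 5)) ?cabs0// big_ord_recl big_ord0 /sigc.
by rewrite !(mul0r, addr0, mulr0, subr0).
Qed.

Lemma Dq0 : Dq (0 : C) = 0.
Proof. by rewrite /Dq E4q0 E6q0 !expr1n subrr mul0r. Qed.

Lemma lip1_E4 : lip1 (@E4q R) 240.
Proof. by have := lip1M (lip1_cst (240 : C)) (lip1_eisq R 2); rewrite mul0r add0r mulr1. Qed.

Opaque Dq E4q.

(* Fixed point of q |-> E_4^3 / w - (Delta - q). *)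
Lemma solve_E4_cube : exists W0 x0 K : R, [/\ 0 < x0, x0 <= 1 / 2, 0 < K &
  forall w : C, W0 <= cabs w -> exists q0 : C,
    [/\ 0 < cabs w, q0 != 0, cabs q0 <= 2 / cabs w, cabs (w * q0 - 1) <= K / cabs w &
      [/\ E4q q0 ^+ 3 - w * Dq q0 = 0,
       (forall q, cabs q <= x0 -> cabs w / 2 * cabs (q - q0) <= cabs (E4q q ^+ 3 - w * Dq q)) &
       (forall q, cabs q <= 190^-1 -> E4q q ^+ 3 - w * Dq q = 0 -> q = q0)]]].
Proof.
have h4 := lip1_E4.
have [K1 K10 hK1] := lip1_lip (lip1M h4 (lip1M h4 h4)).
have {h4} hE q q' : cabs q <= 1 / 2 -> cabs q' <= 1 / 2 ->
    cabs (E4q q ^+ 3 - E4q q' ^+ 3) <= K1 * cabs (q - q') /\ cabs (E4q q ^+ 3) <= K1.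
  move=> hq hq'; have e3 (x : C) : x ^+ 3 = x * (x * x) by rewrite !exprS expr0 mulr1.
  by rewrite !e3; exact: hK1.
have [K2 K20 hD] := lip1_D R.
pose x0 : R := Num.min (1 / 2) (1 / (4 * K2)).
have x00 : 0 < x0 by rewrite lt_min !divr_gt0// mulr_gt0.
have x02 : x0 <= 1 / 2 by rewrite ge_min lexx.
have Kx : K2 * x0 <= 1 / 4.
  have : x0 <= 1 / (4 * K2) by rewrite ge_min lexx orbT.
  by rewrite ler_pdivlMr ?mulr_gt0//; clearbody x0; lra.
pose K := 2 * K1 + 4 * K2; have K0 : 0 < K by rewrite /K; lra.
(* The first three terms of the threshold give K1/|w| <= 1/4, a fixed point inside the disc of
   radius x0, and no solution with x0 < |q| <= 1/190. *)
exists (4 * K1 + 2 / x0 + 20 * K1 / x0 + 1), x0, K; split=> // w hw.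
have a1 : 0 < 2 / x0 by rewrite divr_gt0.
have a2 : 0 < 20 * K1 / x0 by rewrite divr_gt0// mulr_gt0.
have wp : 0 < cabs w by lra.
have wn : w != 0 by rewrite -cabs_gt0.
have w1 : K1 / cabs w <= 1 / 4 by rewrite ler_pdivrMr//; lra.
have w2 : 2 <= x0 * cabs w.
  rewrite mulrC -ler_pdivrMr//; lra.
have w3 : 20 * K1 <= cabs w * x0 by rewrite -ler_pdivrMr//; lra.
pose N q := E4q q ^+ 3 / w - (Dq q - q).
have N0 : N 0 = w^-1 by rewrite /N E4q0 Dq0 expr1n mul1r !subr0.
have hN q q' : cabs q <= x0 -> cabs q' <= x0 -> cabs (N q - N q') <= cabs (q - q') / 2.
  move=> hq hq'; have [e1 _] := hE q q' (le_trans hq x02) (le_trans hq' x02).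
  have d1 := hD x0 q q' x02 hq hq'; have m0 := cabs_ge0 (q - q').
  have -> : N q - N q' = (E4q q ^+ 3 - E4q q' ^+ 3) / w - (Dq q - Dq q' - (q - q')).
    have gen (a b c d p r : C) : a / w - (b - p) - (c / w - (d - r)) = (a - c) / w - (b - d - (p - r)) by ring.
    exact: gen.
  apply: (le_trans (cabsB _ _)); rewrite cabsM cabsV.
  have e2 : cabs (E4q q ^+ 3 - E4q q' ^+ 3) / cabs w <= 1 / 4 * cabs (q - q').
    rewrite ler_pdivrMr//; apply: (le_trans e1); rewrite mulrAC; apply: ler_wpM2r => //.
    by rewrite -ler_pdivrMr.
  have d2 : K2 * x0 * cabs (q - q') <= 1 / 4 * cabs (q - q') by rewrite ler_wpM2r.
  lra.
have [|q0 hq0 fq0] := fixpoint hN.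
  by rewrite N0 cabsV -[_^-1]mul1r ler_pdivrMr//; clearbody x0; lra.
rewrite N0 cabsV in hq0.
have qx : cabs q0 <= x0 by apply: (le_trans hq0); rewrite ler_pdivrMr.
have q0E : E4q q0 ^+ 3 = w * Dq q0.
  move: fq0; rewrite /N => /eqP; rewrite opprB addrA -subr_eq0 addrAC addrK subr_eq0 => /eqP h.
  by rewrite -h mulrC divfK.
have z0 : cabs (0 : C) <= x0 by rewrite cabs0 ltW.
exists q0; split=> //.
- by apply/eqP => h; move/eqP: q0E; rewrite h E4q0 Dq0 expr1n mulr0 oner_eq0.
- have [e1 _] := hE q0 0 (le_trans qx x02) (le_trans z0 x02).
  rewrite E4q0 expr1n subr0 in e1.
  have c0 : cabs (0 : C) <= cabs q0 by rewrite cabs0 cabs_ge0.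
  have := hD (cabs q0) q0 0 (le_trans qx x02) (lexx _) c0; rewrite Dq0 !subr0 => d1.
  have -> : w * q0 - 1 = (E4q q0 ^+ 3 - 1) - w * (Dq q0 - q0) by rewrite q0E; ring.
  apply: (le_trans (cabsB _ _)); rewrite cabsM /K mulrDl; apply: lerD.
    by apply: (le_trans e1); rewrite -mulrA mulrCA ler_wpM2l ?(ltW K10).
  apply: (@le_trans _ _ (cabs w * (K2 * (2 / cabs w) * (2 / cabs w)))).
    apply: ler_wpM2l; first exact: ltW.
    apply: (le_trans d1).
    by apply: ler_pM; rewrite ?mulr_ge0 ?cabs_ge0 ?(ltW K20)// ler_wpM2l ?(ltW K20).
  by rewrite le_eqVlt; apply/orP; left; apply/eqP; field; rewrite gt_eqF.
(* Apart from - w (q - q0) there remains at most |w|/2 |q - q0|. The resulting lower bound gives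
   both uniqueness and simplicity of the zero. *)
have low q : cabs q <= x0 -> cabs w / 2 * cabs (q - q0) <= cabs (E4q q ^+ 3 - w * Dq q).
  move=> hq; have [e1 _] := hE q q0 (le_trans hq x02) (le_trans qx x02).
  have d1 := hD x0 q q0 x02 hq qx; have m0 := cabs_ge0 (q - q0).
  have gen (e d d0 p p0 : C) : e - w * d = - (w * (p - p0)) + ((e - w * d0) - w * (d - d0 - (p - p0))) by ring.
  have -> : E4q q ^+ 3 - w * Dq q = - (w * (q - q0)) +
     ((E4q q ^+ 3 - E4q q0 ^+ 3) - w * (Dq q - Dq q0 - (q - q0))) by rewrite q0E; exact: (gen (E4q q ^+ 3) (Dq q) (Dq q0) q q0).
  apply: le_trans (cabs_addl _ _); rewrite cabsN cabsM.
  have e2 : K1 * cabs (q - q0) <= cabs w / 4 * cabs (q - q0) by rewrite ler_wpM2r//; lra.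
  have d2 : cabs (w * (Dq q - Dq q0 - (q - q0))) <= cabs w * (1 / 4 * cabs (q - q0)).
    by rewrite cabsM; apply: ler_wpM2l; [exact: ltW|apply: (le_trans d1); exact: ler_wpM2r].
  have := cabsB (E4q q ^+ 3 - E4q q0 ^+ 3) (w * (Dq q - Dq q0 - (q - q0))).
  lra.
split=> //; first by rewrite q0E subrr.
move=> q hq hz; have [qx0|qx0] := leP (cabs q) x0.
  have := low q qx0; rewrite hz cabs0 pmulr_rle0 ?divr_gt0// => h.
  by apply/eqP; rewrite -subr_eq0 -cabs_eq0 eq_le cabs_ge0 h.
(* Between x0 and 1/190, |w Delta| > |w| x0 / 10 >= 2 K1, more than |E_4^3| can reach. *)
have q2 : cabs q <= 1 / 2 by lra.
have [_ e1] := hE q q q2 q2; have d1 := Dq_lb hq.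
have : cabs (w * Dq q) <= K1 by move/eqP: hz; rewrite subr_eq0 => /eqP <-.
rewrite cabsM => h.
have h2 : cabs w * (x0 / 10) < cabs w * cabs (Dq q).
  by rewrite ltr_pM2l//; apply: lt_le_trans d1; rewrite ltr_pM2r.
exfalso; clearbody x0; lra.
Qed.

End Solve.

(** * Simple zeros and branches of the logarithm *)

Section SimpleZeros.
Variable R : realType.
Local Notation C := R[i].

(** The bridge from explicit remainders to the filter-based derivatives in [holomorphic_uh] and
    [zero_order]. *)
Lemma expansion_derive (h : C -> C) (t a : C) (K d : R) : 0 < d -> 0 < K ->
  (forall u, cabs u <= d -> cabs (h (t + u) - h t - a * u) <= K * cabs u ^+ 2) ->
  derivable (h : C^o -> C^o) t 1 /\ derive1n 1 (h : C^o -> C^o) t = a.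
Proof.
move=> d0 K0 hh.
have key : ((fun u : C^o => u^-1 *: (h (u + t) - h t) : C^o) @ 0^' --> (a : C^o))%classic.
  apply/cvgrPdist_le => e e0.
  have e1 : 0 < complex.Re e by move: e0; rewrite ltcE /= => /andP[].
  have e2 : e = (complex.Re e)%:C.
    by move: e0; rewrite ltcE /= => /andP[/eqP h1 _]; case: (e) h1 => x y /= ->.
  pose m : R := Num.min d (complex.Re e / K).
  have m0 : 0 < m by rewrite lt_min d0 divr_gt0.
  have mC : 0 < (m%:C : C) by rewrite ltcR.
  near=> u.
  have u0 : u != 0 by near: u; exact: nbhs_dnbhs_neq.
  have um : cabs u <= m.
    rewrite -lecR -cabsE; near: u; exact: (dnbhs0_le mC).
  have /andP[ud ue] : (cabs u <= d) && (cabs u <= complex.Re e / K) by rewrite -le_min.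
  rewrite e2 cabsE lecR cabsC.
  have -> : u^-1 *: (h (u + t) - h t) - a = u^-1 * (h (t + u) - h t - a * u).
    rewrite [u + t]addrC; move: (h (t + u)) (h t) => x y.
    by transitivity (u^-1 * (x - y) - a); rewrite // [RHS]mulrBr [a * u]mulrC mulKf.
  rewrite cabsM cabsV mulrC ler_pdivrMr ?cabs_gt0//; apply: (le_trans (hh u ud)).
  rewrite expr2 mulrA ler_wpM2r ?cabs_ge0// mulrC -ler_pdivlMr//.
split.
  have e : (fun u : C^o => u^-1 *: (((h : C^o -> C^o) \o shift (t : C^o)) (u *: (1 : C^o)) - h t)) =
     (fun u : C^o => u^-1 *: (h (u + t) - h t) : C^o).
    by apply/funext => u; rewrite /= [u *: 1]mulr1.
  by rewrite /derivable e; apply/cvg_ex; exists a.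
by rewrite derive1n1 /derive1; apply: cvg_lim => //; exact: norm_hausdorff.
Unshelve. all: by end_near. Qed.

Lemma smooth2_expansion H tau : smooth2 H -> 0 < complex.Im tau -> exists a : C,
  exists2 K : R, 0 < K & exists2 d : R, 0 < d & forall u, cabs u <= d ->
    cabs (H (nome (tau + u)) - H (nome tau) - a * u) <= K * cabs u ^+ 2.
Proof.
move=> sH y0.
have r0 : 0 < cabs (nome tau) by rewrite cabs_gt0 nome_neq0.
have [K K0 [d d0 hK]] := smooth2_nome r0 (cabs_nome_lt1 y0) sH.
have [a [b [_ _ hb hu]]] := hK tau (lexx _).
exists a, (2 * K); first by rewrite mulr_gt0.
exists (Num.min 1 d); first by rewrite lt_min ltr01.
move=> u; rewrite le_min => /andP[u1 ud]; have {}hu := hu u ud.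
have u20 : 0 <= cabs u ^+ 2 by rewrite exprn_ge0 ?cabs_ge0.
rewrite -[X in cabs X](subrK (b * u ^+ 2)); apply: (le_trans (cabsD _ _)).
have h1 : cabs (b * u ^+ 2) <= K * cabs u ^+ 2 by rewrite cabsM cabsX ler_wpM2r.
have h2 : K * cabs u ^+ 3 <= K * cabs u ^+ 2.
  by rewrite ler_wpM2l ?(ltW K0)// [cabs u ^+ 3]exprS ler_piMl.
lra.
Qed.

Lemma derivable_nome H : smooth2 H -> holomorphic_uh (fun tau : C => H (nome tau)).
Proof.
move=> sH tau y0; have [a [K K0 [d d0 hK]]] := smooth2_expansion sH y0.
exact: (expansion_derive d0 K0 hK).1.
Qed.

(** With a zero derivative the quadratic remainder would contradict the linear lower bound at a
    small real increment. *)
Lemma zero_order1 H tau (c e : R) : smooth2 H -> 0 < complex.Im tau -> H (nome tau) = 0 ->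
  0 < c -> 0 < e -> (forall u, cabs u <= e -> c * cabs u <= cabs (H (nome (tau + u)))) ->
  zero_order (fun tau : C => H (nome tau)) tau 1.
Proof.
move=> sH y0 h0 c0 e0 hc; have [a [K K0 [d d0 hK]]] := smooth2_expansion sH y0.
split; first by case.
rewrite (expansion_derive d0 K0 hK).2; apply: contraT; rewrite negbK => /eqP a0.
pose x : R := Num.min (Num.min e d) (c / (2 * K)).
have x0 : 0 < x by rewrite !lt_min e0 d0 divr_gt0// mulr_gt0.
have /and3P[xe xd xc] : [&& x <= e, x <= d & x <= c / (2 * K)].
  by have := lexx x; rewrite {2}/x !le_min -!andbA.
have xx : cabs (x%:C : C) = x by rewrite cabs_real ger0_norm ?(ltW x0).
have h1 := hc x%:C; rewrite xx in h1; have {}h1 := h1 xe.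
have h2 := hK x%:C; rewrite xx h0 a0 mul0r !subr0 in h2; have {}h2 := h2 xd.
have h3 := le_trans h1 h2.
rewrite ler_pdivlMr ?mulr_gt0// in xc.
rewrite expr2 mulrA ler_pM2r// in h3.
clearbody x; lra.
Qed.

Lemma zero_order0 (h : C -> C) t : h t != 0 -> zero_order h t 0.
Proof. by move=> ht; split. Qed.

(** Factor r is bounded below linearly by the hypothesis on |p - q_r|, the other factors by a
    constant because the q_j are distinct, and Delta by |q|/10. The bounds x0/2 and 1/380 leave room
    for a neighbourhood inside the discs of radius x0 and 1/190. *)
Lemma simple_zero D (n : nat) (w q : 'I_D -> C) (x0 : R) (r : 'I_D) t : 0 < x0 ->
  (forall j, 0 < cabs (w j)) ->
  (forall j p, cabs p <= x0 -> cabs (w j) / 2 * cabs (p - q j) <= cabs (E4q p ^+ 3 - w j * Dq p)) ->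
  injective q -> q r != 0 -> cabs (q r) <= x0 / 2 -> cabs (q r) <= 380^-1 -> nome t = q r ->
  exists c : R, 0 < c /\ exists2 e : R, 0 < e & forall u, cabs u <= e ->
    c * cabs u <= cabs (Dq (nome (t + u)) ^+ n * \prod_(j < D) (E4q (nome (t + u)) ^+ 3 - w j * Dq (nome (t + u)))).
Proof.
move=> x00 w0 low qi qr0 qrx qr380 ht.
have a0 : 0 < cabs (q r) by rewrite cabs_gt0.
have [|g g0 hg] := @finite_lower R 'I_D (fun j => if j == r then 1 else cabs (q r - q j)).
  move=> j; case: eqVneq => // jr; rewrite cabs_gt0 subr_eq0.
  by apply: contraNneq jr => /qi ->.
have [|m m0 hm] := @finite_lower R 'I_D (fun j => cabs (w j) / 2 * (g / 2)).
  by move=> j; rewrite mulr_gt0 ?divr_gt0.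
pose b : R := Num.min (Num.min (x0 / 2) (cabs (q r) / 2)) (Num.min (g / 2) 380^-1).
have b0 : 0 < b.
  have i1 : 0 < x0 / 2 by rewrite divr_gt0.
  have i2 : 0 < cabs (q r) / 2 by rewrite divr_gt0.
  have i3 : 0 < g / 2 by rewrite divr_gt0.
  have i4 : 0 < 380^-1 :> R by rewrite invr_gt0 ltr0n.
  by rewrite !lt_min i1 i2 i3 i4.
have /and4P[bx bq bg b380] : [&& b <= x0 / 2, b <= cabs (q r) / 2, b <= g / 2 & b <= 380^-1].
  by have := lexx b; rewrite {2}/b !le_min -!andbA.
clearbody b.
exists ((cabs (q r) / 20) ^+ n * (cabs (w r) / 2 * (cabs (q r) / 2) * m ^+ D.-1)); split.
  by rewrite !mulr_gt0 ?exprn_gt0 ?divr_gt0// ?mulr_gt0.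
exists (Num.min 80^-1 (b / (16 * cabs (q r)))).
  have i1 : 0 < 80^-1 :> R by rewrite invr_gt0 ltr0n.
  by rewrite lt_min i1 divr_gt0// mulr_gt0.
move=> u; rewrite le_min ler_pdivlMr ?mulr_gt0// => /andP[u80 ub].
pose c : C := 2 * pi%:C * 'i%C.
have cE : cabs c = 2 * pi.
  by rewrite /c !cabsM cabs_nat cabsi cabs_real mulr1 ger0_norm ?pi_ge0.
have p3 := @pi_ge31 R; have p4 := @pi_le4 R.
have u0 := cabs_ge0 u; set U := c * u.
have U1 : cabs u <= cabs U by rewrite cabsM cE ler_peMl//; lra.
have U8 : cabs U <= 8 * cabs u by rewrite cabsM cE ler_wpM2r//; lra.
have U10 : cabs U <= 1 / 10 by lra.
have hlin : cabs (cexp U - 1 - U) <= 5 * cabs U ^+ 2 by apply: cexp_lin; lra.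
have U2 : cabs U ^+ 2 <= 1 / 10 * cabs U by rewrite expr2 ler_wpM2r ?cabs_ge0.
have lo : cabs u / 2 <= cabs (cexp U - 1).
  have := cabs_addl U (cexp U - 1 - U); have -> : U + (cexp U - 1 - U) = cexp U - 1 by ring.
  lra.
have hi : cabs (cexp U - 1) <= 16 * cabs u.
  rewrite -[X in cabs X](subrK U); apply: (le_trans (cabsD _ _)); lra.
set p := nome (t + u).
have pE : p - q r = q r * (cexp U - 1).
  by rewrite /p nomeD ht [nome u]/nome -/c -/U mulrBr mulr1.
have plo : cabs (q r) / 2 * cabs u <= cabs (p - q r).
  rewrite pE cabsM mulrAC -mulrA ler_wpM2l ?cabs_ge0//.
have phi : cabs (p - q r) <= b.
  by rewrite pE cabsM; apply: le_trans ub; have := ler_wpM2l (cabs_ge0 (q r)) hi; lra.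
have hp : cabs p <= cabs (q r) + b.
  rewrite -(subrK (q r) p) addrC; apply: (le_trans (cabsD _ _)); lra.
have hp' : cabs (q r) / 2 <= cabs p.
  have := cabs_addl (q r) (p - q r); have -> : q r + (p - q r) = p by ring.
  lra.
have px : cabs p <= x0 by lra.
have p190 : cabs p <= 190^-1 by lra.
rewrite cabsM cabsX cabs_prod -mulrA; apply: ler_pM.
- by rewrite exprn_ge0// divr_ge0// ltW.
- by rewrite !mulr_ge0 ?divr_ge0 ?exprn_ge0 ?cabs_ge0// ltW.
- apply: ler_expr_base; first by rewrite divr_ge0// ltW.
  by apply: le_trans (Dq_lb p190); lra.
rewrite (bigD1 r)//= mulrAC; apply: ler_pM.
- by rewrite !mulr_ge0 ?divr_ge0 ?cabs_ge0.
- by rewrite exprn_ge0// ltW.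
- apply: le_trans (low r p px); rewrite -[leLHS]mulrA; apply: ler_wpM2l => //.
  by rewrite divr_ge0 ?cabs_ge0.
have <- : #|[pred i | i != r]| = D.-1 by rewrite cardC1 card_ord.
rewrite -prodr_const; apply: ler_prod => j jr; rewrite (ltW m0) /=.
apply: (le_trans (hm j)); apply: le_trans (low j p px).
rewrite ler_wpM2l ?divr_ge0 ?cabs_ge0//.
have := hg j; rewrite (negPf jr) => hgj.
have := cabsB (p - q j) (p - q r); have -> : p - q j - (p - q r) = q r - q j by ring.
lra.
Qed.

Lemma nome_clog (Z : C) : Z != 0 -> nome ('i%C / (2 * pi%:C) * clog Z) = Z^-1.
Proof.
move=> Z0; rewrite /nome -[Z in RHS](clogK Z0) -cexpN; congr cexp.
have p0 : pi%:C != 0 :> C by rewrite eq_complex /= gt_eqF ?pi_gt0.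
have i2 : 'i%C * 'i%C = -1 :> C by rewrite -expr2 sqr_i.
move: (clog Z) (pi%:C) p0 i2 => c p p0; move: 'i%C => i i2.
have -> : 2 * p * i * (i / (2 * p) * c) = (i * i) * c by field.
by rewrite i2 mulN1r.
Qed.

Lemma Re_clog (Z : C) : complex.Re ('i%C / (2 * pi%:C) * clog Z) = - (carg Z / (2 * pi)).
Proof.
have -> : (2 : C) = (2 : R)%:C by rewrite rmorph_nat.
have p0 : pi != 0 :> R by rewrite gt_eqF ?pi_gt0.
rewrite -rmorphM -fmorphV /clog; move: (ln _) (carg _) (_^-1) => x y v.
by rewrite !cReM !cImM /=; ring.
Qed.

(* The strip of [tau] and the branch of [clog] are cut at the two different ends
   [Re = -1/2] and [Re = 1/2], hence the last two cases. *)
Lemma log_near (Z tau : C) (e : R) : Z != 0 -> - 2^-1 <= complex.Re tau -> complex.Re tau < 2^-1 ->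
  cabs (nome tau * Z - 1) <= e -> e <= 1 / 2 -> 
  let L := 'i%C / (2 * pi%:C) * clog Z in
  [\/ cabs (tau - L) <= 2 * e,
      cabs (tau + 1 - L) <= 2 * e /\ carg Z <= - pi + 4 * pi * e |
      cabs (tau - 1 - L) <= 2 * e /\ pi - 4 * pi * e <= carg Z].
Proof.
move=> Z0 t1 t2 he e2 L.
have p0 := @pi_gt0 R; have p3 := @pi_ge31 R.
have [c1 c2 _ _] := cargP Z0.
have ReL : complex.Re L = - (carg Z / (2 * pi)) by exact: Re_clog.
have nL : nome L = Z^-1 by exact: nome_clog.
have e0 : 0 <= e by apply: le_trans he; exact: cabs_ge0.
set x := carg Z / (2 * pi) in ReL.
have cx : carg Z = 2 * pi * x by rewrite /x mulrC divfK// gt_eqF// mulr_gt0.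
have x1 : - 2^-1 <= x by rewrite /x ler_pdivlMr ?mulr_gt0//; lra.
have x2 : x < 2^-1 by rewrite /x ltr_pdivrMr ?mulr_gt0//; lra.
(* [cexp_near1] bounds 2 pi |s| by 8 e, and 2 pi >= 4. *)
have main (s : C) : nome s = nome tau * Z -> `|complex.Re s| <= 2^-1 -> cabs s <= 2 * e.
  move=> hs hRe; have hz : nome s = cexp (2 * pi%:C * 'i%C * s) by [].
  have := @cexp_near1 R (2 * pi%:C * 'i%C * s) e; rewrite -hz hs.
  have -> : complex.Im (2 * pi%:C * 'i%C * s) = 2 * pi * complex.Re s by rewrite nome_argE.
  rewrite normrM ger0_norm ?mulr_ge0 ?(ltW p0)// => /(_ _ he e2).
  have -> : cabs (2 * pi%:C * 'i%C * s) = 2 * pi * cabs s.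
    by rewrite !cabsM cabs_nat cabsi cabs_real mulr1 ger0_norm ?pi_ge0.
  have s0 := cabs_ge0 s.
  move=> h; have {}h : 2 * pi * cabs s <= 8 * e by apply: h; nra.
  nra.
have nD (s : C) (n : C) : nome n = 1 -> nome (tau - L + n) = nome tau * Z.
  by move=> n1; rewrite nomeD n1 mulr1 nomeD nomeN nL invrK.
have n1 : nome (1 : C) = 1 by exact: nome1.
have nN1 : nome (-1 : C) = 1 by rewrite nomeN nome1 invr1.
have Re0 : complex.Re (tau - L) = complex.Re tau + x by rewrite cReD cReN ReL opprK.
have [h1|h1] := leP (complex.Re tau + x) (- 2^-1).
  have hh : cabs (tau - L + 1) <= 2 * e.
    apply: main; first exact: (nD tau).
    by rewrite cReD Re0 /= ler_norml; lra.
  apply: Or32; rewrite addrAC; split=> //.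
  have := le_trans (cabsRe (tau - L + 1)) hh; rewrite cReD Re0 /= ler_norml => /andP[_ h].
  rewrite cx; nra.
have [h2|h2] := leP 2^-1 (complex.Re tau + x).
  have hh : cabs (tau - L - 1) <= 2 * e.
    apply: main; first exact: (nD tau).
    by rewrite cReD Re0 cReN /= ler_norml; lra.
  apply: Or33; rewrite addrAC; split=> //.
  have := le_trans (cabsRe (tau - L - 1)) hh; rewrite cReD Re0 cReN /= ler_norml => /andP[h _].
  rewrite cx; nra.
apply: Or31; apply: main; first by rewrite nomeD nomeN nL invrK.
by rewrite Re0 ler_norml; lra.
Qed.

Lemma carg_scale (t : R) (z : C) : 0 < t -> carg (t%:C * z) = carg z.
Proof.
move=> t0; rewrite /carg cReM cImM cabsM cabs_real (gtr0_norm t0) /= !mul0r subr0 addr0.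
by rewrite pmulr_rgt0// -mulf_div divff ?gt_eqF// mul1r.
Qed.

(** A wrong branch requires an argument approaching the cut. The argument of 2 k z is that of z, so
    a fixed gap rules this out unless z is negative. *)
Lemma carg_gap (z : C) : z != 0 -> exists2 g : R, 0 < g & carg z <= pi - g /\
  (z < 0 \/ - pi + g <= carg z).
Proof.
move=> z0; have [c1 c2 c3 c4] := cargP z0.
have [h|h] := eqVneq (carg z) (- pi).
  exists (pi - carg z); first by lra.
  split; first by lra.
  left; rewrite ltcE /=; rewrite h cosN sinN cospi sinpi oppr0 mulr0 mulrN1 in c3 c4.
  by rewrite -c3 -c4 eqxx oppr_lt0 cabs_gt0.
have h2 : - pi < carg z by rewrite lt_neqAle eq_sym h.
exists (Num.min (pi - carg z) (pi + carg z)); first by rewrite lt_min; apply/andP; split; lra.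
have l1 : Num.min (pi - carg z) (pi + carg z) <= pi - carg z by rewrite ge_min lexx.
have l2 : Num.min (pi - carg z) (pi + carg z) <= pi + carg z by rewrite ge_min lexx orbT.
by split; [lra|right; lra].
Qed.

End SimpleZeros.

(** * Listing the zeros and comparing logarithms *)

Section ZeroAsymptotics.
Variable R : realType.

Lemma smooth2_prod (I : Type) (s : seq I) (F : I -> R[i] -> R[i]) :
  (forall i, smooth2 (F i)) -> smooth2 (fun q => \prod_(i <- s) F i q).
Proof.
move=> h; elim: s => [|i s IH].
  by have := smooth2_cst (1 : R[i]); congr smooth2; apply/funext => q; rewrite big_nil.
by have := smooth2M (h i) IH; congr smooth2; apply/funext => q; rewrite big_cons.
Qed.

(** The square of the imaginary part is at least 3/4, which exceeds (17/20)^2. *)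
Lemma fund_domain_Im (t : R[i]) : fund_domain t -> 17 / 20 <= complex.Im t.
Proof.
move=> [t0 /andP[t1 t2] t3 _]; rewrite leNgt; apply/negP => h.
have t0' : 0 < complex.Im t := t0.
have h1 : 1 <= cabs t ^+ 2 by rewrite exprn_ege1.
have h2 : complex.Re t ^+ 2 <= 2^-1 ^+ 2.
  by rewrite -real_normK ?num_real// ler_expr_base// ler_norml t1 ltW.
have h3 : complex.Im t ^+ 2 <= (17 / 20) ^+ 2 by rewrite ler_expr_base// ltW.
rewrite cabs_sqr in h1; lra.
Qed.

Lemma fund_domain_high (t : R[i]) : 1 < complex.Im t -> - 2^-1 <= complex.Re t ->
  complex.Re t < 2^-1 -> fund_domain t.
Proof.
move=> t0 t1 t2; have h : 1 < cabs t.
  by apply: lt_le_trans (cabsIm t); apply: lt_le_trans t0 (ler_norm _).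
split; rewrite ?t1 ?t2//.
- by rewrite /upper_half /=; apply: lt_trans t0.
- exact: ltW.
by move=> e; rewrite e ltxx in h.
Qed.

(** Every point of the fundamental domain has nome at most 1/190 in modulus, where each factor has a
    single root. The strip makes the nome injective, and Delta has no zero. *)
Lemma product_zeros D (n : nat) (w q tau : 'I_D -> R[i]) (x0 : R) : 0 < x0 ->
  (forall r, 0 < cabs (w r)) ->
  (forall r p, cabs p <= x0 -> cabs (w r) / 2 * cabs (p - q r) <= cabs (E4q p ^+ 3 - w r * Dq p)) ->
  (forall r, E4q (q r) ^+ 3 - w r * Dq (q r) = 0) ->
  (forall r p, cabs p <= 190^-1 -> E4q p ^+ 3 - w r * Dq p = 0 -> p = q r) ->
  injective q -> (forall r, cabs (q r) <= x0 / 2) -> (forall r, cabs (q r) <= 380^-1) ->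
  (forall r, nome (tau r) = q r) -> (forall r, fund_domain (tau r)) ->
  lists_zeros (fun t => Dq (nome t) ^+ n * \prod_(r < D) (E4q (nome t) ^+ 3 - w r * Dq (nome t))) tau.
Proof.
move=> x00 w0 low qz uq qi qx q380 ht hf; split=> // t ft.
have t17 := fund_domain_Im ft; have tq := nome_small t17.
have t0 : 0 < complex.Im t by lra.
have taui : injective tau by move=> r j e; apply: qi; rewrite -!ht e.
pose H p := Dq p ^+ n * \prod_(r < D) (E4q p ^+ 3 - w r * Dq p).
have sH : smooth2 H.
  apply: smooth2M; first exact/smooth2X/smooth2_D.
  apply: smooth2_prod => r; apply: smooth2B; first exact/smooth2X/smooth2_E4.
  exact/smooth2Z/smooth2_D.
have [[r hr]|nr] := pselect (exists r, tau r = t).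
  have -> : #|[pred r | tau r == t]| = 1%N.
    rewrite -(card1 r); apply: eq_card => j; rewrite !inE -hr.
    by apply/eqP/eqP => [/taui|->].
  have qr0 : q r != 0 by rewrite -ht nome_neq0.
  have htq : nome t = q r by rewrite -hr.
  have [c [c0 [e e0 hc]]] := simple_zero n x00 w0 low qi qr0 (qx r) (q380 r) htq.
  apply: (@zero_order1 R H t c e sH t0 _ c0 e0 hc).
  by rewrite /H (bigD1 r)//= htq qz mul0r mulr0.
rewrite eq_card0; last by move=> j; rewrite !inE; apply/negP => /eqP e; apply: nr; exists j.
apply: zero_order0; rewrite mulf_neq0 ?expf_neq0 ?Dq_neq0//.
apply/prodf_neq0 => r _; apply/eqP => /(uq r _ tq) e; apply: nr; exists r.
have [_ /andP[a1 a2] _ _] := ft; have [_ /andP[b1 b2] _ _] := hf r.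
by apply: nome_inj; rewrite ?ht.
Qed.

(** q Z - 1 = (w q - 1) - q (w - Z) is O(1/k), the input of [log_near]. The strict smallness
    condition gives 4 pi e < g, which excludes a wrong branch except for negative z. *)
Lemma log_asymptotics (w q tau z Z : R[i]) (k K1 K3 cz g : R) : 0 < k -> 0 < cz -> 0 < g -> 0 < K1 ->
  0 < K3 -> Z = (2 * k)%:C * z -> cz <= cabs z -> k * cz <= cabs w -> cabs (w - Z) <= K1 ->
  cabs q <= 2 / cabs w -> cabs (w * q - 1) <= K3 / cabs w ->
  - 2^-1 <= complex.Re tau -> complex.Re tau < 2^-1 -> nome tau = q ->
  2 * (K3 + 2 * K1) <= k * cz -> 16 * (K3 + 2 * K1) < k * cz * g ->
  carg z <= pi - g -> (z < 0 \/ - pi + g <= carg z) ->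
  let L := 'i%C / (2 * pi%:C) * clog Z in
  cabs (tau - L) <= 2 * (K3 + 2 * K1) / cz / k \/
  (z < 0 /\ cabs (tau + 1 - L) <= 2 * (K3 + 2 * K1) / cz / k).
Proof.
move=> k0 cz0 g0 K10 K30 ZE hz hw hwZ hq hwq t1 t2 ht c1 c2 a1 a2 L.
have kc : 0 < k * cz by rewrite mulr_gt0.
have w0 : 0 < cabs w by apply: lt_le_trans hw.
have k2 : 0 < 2 * k by rewrite mulr_gt0.
have z0 : 0 < cabs z by apply: lt_le_trans hz.
have Z0 : Z != 0.
  by rewrite ZE -cabs_gt0 cabsM cabs_real gtr0_norm// mulr_gt0.
have cZ : carg Z = carg z by rewrite ZE carg_scale.
pose e := (K3 + 2 * K1) / (k * cz).
have he : cabs (nome tau * Z - 1) <= e.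
  rewrite ht; have -> : q * Z - 1 = (w * q - 1) - q * (w - Z) by ring.
  apply: (le_trans (cabsB _ _)); rewrite cabsM.
  have h1 : cabs q * cabs (w - Z) <= 2 / cabs w * K1 by rewrite ler_pM ?cabs_ge0.
  apply: (le_trans (lerD hwq h1)).
  rewrite [2 / cabs w * K1]mulrAC -mulrDl /e ler_wpM2l//; first by lra.
  by rewrite lef_pV2 ?posrE.
have e2 : e <= 1 / 2 by rewrite /e ler_pdivrMr//; lra.
have e16 : 16 * e < g.
  by rewrite /e mulrA ltr_pdivrMr// mulrC [g * _]mulrC; move: c2; rewrite [16 * _]mulrC.
have eE : 2 * e = 2 * (K3 + 2 * K1) / cz / k.
  by rewrite /e; field; rewrite !gt_eqF.
have p4 := @pi_le4 R; have p0 := @pi_gt0 R.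
have e0 : 0 <= e by apply: le_trans he; exact: cabs_ge0.
have pe : 4 * pi * e < g by apply: le_lt_trans e16; nra.
rewrite -eE; have := log_near Z0 t1 t2 he e2; rewrite /= -/L cZ.
case=> [h|[h hc]|[h hc]]; first by left.
- by right; split=> //; case: a2 => // a2; exfalso; lra.
- by exfalso; lra.
Qed.

Lemma le_of_sum7 (x1 x2 x3 x4 x5 x6 x7 y : R) : 0 <= x1 -> 0 <= x2 -> 0 < x3 -> 0 < x4 -> 0 < x5 ->
  0 <= x6 -> 0 < x7 -> x1 + x2 + x3 + x4 + x5 + x6 + x7 <= y ->
  [/\ x1 <= y, x2 <= y, x3 < y & x4 < y] /\ [/\ x5 < y, x6 <= y & x7 < y].
Proof. by move=> *; split; split; lra. Qed.

End ZeroAsymptotics.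

(** * Asymptotics of the zeros of f / E_k' *)

Theorem theorem1p1 (R : realType) (D : nat) (hD : (1 <= D)%N) (C : R)
    (hC : 0 < C) :
  exists (K : R) (k0 : nat),
  forall (z : 'I_D -> R[i]), inverse_zeros z ->
  forall (k l k' : nat), ~~ odd k -> k = (12 * l + k')%N ->
    k' \in [:: 0; 4; 6; 8; 10; 14]%N -> (D.+1 <= l)%N -> (k0 <= k)%N ->
  forall (f : R[i] -> R[i]) (a : nat -> R[i]),
    cusp_form k f -> has_shape f l D a ->
    (forall j, (1 <= j <= D)%N -> cabs (a j) <= C) ->
  exists h : R[i] -> R[i],
    [/\ holomorphic_uh h,
        (forall t, upper_half t -> f t = h t * eisenstein k' t) &
        exists tau : 'I_D -> R[i],
          lists_zeros h tau /\
          forall r : 'I_D,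
            let L := 'i%C / (2 * pi%:C) * clog (2 * k%:R * z r) in
            cabs (tau r - L) <= K / k%:R \/
            (z r < 0 /\ cabs (tau r + 1 - L) <= K / k%:R)].
Proof.
have [K1 [s1 [K10 hfac]]] := cusp_form_factor hD hC.
have [W0 [x0 [K3 [x00 x02 K30 hsol]]]] := solve_E4_cube R.
have [[z0 hz0]|none] := pselect (exists z0 : 'I_D -> R[i], inverse_zeros z0); last first.
  by exists 0, 0%N => z hz; case: none; exists z.
have [d d0 hd] : exists2 d : R, 0 < d & forall r j, r != j -> d <= cabs (z0 r - z0 j).
  have [|d d0 hd] := @finite_lower R ('I_D * 'I_D)%type
      (fun p => if p.1 == p.2 then 1 else cabs (z0 p.1 - z0 p.2)).
    move=> [r j] /=; case: eqVneq => // rj; rewrite cabs_gt0 subr_eq0.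
    by rewrite (inj_eq (inverse_zeros_inj hz0)).
  by exists d => // r j rj; have := hd (r, j); rewrite /= (negPf rj).
have [|cz cz0 hcz] := @finite_lower R 'I_D (fun i => cabs (z0 i)).
  by move=> i; rewrite cabs_gt0 (inverse_zeros_neq0 hz0).
have hg i : exists g : R, 0 < g /\ (carg (z0 i) <= pi - g /\ (z0 i < 0 \/ - pi + g <= carg (z0 i))).
  by have [g g0 hg] := carg_gap (inverse_zeros_neq0 hz0 i); exists g.
have [gs hgs] := choice hg.
have [|g g0 hgg] := @finite_lower R 'I_D gs; first by move=> i; exact: (hgs i).1.
have {hg} hg i : carg (z0 i) <= pi - g /\ (z0 i < 0 \/ - pi + g <= carg (z0 i)).
  have [_ [h1 h2]] := hgs i; have gi := hgg i; split; first by lra.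
  by case: h2 => h2; [left|right; lra].
(* |q| < e^(-2 pi) means height above 1, where the whole strip lies in the fundamental domain. *)
pose E : R := expR (- (2 * pi)).
have E0 : 0 < E by exact: expR_gt0.
pose B1 := 4 / x0; pose B2 := 2 / E; pose B3 := 2 * (K3 + 2 * K1); pose B4 := 16 * (K3 + 2 * K1) / g.
have B10 : 0 < B1 by rewrite divr_gt0.
have B20 : 0 < B2 by rewrite divr_gt0.
have B30 : 0 < B3 by rewrite mulr_gt0//; lra.
have B40 : 0 < B4 by rewrite divr_gt0// mulr_gt0//; lra.
(* A bound k cz >= B yields seven facts at once: |w_r| >= k cz from K1, solvability from |W0|, |q_r|
   below x0/2, 1/380 and E from 4/x0, 760 and 2/E, and a logarithmic error at most 1/2 and below the
   gap g from the last two. *)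
pose B : R := K1 + `|W0| + B1 + 760 + B2 + B3 + B4.
have W00 : 0 <= `|W0| by exact: normr_ge0.
(* The last term keeps the w_r distinct: w_r = w_j would give 2 k d <= 2 K1. *)
pose X : R := `|s1| + B / cz + (K1 + 1) / d.
have Bp : 0 < B by rewrite /B; lra.
have X1 : 0 <= B / cz by rewrite divr_ge0 ?ltW.
have X2 : 0 <= (K1 + 1) / d by rewrite divr_ge0 ?(ltW d0)//; lra.
have X3 : 0 <= `|s1| by exact: normr_ge0.
exists (B3 / cz), (Num.truncn X).+1 => z hz k l k' _ kE hk' hl hk0 f a cf sh ha.
have kX : X < k%:R.
  by apply: (lt_le_trans (Num.Theory.truncnS_gt X)); rewrite ler_nat.
have kp : 0 < k%:R :> R by apply: le_lt_trans kX; rewrite /X; lra.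
have kB : B <= k%:R * cz by rewrite -ler_pdivrMr//; apply: ltW; apply: le_lt_trans kX; rewrite /X; lra.
have kd : K1 + 1 <= k%:R * d by rewrite -ler_pdivrMr//; apply: ltW; apply: le_lt_trans kX; rewrite /X; lra.
have ks : s1 <= k%:R.
  by apply: (le_trans (ler_norm s1)); apply: ltW; apply: le_lt_trans kX; rewrite /X; lra.
have [[kB1 kB2 kB3 kB4] [kB5 kB6 kB7]] := le_of_sum7 (ltW K10) W00 B10 (ltr0Sn R 759) B20 (ltW B30) B40 kB.
have [w [hw hf]] := hfac z hz k l k' kE hk' hl ks f a cf sh ha.
have zE r : exists i, z r = z0 i by exact: inverse_zeros_same.
have ZE r : 2 * k%:R * z r = (2 * k%:R : R)%:C * z r.
  by rewrite rmorphM !rmorph_nat.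
have zc r : cz <= cabs (z r) by have [i ->] := zE r.
have zd r j : r != j -> d <= cabs (z r - z j).
  move=> rj; have [i hi] := zE r; have [m hm] := zE j.
  rewrite hi hm; apply: hd; apply: contraNneq rj => e; apply/eqP/(inverse_zeros_inj hz).
  by rewrite hi hm e.
have Zc r : 2 * (k%:R * cz) <= cabs (2 * k%:R * z r).
  by rewrite !cabsM !cabs_nat -mulrA ler_wpM2l// ler_wpM2l ?(ltW kp).
have wc r : k%:R * cz <= cabs (w r).
  have := hw r; have := Zc r; have := cabs_subl (2 * k%:R * z r) (w r); rewrite cabsC.
  move: kB1; move: (k%:R * cz) (cabs (w r)) (cabs _) (cabs _) => a1 a2 a3 a4; clear; lra.
have wd r j : r != j -> w r != w j.
  move=> rj; apply/eqP => e; have h1 := hw r; have h2 := hw j; rewrite -e in h2.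
  have : cabs (2 * k%:R * (z r - z j)) <= 2 * K1.
    have -> : 2 * k%:R * (z r - z j) = (w r - 2 * k%:R * z j) - (w r - 2 * k%:R * z r) by ring.
    by apply: (le_trans (cabsB _ _)); lra.
  rewrite !cabsM !cabs_nat; have := ler_wpM2l (ltW kp) (zd r j rj); lra.
have hW r : W0 <= cabs (w r).
  by apply: le_trans (wc r); apply: le_trans kB2; exact: ler_norm.
have ex r := hsol (w r) (hW r).
have [q hq] := choice ex.
have ext r : exists t : R[i], [/\ - 2^-1 <= complex.Re t, complex.Re t < 2^-1 & nome t = q r].
  by apply: nome_surj; have [_ ->] := hq r.
have [tau htau] := choice ext.
have wp r : 0 < cabs (w r) by have [] := hq r.
have q2 r (y : R) : 0 < y -> 2 / y < k%:R * cz -> cabs (q r) < y.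
  move=> y0 hy; have [_ _ h _ _] := hq r; apply: (le_lt_trans h).
  rewrite ltr_pdivrMr// mulrC -ltr_pdivrMr//; exact: lt_le_trans (wc r).
have qx r : cabs (q r) <= x0 / 2.
  apply/ltW/q2; first by rewrite divr_gt0.
  by have -> : 2 / (x0 / 2) = B1 by rewrite /B1; field; rewrite gt_eqF.
have q380 r : cabs (q r) <= 380^-1.
  apply/ltW/q2; first by rewrite invr_gt0 ltr0n.
  by rewrite invrK -natrM.
have qE r : cabs (q r) < E.
  exact: q2.
have qz r : E4q (q r) ^+ 3 - w r * Dq (q r) = 0 by have [_ _ _ _ []] := hq r.
have qi : injective q.
  move=> r j e; apply/eqP; apply: contraT => rj; move/negP: (wd r j rj); case; apply/eqP.
  have h1 := qz r; have h2 := qz j; rewrite -e in h2.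
  have Dn : Dq (q r) != 0.
    have [_ _ <-] := htau r; apply: Dq_neq0; apply: nome_upper.
    by have [_ _ ->] := htau r; apply: (le_lt_trans (q380 r)); clear; lra.
  apply: (mulIf Dn); apply/eqP; rewrite -subr_eq0; apply/eqP.
  by rewrite -[LHS]opprK -[0]oppr0 -h1 -[X in _ - X]addr0 -h2; ring.
have tfd r : fund_domain (tau r).
  have [t1 t2 t3] := htau r; apply: fund_domain_high => //.
  have := qE r; rewrite -t3 cabs_nome /E ltr_expR ltrN2 -{1}[2 * pi]mulr1 ltr_pM2l// mulr_gt0// pi_gt0.
  by [].
pose H t := Dq t ^+ (l - D) * \prod_(r < D) (E4q t ^+ 3 - w r * Dq t).
have sH : smooth2 H.
  apply: smooth2M; first exact/smooth2X/smooth2_D.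
  apply: smooth2_prod => r; apply: smooth2B; first exact/smooth2X/smooth2_E4.
  exact/smooth2Z/smooth2_D.
exists (fun t => H (nome t)); split.
- exact: derivable_nome.
- by move=> t t0; rewrite (hf t t0) eisensteinE// mulrC.
exists tau; split.
  apply: (product_zeros (l - D) x00 wp _ qz _ qi qx q380 _ tfd).
  - by move=> r p hp; have [_ _ _ _ [_ low _]] := hq r; exact: low.
  - by move=> r p hp; have [_ _ _ _ [_ _ u]] := hq r; exact: u.
  - by move=> r; have [_ _ ->] := htau r.
move=> r; have [_ _ h1 h2 _] := hq r; have [t1 t2 t3] := htau r.
have [g1 g2] : carg (z r) <= pi - g /\ (z r < 0 \/ - pi + g <= carg (z r)).
  by have [i ->] := zE r; exact: hg.
apply: (log_asymptotics (w := w r) (q := q r) kp cz0 g0 K10 K30 (ZE r) (zc r) (wc r) (hw r) h1 h2 t1 t2 t3 _ _ g1 g2).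
  exact: kB6.
by rewrite -ltr_pdivrMr.
Qed.
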